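(* Let $\mathfrak{A}$ be a $*$-algebra containing the $C^*$-algebra $\mathfrak{B}$ as a $*$-subalgebra, endowed with two conditional expectations $\Phi,\Psi:\mathfrak{A}\to\mathfrak{B}$. Let $(X_n)_{n\ge1}$ be a sequence of elements of $\mathfrak{A}$, c-free with respect to $(\Phi,\Psi)$, such that: (1) all $X_n$ have the same moment-generating multilinear function series, $\mathfrak{M}$ with respect to $\Phi$ and $M$ with respect to $\Psi$; (2) $\Psi(X_n)=\Phi(X_n)=0$. Set $S_N=\dfrac{X_1+\dots+X_N}{\sqrt N}$. Then: (i) $\lim_{N\to\infty}{}^cR_{S_N}=(0,\mathfrak{M}_1(\cdot),0,\dots)$; (ii) $\lim_{N\to\infty}R_{S_N}=(0,M_1(\cdot),0,\dots)$; (iii) there exist two conditional expectations $\nu:\mathfrak{B}\langle\xi\rangle\to\mathfrak{B}$, depending only on $M_1(\cdot)$, and $\mu:\mathfrak{B}\langle\xi\rangle\to\mathfrak{B}$, depending only on $M_1(\cdot)$ and $\mathfrak{M}_1(\cdot)$, such that $$\lim_{N\to\infty}\Psi_{S_N}=\nu,\qquad \lim_{N\to\infty}\Phi_{S_N}=\mu$$ in the weak sense; in particular, $$\nu(\xi b_1\xi\cdots b_n\xi)=\sum_{\pi\in NC_2(n+1)}V_\pi(X_1,b_1,\dots,b_n),\qquad \mu(\xi b_1\xi\cdots b_n\xi)=\sum_{\pi\in NC_2(n+1)}W_\pi(X_1,b_1,\dots,b_n)$$ for all $b_1,\dots,b_n\in\mathfrak{B}$.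
   Context: A conditional expectation onto $\mathfrak{B}$ is a linear $\mathfrak{B}$-bimodule map restricting to the identity on $\mathfrak{B}$. c-freeness: $*$-subalgebras $(\mathfrak{A}_i)_{i\in\mathcal{I}}$ of $\mathfrak{A}$ are c-free with respect to $(\Phi,\Psi)$ if for all $a_k\in\mathfrak{A}_{\varepsilon(k)}$, $1\le k\le m$, with $\varepsilon(1)\ne\dots\ne\varepsilon(m)$ (consecutive indices distinct) and $\Psi(a_k)=0$ for all $k$, one has $\Psi(a_1\cdots a_m)=0$ and $\Phi(a_1\cdots a_m)=\Phi(a_1)\cdots\Phi(a_m)$. Elements $(X_i)$ are c-free if the $*$-subalgebras generated by $\mathfrak{B}$ and $X_i$ are. Multilinear function series: $\widetilde{\mathfrak{B}}$ is $\mathfrak{B}$ if unital and its unitization otherwise. $Mul[[\mathfrak{B}]]$ is the set of sequences $\omega=(\omega_0,\omega_1,\dots)$ with $\omega_0\in\widetilde{\mathfrak{B}}$ and $\omega_n:\mathfrak{B}^n\to\mathfrak{B}$ multilinear. The sum is componentwise; the product is $(\alpha\beta)_n(b_1,\dots,b_n)=\sum_{k=0}^n\alpha_k(b_1,\dots,b_k)\beta_{n-k}(b_{k+1},\dots,b_n)$; if $\beta_0=0$, $(\alpha\circ\beta)_0=\alpha_0$ and $(\alpha\circ\beta)_n(b_1,\dots,b_n)=\sum_{k=1}^n\sum_{p_1+\dots+p_k=n,\,p_j\ge1}\alpha_k(\beta_{p_1}(b_1,\dots,b_{p_1}),\dots,\beta_{p_k}(b_{q_k+1},\dots,b_{q_k+p_k}))$,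 $q_j=p_1+\dots+p_{j-1}$. $1=(1,0,0,\dots)$ and $I=(0,\mathrm{id}_{\mathfrak{B}},0,\dots)$ are the identities for product and composition; $\alpha^{-1}$ and $\alpha^{\langle-1\rangle}$ denote inverses for product and composition respectively. Moment series: for $X\in\mathfrak{A}$, the moment-generating multilinear function series of $X$ with respect to $\Psi$ has components $\Psi(X)$ ($n=0$) and $(b_1,\dots,b_n)\mapsto\Psi(Xb_1X\cdots Xb_nX)$ ($n\ge1$), and is denoted $\mathcal{M}_X$; the one with respect to $\Phi$ is defined in the same way with $\Phi$ and denoted $\mathfrak{M}_X$. $R$-transform: for $\alpha\in Mul[[\mathfrak{B}]]$, $R_\alpha=\left((1+\alpha I)^{-1}\alpha\right)\circ(I+I\alpha I)^{\langle-1\rangle}$, and $R_X:=R_{\mathcal{M}_X}$. ${}^cR$-transform: for $\beta,\gamma\in Mul[[\mathfrak{B}]]$, ${}^cR_{\beta,\gamma}$ is defined by the recurrence (for all $n\ge0$) $$\beta_n(b_1,\dots,b_n)=\sum_{k=0}^n\ \sum_{1=i(0)<i(1)<\dots<i(k)\le n+1}{}^cR_{\beta,\gamma,k}(c_1,\dots,c_k)\; r_{i(k)},$$ where $c_j=b_{i(j-1)}\gamma_{p(j)}(b_{i(j-1)+1},\dots,b_{i(j)-2})b_{i(j)-1}$, $p(j)=i(j)-i(j-1)-2$ (with $c_j=b_{i(j-1)}$ when $p(j)=-1$), and $r_i=b_i\beta_{n-i}(b_{i+1},\dots,b_n)$ if $i\le n$, $r_{n+1}=1$. Then ${}^cR_X:={}^cR_{\mathfrak{M}_X,\mathcal{M}_X}$.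 Limits of series in (i), (ii) are taken componentwise and pointwise (at each tuple of arguments) in $\mathfrak{B}$. $\mathfrak{B}\langle\xi\rangle$ is the algebra of noncommutative polynomials in the symbol $\xi$ with coefficients in $\mathfrak{B}$ (coefficients do not commute with $\xi$). For $X\in\mathfrak{A}$, $\Phi_X,\Psi_X:\mathfrak{B}\langle\xi\rangle\to\mathfrak{B}$ are $\Phi_X(f(\xi))=\Phi(f(X))$, $\Psi_X(f(\xi))=\Psi(f(X))$. Weak convergence of maps on $\mathfrak{B}\langle\xi\rangle$ means convergence at each $f\in\mathfrak{B}\langle\xi\rangle$. $NC_2(m)$ is the set of non-crossing partitions of $\{1,\dots,m\}$ all of whose blocks have exactly 2 elements (empty for $m$ odd, in which case the sums above are $0$). For $n$ odd, $\pi\in NC_2(n+1)$ and $(1,k)$ the block of $\pi$ containing $1$, define recursively $$V_\pi(X,b_1,\dots,b_n)=\Psi\big(Xb_1V_{\pi|\{2,\dots,k-1\}}(X,b_2,\dots,b_{k-2})b_{k-1}X\big)\,b_k\,V_{\pi|\{k+1,\dots,n+1\}}(X,b_{k+1},\dots,b_n),$$ $$W_\pi(X,b_1,\dots,b_n)=\Phi\big(Xb_1V_{\pi|\{2,\dots,k-1\}}(X,b_2,\dots,b_{k-2})b_{k-1}X\big)\,b_k\,W_{\pi|\{k+1,\dots,n+1\}}(X,b_{k+1},\dots,b_n),$$ where for $k=2$ the argument of $\Psi$, $\Phi$ is $Xb_1X$, and for $k=n+1$ the factor after $\Psi(\cdot)$, $\Phi(\cdot)$ is omitted.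
   Formalization: For non-unital 𝔅, 𝔅⟨ξ⟩ is taken to be the sums of words b_0ξb_1⋯ξb_k with all coefficients in 𝔅 (so not ξ or ξ²); ν, μ are given on bξb_1⋯b_nξb′, and the limits of Ψ, Φ of S_N b_1⋯b_n S_N are stated directly. For unital 𝔅 nothing changes. *)

(* Defs.v *)
From HB Require Import structures.
From mathcomp Require Import all_boot all_order all_algebra.
From mathcomp Require Import complex.
From mathcomp Require Import all_classical all_reals all_analysis.
Set Implicit Arguments.
Unset Strict Implicit.
Unset Printing Implicit Defensive.
Import Order.TTheory GRing.Theory Num.Theory.
Import numFieldNormedType.Exports.
Local Open Scope classical_set_scope.
Local Open Scope ring_scope.
Local Open Scope complex_scope.

(* Associative algebras, without any assumption on the existence of a unit;
   the product is the one of the semigroup structure of [monoid]. *)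
Notation "x ** y" := (monoid.mul x%R y%R) (at level 40, left associativity) : ring_scope.

HB.mixin Record isNuAlgebra (R : realType) A
    of GRing.Lmodule R[i] A & Semigroup A := {
  nu_mulDl : forall x y z : A, (x + y) ** z = x ** z + y ** z;
  nu_mulDr : forall x y z : A, x ** (y + z) = x ** y + x ** z;
  nu_scalel : forall (a : R[i]) (x y : A), (a *: x) ** y = a *: (x ** y);
  nu_scaler : forall (a : R[i]) (x y : A), x ** (a *: y) = a *: (x ** y) }.

#[short(type="nuAlgType")]
HB.structure Definition NuAlgebra (R : realType) :=
  {A of GRing.Lmodule R[i] A & Semigroup A & isNuAlgebra R A}.

HB.mixin Record hasStar (R : realType) A of NuAlgebra R A := {
  star : A -> A;
  starK : involutive star;
  starD : forall x y : A, star (x + y) = star x + star y;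
  starZ : forall (a : R[i]) (x : A), star (a *: x) = conjc a *: star x;
  starM : forall x y : A, star (x ** y) = star y ** star x }.

#[short(type="starAlgType")]
HB.structure Definition StarAlgebra (R : realType) :=
  {A of NuAlgebra R A & hasStar R A}.

HB.mixin Record isCStarAlgebra (R : realType) B
    of StarAlgebra R B & CompleteNormedModule R[i] B := {
  cstar_normM : forall x y : B, `|x ** y| <= `|x| * `|y|;
  cstar_norm : forall x : B, `|star x ** x| = `|x| ^+ 2 }.

#[short(type="cstarAlgType")]
HB.structure Definition CStarAlgebra (R : realType) :=
  {B of StarAlgebra R B & CompleteNormedModule R[i] B & isCStarAlgebra R B}.

Section AlgebrasOver.
Variables (R : realType) (B A : starAlgType R).

Definition star_subalgebra (S : set A) : Prop :=
  [/\ S 0,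
      forall (a : R[i]) x y, S x -> S y -> S (a *: x + y),
      forall x y, S x -> S y -> S (x ** y)
    & forall x, S x -> S (star x)].

Definition star_embedding (iota : B -> A) : Prop :=
  [/\ linear iota, injective iota,
      forall b c, iota (b ** c) = iota b ** iota c
    & forall b, iota (star b) = star (iota b)].

Definition star_generated (iota : B -> A) (X : A) : set A :=
  smallest star_subalgebra (range iota `|` [set X]).

End AlgebrasOver.

Definition conditional_expectation (R : realType) (B P : nuAlgType R)
    (iota : B -> P) (E : P -> B) : Prop :=
  [/\ linear E,
      forall b p, E (iota b ** p) = b ** E p,
      forall p b, E (p ** iota b) = E p ** b
    & forall b, E (iota b) = b].

(* The product of a nonempty word [a :: s]. *)
Definition nprod (R : realType) (A : nuAlgType R) (a : A) (s : seq A) : A :=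
  foldl (fun x y => x ** y) a s.

(* A word a_1 ... a_m (m >= 1) comes with the indices eps(k) as a nonempty list
   [x :: s] of pairs (eps(k), a_k). *)
Definition cfree (R : realType) (A B : nuAlgType R) (I : eqType)
    (D : I -> set A) (Phi Psi : A -> B) : Prop :=
  forall (x : I * A) (s : seq (I * A)),
    path (fun p q => p.1 != q.1) x s ->
    (forall p, p \in x :: s -> D p.1 p.2 /\ Psi p.2 = 0) ->
    Psi (nprod x.2 [seq p.2 | p <- s]) = 0 /\
    Phi (nprod x.2 [seq p.2 | p <- s]) = nprod (Phi x.2) [seq Phi p.2 | p <- s].

(* For each length n, [phi] restricted to lists of length n is n-linear. *)
Definition multilinear (R : realType) (B V : lmodType R[i]) (phi : seq B -> V) :=
  forall (s t : seq B) (a : R[i]) (x y : B),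
    phi (s ++ (a *: x + y) :: t) = a *: phi (s ++ x :: t) + phi (s ++ y :: t).

(* B<xi>.  The monomial b_0 xi b_1 xi ... xi b_k, with b_0, ..., b_k in B, is
   encoded as the pair (b_0, [:: b_1; ...; b_k]), and a polynomial is a finite
   formal sum of monomials, up to multilinearity in (b_0, ..., b_k); that is,
   B<xi> is the direct sum over k of the (k+1)-st tensor powers of B over the
   complex numbers.  If B has a unit 1, the symbol xi is the monomial 1 xi 1. *)
Section NcPoly.
Variables (R : realType) (B : nuAlgType R).
Local Notation C := R[i].
Local Notation formal_sum := (seq (B * seq B)).

Definition nc_sum (V : lmodType C) (phi : seq B -> V) (p : formal_sum) : V :=
  \sum_(w <- p) phi (w.1 :: w.2).

Definition nc_eq (p q : formal_sum) : bool :=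
  `[< forall (V : lmodType C) (phi : seq B -> V),
        multilinear phi -> nc_sum phi p = nc_sum phi q >].

Lemma nc_eq_refl : reflexive nc_eq.
Proof. by move=> p; apply/asboolP. Qed.

Lemma nc_eq_sym : symmetric nc_eq.
Proof.
by move=> p q; apply/asboolP/asboolP => H V phi hphi; rewrite (H V phi hphi).
Qed.

Lemma nc_eq_trans : transitive nc_eq.
Proof.
move=> q p r /asboolP H1 /asboolP H2; apply/asboolP => V phi hphi.
by rewrite (H1 V phi hphi) (H2 V phi hphi).
Qed.

Canonical nc_equiv := EquivRel nc_eq nc_eq_refl nc_eq_sym nc_eq_trans.

Definition ncpoly : Type := {eq_quot nc_equiv}%qT.
HB.instance Definition _ := Choice.on ncpoly.

Definition ncpoly_of (p : formal_sum) : ncpoly := (\pi_({eq_quot nc_equiv}) p)%qT.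
Definition ncpoly_repr (f : ncpoly) : formal_sum := repr (f : {eq_quot nc_equiv}%qT).

Definition nc_eval (V : lmodType C) (phi : seq B -> V) (f : ncpoly) : V :=
  nc_sum phi (ncpoly_repr f).

Lemma nc_evalE (V : lmodType C) (phi : seq B -> V) p :
  multilinear phi -> nc_eval phi (ncpoly_of p) = nc_sum phi p.
Proof.
move=> hphi; rewrite /nc_eval /ncpoly_repr /ncpoly_of.
have : nc_eq (repr (\pi_({eq_quot nc_equiv}) p)%qT) p.
  by have /eqmodP := reprK (\pi_({eq_quot nc_equiv}) p)%qT.
by move/asboolP => /(_ V phi hphi).
Qed.

Lemma ncpoly_ext (f g : ncpoly) :
  (forall (V : lmodType C) (phi : seq B -> V),
     multilinear phi -> nc_eval phi f = nc_eval phi g) -> f = g.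
Proof.
move=> H; rewrite -[f](reprK (f : {eq_quot nc_equiv}%qT)).
rewrite -[RHS](reprK (g : {eq_quot nc_equiv}%qT)).
by apply/eqmodP/asboolP.
Qed.

Definition nc_add (f g : ncpoly) := ncpoly_of (ncpoly_repr f ++ ncpoly_repr g).
Definition nc_scale (a : C) (f : ncpoly) :=
  ncpoly_of [seq (a *: w.1, w.2) | w <- ncpoly_repr f].
Definition nc_zero : ncpoly := ncpoly_of [::].

(* (b_0 xi ... xi b_k)(c_0 xi ... xi c_l) = b_0 xi ... xi (b_k c_0) xi ... xi c_l *)
Fixpoint word_mul (s t : seq B) : seq B :=
  match s, t with
  | [:: x], y :: t' => x ** y :: t'
  | x :: s', _ => x :: word_mul s' t
  | [::], _ => t
  end.

Definition mono_mul (w v : B * seq B) : B * seq B :=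
  let u := word_mul (w.1 :: w.2) (v.1 :: v.2) in (head 0 u, behead u).

Definition nc_mul (f g : ncpoly) :=
  ncpoly_of [seq mono_mul w v | w <- ncpoly_repr f, v <- ncpoly_repr g].

Lemma mlin0 (V : lmodType C) (phi : seq B -> V) s t :
  multilinear phi -> phi (s ++ 0 :: t) = 0.
Proof.
move=> h; have := h s t (-1) 0 0.
by rewrite scaler0 addr0 scaleN1r addNr.
Qed.

Lemma mlinZ (V : lmodType C) (phi : seq B -> V) t a x :
  multilinear phi -> phi (a *: x :: t) = a *: phi (x :: t).
Proof.
move=> h; have := h [::] t a x 0.
by rewrite /= addr0 => ->; rewrite (mlin0 [::] _ h) addr0.
Qed.

Section Eval.
Variables (V : lmodType C) (phi : seq B -> V).
Hypothesis hphi : multilinear phi.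

Lemma nc_eval0 : nc_eval phi nc_zero = 0.
Proof. by rewrite nc_evalE // /nc_sum big_nil. Qed.

Lemma nc_evalD f g : nc_eval phi (nc_add f g) = nc_eval phi f + nc_eval phi g.
Proof. by rewrite nc_evalE // /nc_sum big_cat. Qed.

Lemma nc_evalZ a f : nc_eval phi (nc_scale a f) = a *: nc_eval phi f.
Proof.
rewrite nc_evalE // /nc_sum big_map scaler_sumr.
by apply: eq_bigr => w _ /=; rewrite mlinZ.
Qed.

Lemma word_mul_mlin_l t : multilinear (fun s => phi (word_mul s t)).
Proof.
move=> s u a x y; elim: s phi hphi => [|z s IH] psi hpsi.
  case: u => [|z u] /=; last exact: (hpsi [::]).
  case: t => [|z t]; first exact: (hpsi [::]).
  by rewrite nu_mulDl nu_scalel; exact: (hpsi [::]).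
have hz : multilinear (fun s => psi (z :: s)).
  by move=> s1 t1 *; exact: (hpsi (z :: s1) t1).
have E v : word_mul ((z :: s) ++ v :: u) t = z :: word_mul (s ++ v :: u) t.
  by case: s {IH}.
by rewrite !E; exact: (IH _ hz).
Qed.

Lemma word_mul_mlin_r x s : multilinear (fun t => phi (word_mul (x :: s) t)).
Proof.
elim: s x phi hphi => [|z s IH] x psi hpsi.
  move=> [|v t] u a y y'; last exact: (hpsi (x ** v :: t)).
  by rewrite /= nu_mulDr nu_scaler; exact: (hpsi [::]).
have hx : multilinear (fun s => psi (x :: s)).
  by move=> s1 t1 *; exact: (hpsi (x :: s1) t1).
exact: (IH z _ hx).
Qed.

Lemma nc_evalM f g : nc_eval phi (nc_mul f g) =
  nc_eval (fun s => nc_eval (fun t => phi (word_mul s t)) g) f.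
Proof.
rewrite nc_evalE // {1}/nc_sum big_allpairs_dep.
apply: eq_bigr => -[b s] _; apply: eq_bigr => -[c t] _.
by congr (phi _); rewrite /mono_mul /=; case: s.
Qed.

End Eval.

Lemma nc_eval_mlin (V : lmodType C) (phi : seq B -> seq B -> V) g :
  (forall t, multilinear (phi^~ t)) ->
  multilinear (fun s => nc_eval (phi s) g).
Proof.
move=> h s t a x y; rewrite /nc_eval /nc_sum scaler_sumr -big_split.
by apply: eq_bigr => w _; rewrite h.
Qed.

Lemma word_mulA b s c t d u :
  word_mul (word_mul (b :: s) (c :: t)) (d :: u) =
  word_mul (b :: s) (word_mul (c :: t) (d :: u)).
Proof.
elim: s b => [|z s IH] b.
  by case: t => [|z t] //=; rewrite mulgA.
have -> : word_mul [:: b, z & s] (c :: t) = b :: word_mul (z :: s) (c :: t) by [].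
have -> x y : word_mul [:: b, z & s] (word_mul x y) =
    b :: word_mul (z :: s) (word_mul x y) by [].
rewrite -IH; case E : (word_mul (z :: s) (c :: t)) => [|e v] //.
by case: s E {IH}.
Qed.

Fact nc_addA : associative nc_add.
Proof. by move=> f g h; apply: ncpoly_ext => V phi H; rewrite !nc_evalD // addrA. Qed.
Fact nc_addC : commutative nc_add.
Proof. by move=> f g; apply: ncpoly_ext => V phi H; rewrite !nc_evalD // addrC. Qed.
Fact nc_add0 : left_id nc_zero nc_add.
Proof. by move=> f; apply: ncpoly_ext => V phi H; rewrite nc_evalD // nc_eval0 // add0r. Qed.
Fact nc_addN : left_inverse nc_zero (nc_scale (-1)) nc_add.
Proof.
move=> f; apply: ncpoly_ext => V phi H.
by rewrite nc_evalD // nc_evalZ // nc_eval0 // scaleN1r addNr.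
Qed.

HB.instance Definition _ :=
  GRing.isZmodule.Build ncpoly nc_addA nc_addC nc_add0 nc_addN.

Fact nc_scaleA a b (f : ncpoly) : nc_scale a (nc_scale b f) = nc_scale (a * b) f.
Proof. by apply: ncpoly_ext => V phi H; rewrite !nc_evalZ // scalerA. Qed.
Fact nc_scale1 : left_id 1 nc_scale.
Proof. by move=> f; apply: ncpoly_ext => V phi H; rewrite nc_evalZ // scale1r. Qed.
Fact nc_scaleDr : right_distributive nc_scale +%R.
Proof.
move=> a f g; apply: ncpoly_ext => V phi H.
by rewrite !(nc_evalZ, nc_evalD) // scalerDr.
Qed.
Fact nc_scaleDl f : {morph nc_scale^~ f : a b / a + b}.
Proof.
move=> a b; apply: ncpoly_ext => V phi H.
by rewrite !(nc_evalZ, nc_evalD) // scalerDl.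
Qed.

HB.instance Definition _ := GRing.Zmodule_isLmodule.Build C ncpoly
  nc_scaleA nc_scale1 nc_scaleDr nc_scaleDl.

Fact nc_mulA : associative nc_mul.
Proof.
move=> f g h; apply: ncpoly_ext => V phi H; rewrite !nc_evalM //; last first.
  by apply: nc_eval_mlin => t; exact: word_mul_mlin_l.
rewrite {1}/nc_eval [RHS]/nc_eval; apply: eq_bigr => -[b s] _.
apply: etrans (nc_evalM (word_mul_mlin_r H b s) g h) _.
apply: eq_bigr => -[c t] _; apply: eq_bigr => -[d u] _.
by rewrite word_mulA.
Qed.

HB.instance Definition _ := hasMul.Build ncpoly nc_mul.
HB.instance Definition _ := Magma_isSemigroup.Build ncpoly nc_mulA.

Fact nc_mulDl (f g h : ncpoly) : (f + g) ** h = f ** h + g ** h.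
Proof.
apply: ncpoly_ext => V phi H; rewrite !(nc_evalM, nc_evalD) //.
by apply: nc_eval_mlin => t; exact: word_mul_mlin_l.
Qed.
Fact nc_mulDr (f g h : ncpoly) : f ** (g + h) = f ** g + f ** h.
Proof.
apply: ncpoly_ext => V phi H; rewrite !(nc_evalM, nc_evalD) //.
rewrite {1 3 4}/nc_eval /nc_sum -big_split; apply: eq_bigr => -[b s] _.
exact: (nc_evalD (word_mul_mlin_r H b s) g h).
Qed.
Fact nc_scalel a (f g : ncpoly) : (a *: f) ** g = a *: (f ** g).
Proof.
apply: ncpoly_ext => V phi H; rewrite !(nc_evalM, nc_evalZ) //.
by apply: nc_eval_mlin => t; exact: word_mul_mlin_l.
Qed.
Fact nc_scaler a (f g : ncpoly) : f ** (a *: g) = a *: (f ** g).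
Proof.
apply: ncpoly_ext => V phi H; rewrite !(nc_evalM, nc_evalZ) //.
rewrite {1 3}/nc_eval /nc_sum scaler_sumr; apply: eq_bigr => -[b s] _.
exact: (nc_evalZ (word_mul_mlin_r H b s) a g).
Qed.

HB.instance Definition _ := isNuAlgebra.Build R ncpoly
  nc_mulDl nc_mulDr nc_scalel nc_scaler.

Definition nc_mono (b : B) (s : seq B) : ncpoly := ncpoly_of [:: (b, s)].
Definition nc_const (b : B) : ncpoly := nc_mono b [::].

(* b_0 X b_1 X ... X b_k *)
Definition mono_at (A : nuAlgType R) (iota : B -> A) (X : A) (s : seq B) : A :=
  if s is b :: s' then foldl (fun y c => y ** X ** iota c) (iota b) s' else 0.

(* f(X); the choice of the formal sum representing f is immaterial by
   [nc_evalE] and [mono_at_mlin]. *)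
Definition nc_at (A : nuAlgType R) (iota : B -> A) (X : A) : ncpoly -> A :=
  nc_eval (mono_at iota X).

Lemma mono_at_mlin (A : nuAlgType R) (iota : B -> A) (X : A) :
  linear iota -> multilinear (mono_at iota X).
Proof.
move=> li s t a x y.
have G (u : seq B) z z' : foldl (fun y c => y ** X ** iota c) (a *: z + z') u =
    a *: foldl (fun y c => y ** X ** iota c) z u +
    foldl (fun y c => y ** X ** iota c) z' u.
  elim: u z z' => [|c u IH] z z' //=.
  by rewrite !nu_mulDl !nu_scalel IH.
case: s => [|b s] /=; first by rewrite li G.
by rewrite !foldl_cat /= li nu_mulDr nu_scaler G.
Qed.

End NcPoly.

Section Series.
Variables (R : realType) (B : cstarAlgType R).
Local Notation C := R[i].

Definition is_unit_of (e : B) : Prop := forall b, e ** b = b /\ b ** e = b.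

(* The unitization B (+) C of B, whose element (b, z) stands for b + z 1. *)
Definition unitization := (B * C^o)%type.

Definition umul (u v : unitization) : unitization :=
  (u.1 ** v.1 + u.2 *: v.1 + v.2 *: u.1, u.2 * v.2).

Definition uB (b : B) : unitization := (b, 0).

(* B~ inside the unitization: it is B (+) 0 if B is unital, and everything
   otherwise. *)
Definition in_tilde (u : unitization) : Prop :=
  (exists e, is_unit_of e) -> u.2 = 0.

Definition tilde1 : unitization :=
  if `[< exists e, is_unit_of e >] then uB (xget 0 is_unit_of) else (0, 1).

(* A sequence (omega_0, omega_1, ...) is encoded as a function on lists, which
   is omega_n on the lists of length n; the values of omega_n for n >= 1 are in
   B, embedded in the unitization by [uB]. *)
Definition mfseries := seq B -> unitization.

Definition Mul : set mfseries := [set omega : mfseries |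
  [/\ in_tilde (omega [::]),
      forall s, s != [::] -> (omega s).2 = 0
    & multilinear omega]].

Definition ser_one : mfseries := fun s => if s is [::] then tilde1 else 0.

Definition ser_id : mfseries := fun s => if s is [:: b] then uB b else 0.

Definition ser_add (alpha beta : mfseries) : mfseries := fun s => alpha s + beta s.

Definition ser_mul (alpha beta : mfseries) : mfseries := fun s =>
  \sum_(k < (size s).+1) umul (alpha (take k s)) (beta (drop k s)).

(* The inner sum is over (p_1, ..., p_k) with p_j >= 1 and sum n. *)
Definition ser_comp (alpha beta : mfseries) : mfseries := fun s =>
  if s is [::] then alpha [::] else
  \sum_(1 <= k < (size s).+1)
    \sum_(p : k.-tuple 'I_(size s).+1 |
            all (fun j => (0 < j)%N) (map val p) && (sumn (map val p) == size s))
      alpha [seq (beta t).1 | t <- reshape (map val p) s].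

Definition ser_inv (alpha : mfseries) : mfseries :=
  xget 0 [set beta | [/\ Mul beta, ser_mul alpha beta = ser_one
                       & ser_mul beta alpha = ser_one]].

Definition ser_cinv (alpha : mfseries) : mfseries :=
  xget 0 [set beta | [/\ Mul beta, beta [::] = 0, ser_comp alpha beta = ser_id
                       & ser_comp beta alpha = ser_id]].

Definition R_of (alpha : mfseries) : mfseries :=
  ser_comp
    (ser_mul (ser_inv (ser_add ser_one (ser_mul alpha ser_id))) alpha)
    (ser_cinv (ser_add ser_id (ser_mul ser_id (ser_mul alpha ser_id)))).

(* Arguments b_1, ..., b_n are numbered from 1. *)
Definition barg (s : seq B) (j : nat) : B := nth 0 s j.-1.

(* c_j, as a function of i = i(j-1) and i' = i(j) *)
Definition cR_arg (gamma : mfseries) (s : seq B) (i i' : nat) : B :=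
  if i' == i.+1 then barg s i
  else (umul (umul (uB (barg s i)) (gamma (take (i' - i - 2) (drop i s))))
             (uB (barg s i'.-1))).1.

Definition cR_rest (beta : mfseries) (s : seq B) (i : nat) : unitization :=
  if (i <= size s)%N then umul (uB (barg s i)) (beta (drop i s)) else tilde1.

(* The inner sum is over (i(1), ..., i(k)) with 1 < i(1) < ... < i(k) <= n+1. *)
Definition cR_recurrence (beta gamma rho : mfseries) : Prop :=
  forall s : seq B, beta s =
    \sum_(k < (size s).+1)
      \sum_(i : k.-tuple 'I_(size s).+2 | path ltn 1%N (map val i))
        umul (rho (pairmap (cR_arg gamma s) 1%N (map val i)))
             (cR_rest beta s (last 1%N (map val i))).

Definition cR_of (beta gamma : mfseries) : mfseries :=
  xget 0 [set rho | Mul rho /\ cR_recurrence beta gamma rho].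

(* (0, m, 0, ...) *)
Definition ser_linear (m : B -> B) : mfseries :=
  fun s => if s is [:: b] then uB (m b) else 0.

(* omega_1 *)
Definition ser1 (omega : mfseries) : B -> B := fun b => (omega [:: b]).1.

Section Moments.
Variables (A : nuAlgType R) (iota : B -> A).

(* X b_1 X ... b_n X *)
Definition moment_word (X : A) (s : seq B) : A :=
  foldl (fun y b => y ** iota b ** X) X s.

Definition moment_series (E : A -> B) (X : A) : mfseries :=
  fun s => uB (E (moment_word X s)).

End Moments.

End Series.

Definition noncrossing m (P : {set {set 'I_m}}) : bool :=
  [forall U in P, forall W in P, (U != W) ==>
    ~~ [exists i in U, exists j in W, exists k in U, exists l in W,
          (i < j < k) && (k < l)]]%N.

Definition NC2 m : {set {set {set 'I_m}}} :=
  [set P : {set {set 'I_m}} | [&& finset.partition P [set: 'I_m],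
     noncrossing P & [forall U in P, #|U| == 2%N]]]%SET.

(* The element that shares the block of the pairing P with i; positions and
   arguments are numbered from 0 here, as opposed to 1 in the text. *)
Definition partner m (P : {set {set 'I_m}}) (i : nat) : nat :=
  if [pick j : 'I_m | (val j != i) &&
        [exists U in P, (j \in U) && [exists l in U, val l == i]]]
  is Some j then val j else i.

Section PairingSums.
Variables (R : realType) (B A : nuAlgType R) (iota : B -> A).
Variables (Phi Psi : A -> B) (X : A).
Variables (m : nat) (P : {set {set 'I_m}}) (s : seq B).

(* The positions 0, ..., m-1 of X in X b_0 X b_1 ... b_{m-2} X are separated by
   the arguments of s.  [V_seg d lo hi] is V for the restriction of P to the
   positions lo, ..., hi-1 and the arguments between them; d bounds the depth
   of the recursion and has to be at least hi - lo. *)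
Definition seg_arg (V : nat -> nat -> B) (lo k : nat) : A :=
  if k == lo.+1 then X ** iota s`_lo ** X
  else X ** iota (s`_lo ** V lo.+1 k ** s`_k.-1) ** X.

Fixpoint V_seg (d lo hi : nat) : B :=
  if d is d'.+1 then
    let k := partner P lo in
    let e := Psi (seg_arg (V_seg d') lo k) in
    if k.+1 == hi then e else e ** s`_k ** V_seg d' k.+1 hi
  else 0.

Fixpoint W_seg (d lo hi : nat) : B :=
  if d is d'.+1 then
    let k := partner P lo in
    let e := Phi (seg_arg (V_seg d') lo k) in
    if k.+1 == hi then e else e ** s`_k ** W_seg d' k.+1 hi
  else 0.

Definition V_pairing : B := V_seg m 0 m.
Definition W_pairing : B := W_seg m 0 m.

End PairingSums.

Section Transforms.
Variables (R : realType) (B : cstarAlgType R) (A : nuAlgType R) (iota : B -> A).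

(* R_X *)
Definition R_transform (Psi : A -> B) (X : A) : mfseries B :=
  R_of (moment_series iota Psi X).

(* cR_X *)
Definition cR_transform (Phi Psi : A -> B) (X : A) : mfseries B :=
  cR_of (moment_series iota Phi X) (moment_series iota Psi X).

(* (X_1 + ... + X_N) / sqrt N, the sequence being X 0, X 1, ... *)
Definition normalized_sum (X : nat -> A) (N : nat) : A :=
  ((Num.sqrt (N%:R : R))^-1)%:C *: \sum_(i < N) X i.

End Transforms.

(* Main.v *)
Require Import Defs.
From HB Require Import structures.
From mathcomp Require Import all_boot all_order all_algebra.
From mathcomp Require Import complex zify.
From mathcomp Require Import all_classical all_reals all_analysis.
Set Implicit Arguments.
Unset Strict Implicit.
Unset Printing Implicit Defensive.
Import Order.TTheory GRing.Theory Num.Theory.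
Import numFieldNormedType.Exports.
Local Open Scope classical_set_scope.
Local Open Scope ring_scope.
Local Open Scope complex_scope.

(** The coefficients of the series are arbitrary multilinear maps: [Phi] and
    [Psi] may be discontinuous, so no limit may be taken inside a series.  All the
    work is done with exact identities, and limits are taken only of finite sums
    of fixed elements times powers of 1 / sqrt N.

    The cumulants of X are first described without composition.  Let I be the
    identity series and let W = (1 - (X - r) I)^-1 in the ring of series over the
    unitization of [A].  The pair (r, c) is a cumulant pair for X if
        Psi W = 1    and    Phi W (1 - (c - r) I) = 1.
    Composing with the compositional inverse of I + I gamma I, gamma being the
    moment series of X for [Psi], turns the recursion that defines the
    R-transform and the cR-transform into these two equations
    ([rec_cumulant_pair]).  A cumulant pair is unique
    ([cumulant_pair_uniq]), and scaling X by l multiplies the component of degree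
    n by l^(n+1) ([cumulant_pair_dil]).

    Cumulant pairs add up for c-free variables ([cumulant_pair_sum]).  Put
    y_i = (X_i - r_i) I and x_i = W_i - 1, so that y_i = x_i (1 + x_i)^-1.  The
    inverse of 1 - (y_1 + ... + y_N) is the sum of all products of the x_i in
    which neighbouring indices differ, as in the enumeration of words without
    repeated neighbours.  The coefficients of x_i lie in the algebra generated by
    [B] and X_i and are killed by [Psi]; c-freeness says precisely that [Psi]
    kills these products and that [Phi] is multiplicative on them.  Hence [Psi]
    sends the inverse to 1, and [Phi] sends it to the same expression in the
    series Phi x_i: its own inverse is 1 minus the sum of the
    1 - (1 + Phi x_i)^-1 = (c_i - r_i) I.

    The cumulants of S_N in degree n are therefore N * N^(-(n+1)/2) times those of
    X_1: the mean vanishes, degree 1 is fixed and higher degrees tend to 0.  This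
    is (i) and (ii).  For (iii), the recursion that expresses moments by cumulants
    shows, by induction on the length, that each moment of S_N is a polynomial in
    1 / sqrt N, whose constant term obeys the recursion in which only blocks of
    size two survive ([exp_pair_step], [central_limit]).  Splitting a non-crossing
    pairing at the partner of its first point gives the same recursion for the
    sums over NC_2 ([sum_V_pairing], [sum_W_pairing]). *)

(** * Splittings of a word and composition of series *)

Section SplitSum.
Variables (T : Type) (V : nmodType).

Definition splitsum (F : seq T -> seq T -> V) (s : seq T) : V :=
  \sum_(k < (size s).+1) F (take k s) (drop k s).

Lemma splitsum_nil F : splitsum F [::] = F [::] [::].
Proof. by rewrite /splitsum big_ord_recl big_ord0 addr0. Qed.

Lemma splitsum_cons F x s :
  splitsum F (x :: s) = F [::] (x :: s) + splitsum (fun a b => F (x :: a) b) s.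
Proof. by rewrite /splitsum big_ord_recl. Qed.

Lemma splitsum_rcons F s x :
  splitsum F (rcons s x) =
    splitsum (fun a b => F a (rcons b x)) s + F (rcons s x) [::].
Proof.
elim: s F => [|y s IH] F.
  by rewrite /= splitsum_cons !splitsum_nil.
by rewrite rcons_cons !splitsum_cons IH addrA.
Qed.

Lemma eq_splitsum F G s :
  (forall a b, a ++ b = s -> F a b = G a b) -> splitsum F s = splitsum G s.
Proof. by move=> h; apply: eq_bigr => k _; apply: h; exact: cat_take_drop. Qed.

Lemma splitsum0 F s :
  (forall a b, a ++ b = s -> F a b = 0) -> splitsum F s = 0.
Proof. by move=> h; rewrite /splitsum big1 // => k _; apply: h; exact: cat_take_drop. Qed.

Lemma splitsumD F G s :
  splitsum (fun a b => F a b + G a b) s = splitsum F s + splitsum G s.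
Proof. exact: big_split. Qed.

(** Both sides run over the ways of cutting a word into three pieces. *)
Lemma splitsumA (F : seq T -> seq T -> seq T -> V) s :
  splitsum (fun a b => splitsum (fun a1 a2 => F a1 a2 b) a) s =
  splitsum (fun a b => splitsum (F a) b) s.
Proof.
elim: s F => [|x s IH] F; first by rewrite !splitsum_nil.
rewrite !splitsum_cons splitsum_nil -(IH (fun a => F (x :: a))) -addrA -splitsumD.
by congr (_ + _); apply: eq_splitsum => a b _; rewrite splitsum_cons.
Qed.

End SplitSum.

Lemma splitsum_raddf (T : Type) (V W : nmodType) (f : V -> W) F (s : seq T) :
  f 0 = 0 -> {morph f : x y / x + y} ->
  f (splitsum F s) = splitsum (fun a b => f (F a b)) s.
Proof. by move=> f0 fD; exact: (big_morph f fD f0). Qed.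

Section Composition.
Variables (R : realType) (B : lmodType R[i]).
Implicit Types (h g : seq B -> B).

Section Def.
Variables (V : lmodType R[i]) (h : seq B -> B).

(** [u] and [h] composed on a word whose current block is still open: [f] is [h] with
    the letters of that block already inserted, and each new letter either extends
    the block or closes it.  This makes composition structurally recursive. *)
Fixpoint scomp_head (u : seq B -> V) (f : seq B -> B) (s : seq B) : V :=
  if s is x :: s' then
    scomp_head u (fun t => f (x :: t)) s' +
    scomp_head (fun t => u (f [::] :: t)) (fun t => h (x :: t)) s'
  else u [:: f [::]].

Definition scomp (u : seq B -> V) (s : seq B) : V :=
  if s is x :: s' then scomp_head u (fun t => h (x :: t)) s' else u [::].

Lemma scomp_headE u f s :
  scomp_head u f s = splitsum (fun a b => scomp (fun t => u (f a :: t)) b) s.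
Proof.
elim: s u f => [|x s IH] u f; first by rewrite splitsum_nil.
by rewrite splitsum_cons /= IH addrC.
Qed.

Lemma scomp_cons u x s : scomp u (x :: s) =
  splitsum (fun a b => scomp (fun t => u (h (x :: a) :: t)) b) s.
Proof. exact: scomp_headE. Qed.

Lemma eq_scomp u v s : u =1 v -> scomp u s = scomp v s.
Proof. by move=> /funext ->. Qed.

End Def.

Lemma scomp_linear (V W : lmodType R[i]) h (f : V -> W) (u : seq B -> V) s :
  linear f -> scomp h (fun t => f (u t)) s = f (scomp h u s).
Proof.
move=> lf; have fD : {morph f : x y / x + y}.
  by move=> x y; have := lf 1 x y; rewrite !scale1r.
have f0 : f 0 = 0 by have := lf (-1) 0 0; rewrite scaler0 addr0 scaleN1r addNr.
have [n] := ubnP (size s); elim: n u s => // n IH u [|x s] // /ltnSE hn.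
rewrite !scomp_cons (splitsum_raddf _ _ f0 fD).
apply: eq_splitsum => a b ab.
rewrite (IH (fun t => u (h (x :: a) :: t))) //.
by apply: leq_trans hn; rewrite -ab /= size_cat ltnS leq_addl.
Qed.

Lemma scomp_lin (V : lmodType R[i]) h (c : R[i]) (u v : seq B -> V) s :
  scomp h (fun t => c *: u t + v t) s = c *: scomp h u s + scomp h v s.
Proof.
have [n] := ubnP (size s); elim: n u v s => // n IH u v [|x s] // /ltnSE hn.
rewrite !scomp_cons /splitsum scaler_sumr -big_split /=; apply: eq_bigr => k _.
apply: IH; apply: leq_trans hn.
by rewrite size_drop ltnS leq_subr.
Qed.

Lemma scomp0 (V : lmodType R[i]) h s : scomp h (fun _ => 0 : V) s = 0.
Proof. by have := scomp_lin h (-1) (fun _ => 0 : V) (fun _ => 0) s;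
  rewrite scaler0 addr0 scaleN1r addNr. Qed.

Lemma scompD (V : lmodType R[i]) h (u v : seq B -> V) s :
  scomp h (fun t => u t + v t) s = scomp h u s + scomp h v s.
Proof.
have := scomp_lin h 1 u v s; rewrite scale1r => <-.
by apply: eq_scomp => t; rewrite scale1r.
Qed.

(** A block of the composed word never straddles the cut, so composition
    respects cutting a word in two.  Both the multiplicativity and the
    associativity of composition are instances of this identity. *)
Lemma scomp_splitsum (V : lmodType R[i]) h (F : seq B -> seq B -> V) s :
  scomp h (splitsum F) s =
  splitsum (fun a b => scomp h (fun t1 => scomp h (F t1) b) a) s.
Proof.
have [n] := ubnP (size s); elim: n F s => // n IH F [|x s] /= /ltnSE hn.
  by rewrite !splitsum_nil.
rewrite -[LHS]/(scomp h (splitsum F) (x :: s)) scomp_cons splitsum_cons.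
transitivity (splitsum (fun a b => scomp h (fun t => F [::] (h (x :: a) :: t)) b +
   splitsum (fun b1 b2 =>
     scomp h (fun t1 => scomp h (F (h (x :: a) :: t1)) b2) b1) b) s).
  apply: eq_splitsum => a b ab; rewrite -IH; last first.
    by apply: leq_trans hn; rewrite -ab size_cat ltnS leq_addl.
  by rewrite -scompD; apply: eq_scomp => t; rewrite splitsum_cons.
rewrite splitsumD -scomp_cons; congr (_ + _).
rewrite -(splitsumA (fun a b1 b2 =>
  scomp h (fun t1 => scomp h (F (h (x :: a) :: t1)) b2) b1)).
by apply: eq_splitsum => a b _; rewrite scomp_cons.
Qed.

Lemma mlin_cons (V : lmodType R[i]) (u : seq B -> V) x :
  multilinear u -> multilinear (fun t => u (x :: t)).
Proof. by move=> hu s t a y z; exact: (hu (x :: s)). Qed.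

Lemma mlin_head0 (V : lmodType R[i]) (u : seq B -> V) t :
  multilinear u -> u (0 :: t) = 0.
Proof. by move=> hu; have := hu [::] t (-1) 0 0; rewrite scaler0 addr0 scaleN1r addNr. Qed.

Lemma scomp_head_arg_linear (V : lmodType R[i]) h (u : seq B -> V) b :
  multilinear u -> linear (fun z => scomp h (fun t => u (z :: t)) b).
Proof.
move=> hu a y z; rewrite -scomp_lin; apply: eq_scomp => t.
exact: (hu [::]).
Qed.

(** The first block of the outer composition is a composed word itself; cutting the
    rest according to [scomp_splitsum] regroups the double sum. *)
Lemma scompA (V : lmodType R[i]) g h (u : seq B -> V) :
  multilinear u -> scomp h (scomp g u) = scomp (scomp h g) u.
Proof.
move=> mu; apply/funext => s; move: mu.
have [n] := ubnP (size s); elim: n u s => // n IH u [|x s] // /= /ltnSE hn hu.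
rewrite -[LHS]/(scomp h _ (x :: s)) -[RHS]/(scomp _ u (x :: s)) !scomp_cons.
transitivity (splitsum (fun a b => splitsum (fun b1 b2 =>
    scomp (scomp h g) (fun t =>
       u (scomp h (fun t => g (h (x :: a) :: t)) b1 :: t)) b2) b) s).
  apply: eq_splitsum => a b ab.
  under eq_scomp => t do rewrite scomp_cons.
  rewrite scomp_splitsum; apply: eq_splitsum => b1 b2 bb.
  rewrite -(scomp_linear h _ b1 (scomp_head_arg_linear (scomp h g) b2 hu)).
  apply: eq_scomp => t1; rewrite IH //; last exact: mlin_cons.
  by apply: leq_trans hn; rewrite -ab -bb !size_cat addnA ltnS leq_addl.
rewrite -(splitsumA (fun a b1 b2 => scomp (scomp h g) (fun t =>
       u (scomp h (fun t => g (h (x :: a) :: t)) b1 :: t)) b2)).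
apply: eq_splitsum => a b ab.
have L := scomp_head_arg_linear (scomp h g) b hu.
rewrite scomp_cons.
have fD : {morph (fun z => scomp (scomp h g) (fun t => u (z :: t)) b) : x y / x + y}.
  by move=> y z; have := L 1 y z; rewrite !scale1r.
have f0 : scomp (scomp h g) (fun t => u (0 :: t)) b = 0.
  by have := L (-1) 0 0; rewrite scaler0 addr0 scaleN1r addNr.
by rewrite (splitsum_raddf _ _ f0 fD).
Qed.

Definition idser (s : seq B) : B := if s is [:: b] then b else 0.

Lemma scomp_id_r (V : lmodType R[i]) (u : seq B -> V) :
  multilinear u -> scomp idser u = u.
Proof.
move=> hu; apply/funext => s; elim: s u hu => [|x s IH] u hu //.
rewrite scomp_cons; case: s IH => [|y s] IH; first by rewrite splitsum_nil.
rewrite splitsum_cons IH; last exact: mlin_cons.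
rewrite splitsum0 ?addr0 // => a b _ /=.
rewrite -[RHS](scomp0 V idser b); apply: eq_scomp => t; exact: mlin_head0.
Qed.

Lemma scomp_id_l h : h [::] = 0 -> scomp h idser = h.
Proof.
move=> h0; apply/funext => -[|x s] /=; first by rewrite h0.
rewrite -[LHS]/(scomp h _ (x :: s)) scomp_cons.
case/lastP: s => [|s y]; first by rewrite splitsum_nil.
rewrite splitsum_rcons splitsum0 ?add0r // => a b _.
by case: b => [|z b]; rewrite scomp_cons splitsum0 // => c d _; exact: scomp0.
Qed.

Lemma mlin_splitsum (V : lmodType R[i]) (F : seq B -> seq B -> V) :
  (forall b, multilinear (F^~ b)) -> (forall a, multilinear (F a)) ->
  multilinear (splitsum F).
Proof.
move=> h1 h2 s t c x y; elim: s F h1 h2 => [|z s IH] F h1 h2 /=.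
  rewrite !splitsum_cons (h2 [::] [::]) /= scalerDr addrACA; congr (_ + _).
  by rewrite /splitsum scaler_sumr -big_split; apply: eq_bigr => k _; exact: (h1 _ [::]).
rewrite !splitsum_cons (h2 [::] (z :: s)) IH; first by rewrite scalerDr addrACA.
  by move=> b; exact: (mlin_cons z (h1 b)).
by move=> a; exact: h2.
Qed.

Lemma mlin_comp_head (V : lmodType R[i]) h (u : seq B -> V) f :
  multilinear h -> multilinear u -> multilinear f ->
  multilinear (scomp_head h u f).
Proof.
move=> hh hu hf s t c x y.
have L (v : seq B -> V) (f1 f2 : seq B -> B) r : multilinear v ->
    scomp_head h v (fun t => c *: f1 t + f2 t) r =
    c *: scomp_head h v f1 r + scomp_head h v f2 r.
  move=> hv; rewrite !scomp_headE /splitsum scaler_sumr -big_split.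
  by apply: eq_bigr => k _; exact: scomp_head_arg_linear.
elim: s u f hu hf => [|z s IH] u f hu hf /=.
  rewrite scalerDr addrACA -!L //; last exact: mlin_cons.
  by congr (scomp_head h _ _ _ + scomp_head h _ _ _); apply/funext => r; rewrite ?(hf [::]) ?(hh [::]).
by rewrite !IH ?scalerDr 1?addrACA //; exact: mlin_cons.
Qed.

Lemma mlin_comp (V : lmodType R[i]) h (u : seq B -> V) :
  multilinear h -> multilinear u -> multilinear (scomp h u).
Proof.
move=> hh hu [|z s] t c x y /=; last first.
  by apply: mlin_comp_head => //; exact: mlin_cons.
rewrite !scomp_headE /splitsum scaler_sumr -big_split.
apply: eq_bigr => k _; have /= -> := hh [::] (take k t) c x y.
exact: scomp_head_arg_linear.
Qed.

Lemma scomp_congr (V : lmodType R[i]) h h' (u : seq B -> V) s :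
  (forall t, (0 < size t <= size s)%N -> h t = h' t) -> scomp h u s = scomp h' u s.
Proof.
have [n] := ubnP (size s); elim: n u s => // n IH u [|x s] // /= /ltnSE hn hh.
rewrite -[LHS]/(scomp h _ (x :: s)) -[RHS]/(scomp _ u (x :: s)) !scomp_cons.
apply: eq_splitsum => a b ab; rewrite (hh (x :: a)); last first.
  by rewrite /= -ab size_cat ltnS leq_addr.
apply: IH; first by apply: leq_trans hn; rewrite -ab size_cat ltnS leq_addl.
move=> t /andP[t0 tb]; apply: hh; rewrite t0 (leq_trans tb) //= -ab size_cat.
by rewrite ltnW // ltnS leq_addl.
Qed.

End Composition.
Arguments idser {R B}.

(** * Fixed points of contractions of series *)

Section FixSer.
Variables (B : Type) (V : zmodType).
Implicit Types u v : seq B -> V.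

Definition contracting (F : (seq B -> V) -> seq B -> V) :=
  forall u v n, (forall t, (size t < n)%N -> u t = v t) ->
    forall t, (size t <= n)%N -> F u t = F v t.

Definition fixser (F : (seq B -> V) -> seq B -> V) (s : seq B) : V :=
  iter (size s).+1 F (fun=> 0) s.

Lemma fixserE F : contracting F -> F (fixser F) = fixser F.
Proof.
move=> cF.
have st n m s : (size s < n)%N -> (n <= m)%N ->
    iter n F (fun=> 0) s = iter m F (fun=> 0) s.
  elim: n m s => // n IH [//|m] s sn nm; apply: (cF _ _ n) => // t tn.
  exact: IH.
apply/funext => s; rewrite /fixser /=.
apply: (cF _ _ (size s)) => // t ts.
exact: (st (size t).+1).
Qed.

End FixSer.

Lemma fixser_mlin (R : realType) (B V : lmodType R[i])
    (F : (seq B -> V) -> seq B -> V) :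
  (forall u, multilinear u -> multilinear (F u)) -> multilinear (fixser F).
Proof.
move=> hF s t a x y; rewrite /fixser.
have E z : size (s ++ z :: t) = size (s ++ x :: t) by rewrite !size_cat.
rewrite !E; set n := _.+1.
have M k : multilinear (iter k F (fun=> 0)).
  elim: k => [|k IH] /=; last exact: hF.
  by move=> *; rewrite scaler0 addr0.
exact: M.
Qed.

(** * Compositional inverses *)

Section CompInverse.
Variables (R : realType) (B : lmodType R[i]).

(** Since the linear part of [g] is the identity, the equation reads
    h = I - (g - I) o h, whose right-hand side involves [h] on shorter words only. *)
Lemma scomp_rinv (g : seq B -> B) : multilinear g -> (forall b, g [:: b] = b) ->
  g [::] = 0 ->
  exists h, [/\ multilinear h, forall b, h [:: b] = b, h [::] = 0 &
                scomp h g = idser].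
Proof.
move=> mg g1 g0.
have mid : multilinear (@idser R B).
  move=> [|a [|b s]] [|c t] z x y //=; by rewrite scaler0 addr0.
pose F (h : seq B -> B) s := idser s - scomp h (fun t => g t - idser t) s.
have mg' : multilinear (fun t => g t - idser t).
  move=> s t a x y; rewrite mg mid scalerBr opprD.
  by rewrite addrACA.
have cF : contracting F.
  move=> u v n uv [|x s] sn //; rewrite /F; congr (_ - _).
  rewrite !scomp_cons; apply: eq_splitsum => a [|y b] ab /=.
    by rewrite !g1 /= !subrr.
  have sa : (size a < size s)%N by rewrite -ab size_cat addnS ltnS leq_addr.
  rewrite uv ?(leq_trans _ sn) //.
  rewrite -[LHS]/(scomp u _ (y :: b)) -[RHS]/(scomp v _ (y :: b)).
  apply: scomp_congr => t /andP[_ tb]; apply: uv.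
  by apply: leq_ltn_trans tb _; apply: leq_trans sn; rewrite -ab /= size_cat ltnS leq_addl.
have E := fixserE cF; set h := fixser F in E.
have mh : multilinear h.
  apply: fixser_mlin => u mu s t a x y; rewrite /F mid.
  by rewrite (mlin_comp mu mg') scalerBr opprD addrACA.
have h0 : h [::] = 0 by rewrite -E /F /= g0 subrr subr0.
exists h; split => //.
  by move=> b; rewrite -E /F /= g1 /= subrr subr0.
apply/funext => s.
transitivity (scomp h (fun t => idser t + (g t - idser t)) s).
  by apply: eq_scomp => t; rewrite addrC subrK.
by rewrite scompD scomp_id_l // -{1}E /F subrK.
Qed.

(** A right inverse has a right inverse itself, so it is two-sided. *)
Lemma scomp_inverse (g : seq B -> B) : multilinear g -> (forall b, g [:: b] = b) ->
  g [::] = 0 ->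
  exists h, [/\ multilinear h, h [::] = 0, scomp h g = idser & scomp g h = idser].
Proof.
move=> mg g1 g0; have [h [mh h1 h0 gh]] := scomp_rinv mg g1 g0.
have [k [mk k1 k0 hk]] := scomp_rinv mh h1 h0.
exists h; split => //; rewrite -hk; congr (scomp _ h).
rewrite -(scomp_id_l k0) -gh.
by rewrite scompA // hk scomp_id_r.
Qed.

End CompInverse.

(** * Unitizations and the convolution ring of series *)

Section Unitization.
Variables (R : realType) (V : nuAlgType R).

Lemma nu_mul0 (x : V) : 0 ** x = 0.
Proof. by rewrite -[0 in LHS](scale0r (0 : V)) nu_scalel scale0r. Qed.
Lemma nu_mulr0 (x : V) : x ** 0 = 0.
Proof. by rewrite -[0 in LHS](scale0r (0 : V)) nu_scaler scale0r. Qed.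

(** The carrier and the operations are those of [unitization], for an arbitrary
    algebra and as a ring, so that series over it form a ring with unit. *)
Definition uz : Type := (V * R[i]^o)%type.
HB.instance Definition _ := GRing.Lmodule.copy uz (V * R[i]^o)%type.

Definition uz_mul (u v : uz) : uz :=
  (u.1 ** v.1 + u.2 *: v.1 + v.2 *: u.1, u.2 * v.2).
Definition uz_one : uz := (0, 1).

Fact uz_mulA : associative uz_mul.
Proof.
move=> [a x] [b y] [c z]; rewrite /uz_mul /= mulrA; congr (_, _).
rewrite !(nu_mulDl, nu_mulDr, scalerDr, nu_scalel, nu_scaler, scalerA) mulgA.
rewrite -!addrA; congr (_ + _).
rewrite [RHS]addrCA; congr (_ + _); rewrite addrCA; congr (_ + _).
by rewrite addrCA [z * x]mulrC [z * y]mulrC.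
Qed.
Fact uz_mul1 : left_id uz_one uz_mul.
Proof. by move=> [a x]; rewrite /uz_mul /= nu_mul0 add0r scale1r scaler0 addr0 mul1r. Qed.
Fact uz_mulr1 : right_id uz_one uz_mul.
Proof. by move=> [a x]; rewrite /uz_mul /= nu_mulr0 add0r scale1r scaler0 add0r mulr1. Qed.
Fact uz_mulDl : left_distributive uz_mul +%R.
Proof.
move=> [a x] [b y] [c z]; rewrite /uz_mul /=; congr (_, _); last exact: mulrDl.
rewrite nu_mulDl scalerDl scalerDr -!addrA; congr (_ + _).
rewrite addrCA; congr (_ + _); rewrite [RHS]addrCA; congr (_ + _).
by rewrite [RHS]addrCA.
Qed.
Fact uz_mulDr : right_distributive uz_mul +%R.
Proof.
move=> [a x] [b y] [c z]; rewrite /uz_mul /=; congr (_, _); last exact: mulrDr.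
rewrite nu_mulDr scalerDl scalerDr -!addrA; congr (_ + _).
rewrite addrCA; congr (_ + _); rewrite [RHS]addrCA; congr (_ + _).
by rewrite [RHS]addrCA.
Qed.

HB.instance Definition _ :=
  GRing.Zmodule_isPzRing.Build uz uz_mulA uz_mul1 uz_mulr1 uz_mulDl uz_mulDr.

Lemma uz_scalel (a : R[i]) (u v : uz) : (a *: u) * v = a *: (u * v).
Proof.
case: u v => [u x] [v y]; congr (_, _) => /=; last exact: (esym (mulrA a x y)).
by rewrite !(nu_scalel, scalerDr, scalerA) [a * y]mulrC.
Qed.
Lemma uz_scaler (a : R[i]) (u v : uz) : u * (a *: v) = a *: (u * v).
Proof.
case: u v => [u x] [v y]; congr (_, _) => /=; last exact: (mulrCA x a y).
by rewrite !(nu_scaler, scalerDr, scalerA) [a * x]mulrC.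
Qed.

End Unitization.

Section Series.
Variables (T : Type) (U : pzRingType).

(** Letters are taken from [B] and coefficients from the unitization of [A] or of [B];
    multilinearity is imposed only where composition needs it. *)
Definition mser : Type := seq T -> U.
HB.instance Definition _ := GRing.Zmodule.copy mser (seq T -> U).

Definition ser_conv (u v : mser) : mser := splitsum (fun a b => u a * v b).
Definition ser_unit : mser := fun s => if s is [::] then 1 else 0.

Fact ser_convA : associative ser_conv.
Proof.
move=> u v w; apply/funext => s; rewrite /ser_conv.
transitivity (splitsum (fun a b => splitsum (fun b1 b2 => u a * v b1 * w b2) b) s).
  apply: eq_splitsum => a b _; rewrite (splitsum_raddf _ _ (mulr0 (u a)) (mulrDr (u a))).
  by apply: eq_splitsum => *; rewrite mulrA.
rewrite -(splitsumA (fun a b1 b2 => u a * v b1 * w b2)).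
apply: eq_splitsum => a b _.
by rewrite (splitsum_raddf _ _ (mul0r (w b)) (fun x y => mulrDl x y (w b))).
Qed.
Fact ser_conv1 : left_id ser_unit ser_conv.
Proof.
move=> u; apply/funext => -[|x s]; first by rewrite /ser_conv splitsum_nil mul1r.
rewrite /ser_conv splitsum_cons mul1r splitsum0 ?addr0 // => a b _.
exact: mul0r.
Qed.
Fact ser_convr1 : right_id ser_unit ser_conv.
Proof.
move=> u; apply/funext; case/lastP => [|s x]; first by rewrite /ser_conv splitsum_nil mulr1.
rewrite /ser_conv splitsum_rcons mulr1 splitsum0 ?add0r // => a b _.
by case: b => [|y b]; exact: mulr0.
Qed.
Fact ser_convDl : left_distributive ser_conv +%R.
Proof.
move=> u v w; apply/funext => s; rewrite /ser_conv -[RHS]/(splitsum _ s + splitsum _ s) -splitsumD.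
by apply: eq_splitsum => a b _; exact: mulrDl.
Qed.
Fact ser_convDr : right_distributive ser_conv +%R.
Proof.
move=> u v w; apply/funext => s; rewrite /ser_conv -[RHS]/(splitsum _ s + splitsum _ s) -splitsumD.
by apply: eq_splitsum => a b _; exact: mulrDr.
Qed.

HB.instance Definition _ :=
  GRing.Zmodule_isPzRing.Build mser ser_convA ser_conv1 ser_convr1 ser_convDl ser_convDr.

Lemma serM (u v : mser) s : (u * v) s = splitsum (fun a b => u a * v b) s.
Proof. by []. Qed.
Lemma ser1_nil : (1 : mser) [::] = 1. Proof. by []. Qed.
Lemma ser1_cons x s : (1 : mser) (x :: s) = 0. Proof. by []. Qed.
Lemma serDE (u v : mser) s : (u + v) s = u s + v s. Proof. by []. Qed.
Lemma serNE (u : mser) s : (- u) s = - u s. Proof. by []. Qed.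
Lemma serM_nil (u v : mser) : (u * v) [::] = u [::] * v [::].
Proof. exact: splitsum_nil. Qed.
Lemma ser_sumE (I : Type) (r : seq I) (P : pred I) (F : I -> mser) s :
  (\sum_(i <- r | P i) F i) s = \sum_(i <- r | P i) F i s.
Proof. by elim/big_rec2: _ => // i x y _ <-. Qed.

End Series.

Section SeriesInverse.
Variables (R : realType) (B : lmodType R[i]) (V : nuAlgType R).
Notation S := (mser B (uz V)).
Implicit Types u v : S.

Lemma mlin_serM u v : multilinear u -> multilinear v -> multilinear (u * v : S).
Proof.
move=> mu mv; apply: mlin_splitsum => [b|a] s t c x y.
  by rewrite /= mu mulrDl uz_scalel.
by rewrite mv mulrDr uz_scaler.
Qed.

Lemma mlin_ser1 : multilinear (1 : S).
Proof. by move=> [|z s] t a x y; rewrite /= scaler0 addr0. Qed.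

Lemma mlin_serD u v : multilinear u -> multilinear v -> multilinear (u + v : S).
Proof. by move=> mu mv s t a x y; rewrite !serDE mu mv scalerDr addrACA. Qed.

Lemma mlin_serN u : multilinear u -> multilinear (- u : S).
Proof. by move=> mu s t a x y; rewrite !serNE mu opprD scalerN. Qed.

Lemma ser_left_cancel u v w : u * v = 1 -> w * u = 1 -> v = w :> S.
Proof. by move=> uv wu; rewrite -[v]mul1r -wu -mulrA uv mulr1. Qed.

Definition is_inv (u w : S) := u * w = 1 /\ w * u = 1.

(** Both one-sided inverses are fixed points of contractions. *)
Lemma ser_inverse u : u [::] = 0 -> exists w : S, is_inv (1 - u) w.
Proof.
move=> u0.
pose Fl (w : S) : S := 1 + u * w; pose Fr (w : S) : S := 1 + w * u.
have cl : contracting Fl.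
  move=> v w n vw s sn; rewrite /Fl !serDE; congr (_ + _).
  rewrite !serM; apply: eq_splitsum => a b ab.
  case: a ab => [|x a] ab; first by rewrite u0 !mul0r.
  by rewrite vw //; apply: leq_trans sn; rewrite -ab /= size_cat ltnS leq_addl.
have cr : contracting Fr.
  move=> v w n vw s sn; rewrite /Fr !serDE; congr (_ + _).
  rewrite !serM; apply: eq_splitsum => a b ab.
  case: b ab => [|x b] ab; first by rewrite u0 !mulr0.
  by rewrite vw //; apply: leq_trans sn; rewrite -ab size_cat addnS ltnS leq_addr.
have El : Fl (fixser Fl) = fixser Fl by exact: fixserE.
have Er : Fr (fixser Fr) = fixser Fr by exact: fixserE.
set w := fixser Fl in El; set w' := fixser Fr in Er.
have h1 : (1 - u) * (w : S) = 1 by rewrite mulrBl mul1r -{1}El /Fl addrK.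
have h2 : (w' : S) * (1 - u) = 1 by rewrite mulrBr mulr1 -{1}Er /Fr addrK.
exists w; split => //; by rewrite (ser_left_cancel h1 h2).
Qed.

(** The inverse is the fixed point of w |-> 1 + u w, which preserves multilinearity. *)
Lemma is_inv_mlin u w : u [::] = 0 -> multilinear u -> is_inv (1 - u) w ->
  multilinear w.
Proof.
move=> u0 mu [uw wu].
pose F (w : S) : S := 1 + u * w.
have cF : contracting F.
  move=> v v' n vw s sn; rewrite /F !serDE; congr (_ + _).
  rewrite !serM; apply: eq_splitsum => a b ab.
  case: a ab => [|x a] ab; first by rewrite u0 !mul0r.
  by rewrite vw //; apply: leq_trans sn; rewrite -ab /= size_cat ltnS leq_addl.
have E : F (fixser F) = fixser F by exact: fixserE.
have <- : fixser F = w.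
  set v := fixser F in E.
  have h1 : (1 - u) * (v : S) = 1 by rewrite mulrBl mul1r -{1}E /F addrK.
  exact: ser_left_cancel h1 wu.
apply: fixser_mlin => v mv; apply: mlin_serD; first exact: mlin_ser1.
exact: mlin_serM.
Qed.

End SeriesInverse.

(** * Linear maps applied to series *)

Lemma splitsum_ind (T : Type) (V : nmodType) (K : V -> Prop) F (s : seq T) :
  K 0 -> (forall x y, K x -> K y -> K (x + y)) ->
  (forall a b, a ++ b = s -> K (F a b)) -> K (splitsum F s).
Proof.
move=> K0 KD KF; apply: big_ind => // k _; apply: KF; exact: cat_take_drop.
Qed.

Section UzMaps.
Variables (R : realType) (V W : nuAlgType R).

Definition uz_in (x : V) : uz V := (x, 0).
Definition uz_map (f : V -> W) (u : uz V) : uz W := (f u.1, u.2).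

Lemma uz_ext (u v : uz V) : u.1 = v.1 -> u.2 = v.2 -> u = v.
Proof. by case: u v => [? ?] [? ?] /= -> ->. Qed.
Lemma uzM1 (u v : uz V) : (u * v).1 = u.1 ** v.1 + u.2 *: v.1 + v.2 *: u.1.
Proof. by []. Qed.
Lemma uzM2 (u v : uz V) : (u * v).2 = u.2 * v.2.
Proof. by []. Qed.

Lemma uz_inM x y : uz_in x * uz_in y = uz_in (x ** y).
Proof. by congr (_, _); rewrite /= ?scale0r ?addr0 ?mulr0. Qed.
Lemma uz_inD x y : uz_in x + uz_in y = uz_in (x + y).
Proof. by congr (_, _); rewrite /= addr0. Qed.
Lemma uz_in_lin (a : R[i]) x y : uz_in (a *: x + y) = a *: uz_in x + uz_in y.
Proof. by congr (_, _); rewrite /= scaler0 addr0. Qed.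
Lemma uz_inE (u : uz V) : u.2 = 0 -> u = uz_in u.1.
Proof. by case: u => u x /= ->. Qed.
Lemma uz_in_inj : injective uz_in. Proof. by move=> x y []. Qed.

Variable f : V -> W.
Hypothesis lf : linear f.

Lemma lin0 : f 0 = 0.
Proof. by have := lf (-1) 0 0; rewrite scaler0 addr0 scaleN1r addNr. Qed.
Lemma linD x y : f (x + y) = f x + f y.
Proof. by have := lf 1 x y; rewrite !scale1r. Qed.
Lemma linZ a x : f (a *: x) = a *: f x.
Proof. by have := lf a x 0; rewrite !addr0 lin0 addr0. Qed.

Lemma uz_map_lin : linear (uz_map f).
Proof. by move=> a [x z] [y t]; congr (_, _); rewrite /= lf. Qed.
Lemma uz_map0 : uz_map f 0 = 0.
Proof. by congr (_, _); rewrite /= lin0. Qed.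
Lemma uz_map1 : uz_map f 1 = 1.
Proof. by congr (_, _); rewrite /= lin0. Qed.
Lemma uz_mapD u v : uz_map f (u + v) = uz_map f u + uz_map f v.
Proof. by congr (_, _); rewrite /= linD. Qed.
Definition smap T (u : mser T (uz V)) : mser T (uz W) := fun s => uz_map f (u s).

Variable T : Type.
Implicit Types u v : mser T (uz V).

Lemma smapD u v : smap (u + v) = smap u + smap v.
Proof. by apply/funext => s; exact: uz_mapD. Qed.
Lemma smap0 : smap (0 : mser T (uz V)) = 0.
Proof. by apply/funext => s; exact: uz_map0. Qed.
Lemma smap1 : smap (1 : mser T (uz V)) = 1.
Proof. by apply/funext => -[|x s]; [exact: uz_map1 | exact: uz_map0]. Qed.
Lemma smap_sum (J : Type) (r : seq J) (P : pred J) (F : J -> mser T (uz V)) :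
  smap (\sum_(i <- r | P i) F i) = \sum_(i <- r | P i) smap (F i).
Proof. exact: (big_morph _ smapD smap0). Qed.
Lemma smapN u : smap (- u) = - smap u.
Proof. by apply/eqP; rewrite -addr_eq0 -smapD addNr smap0. Qed.

Lemma smapM_eq u v s :
  (forall a b, a ++ b = s -> uz_map f (u a * v b) = uz_map f (u a) * uz_map f (v b)) ->
  smap (u * v) s = (smap u * smap v) s.
Proof.
move=> h; rewrite /smap serM (splitsum_raddf _ _ uz_map0 uz_mapD).
exact: eq_splitsum.
Qed.

End UzMaps.
Arguments uz_in {R V}.

Definition ser_in (R : realType) (V : nuAlgType R) T (u : seq T -> V) :
  mser T (uz V) := fun s => uz_in (u s).

Definition ser_cst (R : realType) (V : nuAlgType R) T (x : V) :
  mser T (uz V) := fun s => if s is [::] then uz_in x else 0.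

(** * Cumulant pairs *)

Section CumulantPair.
Variables (R : realType) (B A : nuAlgType R) (iota : B -> A) (Phi Psi : A -> B).
Hypothesis lin_iota : linear iota.
Hypothesis iotaM : forall b c, iota (b ** c) = iota b ** iota c.
Hypothesis condPhi : conditional_expectation iota Phi.
Hypothesis condPsi : conditional_expectation iota Psi.

Notation SB := (mser B (uz B)).
Notation SA := (mser B (uz A)).

Definition serI : SB := ser_in idser.

Lemma smap_iotaM (u v : SB) : smap iota (u * v) = smap iota u * smap iota v.
Proof.
apply/funext => s; apply: smapM_eq => // a b _; apply: uz_ext => //.
by rewrite /= ?uzM1 /= !(linD lin_iota) !(linZ lin_iota) iotaM.
Qed.

Section CondExp.
Variable E : A -> B.
Hypothesis condE : conditional_expectation iota E.

Lemma smap_condl (u : SB) (v : SA) : smap E (smap iota u * v) = u * smap E v.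
Proof.
case: condE => lE El Er Ei; apply/funext => s.
rewrite smapM_eq // => [|a b _]; last first.
  by apply: uz_ext => //; rewrite /= ?uzM1 /= !(linD lE) !(linZ lE) El Ei.
by congr (ser_conv _ _ s); apply/funext => t; apply: uz_ext => //=; rewrite Ei.
Qed.

Lemma smap_condr (u : SB) (v : SA) : smap E (v * smap iota u) = smap E v * u.
Proof.
case: condE => lE El Er Ei; apply/funext => s.
rewrite smapM_eq // => [|a b _]; last first.
  by apply: uz_ext => //; rewrite /= ?uzM1 /= !(linD lE) !(linZ lE) Er Ei.
by congr (ser_conv _ _ s); apply/funext => t; apply: uz_ext => //=; rewrite Ei.
Qed.

Lemma smap_cond (u : SB) : smap E (smap iota u) = u.
Proof. have lE : linear E by case: condE.
by rewrite -[smap iota u]mulr1 smap_condl (smap1 lE) mulr1. Qed.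

End CondExp.

Definition cumulant_arg (X : A) (r : seq B -> B) : SA :=
  (ser_cst X - smap iota (ser_in r)) * smap iota serI.

(** The functional equations for the two transforms, free of composition; in the
    scalar case they say that r and c are the R- and cR-transforms in their
    resolvent form. *)
Definition cumulant_pair (X : A) (r c : seq B -> B) :=
  exists2 W : SA, is_inv (1 - cumulant_arg X r) W /\ smap Psi W = 1 &
    smap Phi W * (1 - (ser_in c - ser_in r) * serI) = 1.

Lemma mulI_nil (U : SB) : (U * serI) [::] = 0.
Proof. by rewrite serM_nil /serI /ser_in /= mulr0. Qed.

Lemma cumulant_arg_nil X r : cumulant_arg X r [::] = 0.
Proof. by rewrite /cumulant_arg serM_nil /smap /serI /ser_in /= (uz_map0 lin_iota) mulr0. Qed.

(** * Conditional freeness for series *)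

Section Alternating.
Variables (I : eqType) (D : I -> set A).
Hypothesis free : cfree D Phi Psi.

(** What is true of a sum of alternating products of centered elements whose first
    factor has color [i], in a form that is closed under sums: such an element may be
    appended to every alternating word of centered elements that does not end in
    color [i]. *)
Definition alt_from (i : I) (a : A) : Prop :=
  Psi a = 0 /\ forall (x : I * A) (s : seq (I * A)),
    path (fun p q => p.1 != q.1) x s ->
    (forall p, p \in x :: s -> D p.1 p.2 /\ Psi p.2 = 0) ->
    (last x s).1 != i ->
    Psi (nprod x.2 [seq p.2 | p <- s] ** a) = 0 /\
    Phi (nprod x.2 [seq p.2 | p <- s] ** a) =
      nprod (Phi x.2) [seq Phi p.2 | p <- s] ** Phi a.

Let lPhi : linear Phi. Proof. by case: condPhi. Qed.
Let lPsi : linear Psi. Proof. by case: condPsi. Qed.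

Lemma alt_from0 i : alt_from i 0.
Proof.
split=> [|x s _ _ _]; first exact: (lin0 lPsi).
by rewrite nu_mulr0 (lin0 lPsi) (lin0 lPhi) nu_mulr0.
Qed.

Lemma alt_fromD i a b : alt_from i a -> alt_from i b -> alt_from i (a + b).
Proof.
move=> [a0 ha] [b0 hb]; split=> [|x s h1 h2 h3].
  by rewrite (linD lPsi) a0 b0 addr0.
have [e1 e2] := ha x s h1 h2 h3; have [e3 e4] := hb x s h1 h2 h3.
by rewrite nu_mulDr (linD lPsi) !(linD lPhi) e1 e2 e3 e4 addr0 nu_mulDr.
Qed.

Lemma nprod_rcons (V : nuAlgType R) (a b : V) s : nprod a (rcons s b) = nprod a s ** b.
Proof. by rewrite /nprod -cats1 foldl_cat. Qed.

Lemma alt_from_letter i d : D i d -> Psi d = 0 -> alt_from i d.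
Proof.
move=> Dd d0; split=> // x s h1 h2 h3.
have := free (x := x) (s := rcons s (i, d)).
rewrite !map_rcons !nprod_rcons; apply; first by rewrite rcons_path h1.
move=> p; rewrite -rcons_cons mem_rcons inE => /orP[/eqP -> //|]; exact: h2.
Qed.

(** Testing against a word followed by [d] instead of the word alone. *)
Lemma alt_from_mul i j d a : D i d -> Psi d = 0 -> alt_from j a -> i != j ->
  alt_from i (d ** a) /\ Phi (d ** a) = Phi d ** Phi a.
Proof.
move=> Dd d0 [a0 ha] ij.
have [p0 pm] : Psi (d ** a) = 0 /\ Phi (d ** a) = Phi d ** Phi a.
  by apply: (ha (i, d) [::]) => // p; rewrite inE => /eqP ->.
do 2 split => //; move=> x s h1 h2 h3.
rewrite pm !mulgA -[nprod x.2 _ ** d]nprod_rcons -[nprod _ _ ** Phi d]nprod_rcons.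
have := ha x (rcons s (i, d)); rewrite !map_rcons; apply.
- by rewrite rcons_path h1.
- move=> p; rewrite -rcons_cons mem_rcons inE => /orP[/eqP -> //|]; exact: h2.
- by rewrite last_rcons.
Qed.

Variables (r : seq I) (x Om : I -> SA).
Hypothesis x_nil : forall i, x i [::] = 0.
Hypothesis x_in : forall i s, [/\ (x i s).2 = 0, D i (x i s).1 & Psi (x i s).1 = 0].
Hypothesis Om_rec : forall i, i \in r -> Om i = x i * (1 + \sum_(j <- r | j != i) Om j).

Lemma uz_zero2 (u v : uz A) : u.2 = 0 -> v.2 = 0 -> (u * v) = uz_in (u.1 ** v.1).
Proof. by case: u v => u a [v b] /= -> ->; rewrite uz_inM. Qed.

(** Each coefficient of [Om i] is a sum of alternating products starting in color [i]:
    unfolding the recursion strips one factor [x i], which uses up a nonempty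
    prefix of the word. *)
Lemma Om_alt i s : i \in r -> (Om i s).2 = 0 /\ alt_from i (Om i s).1.
Proof.
have [n] := ubnP (size s); elim: n i s => // n IH i s /ltnSE hn ir.
pose K (u : uz A) := u.2 = 0 /\ alt_from i u.1.
have K0 : K 0 by split=> //; exact: alt_from0.
have KD u v : K u -> K v -> K (u + v).
  by move=> [u2 u1] [v2 v1]; split; [rewrite /= u2 v2 addr0 | exact: alt_fromD].
rewrite -/(K _) Om_rec // serM; apply: splitsum_ind => // a b ab.
have [x2 x1 x0] := x_in i a.
rewrite serDE mulrDr; apply: (KD).
  case: b ab => [|y b] ab; last by rewrite mulr0.
  by rewrite mulr1; split => //; exact: alt_from_letter.
case: a ab x2 x1 x0 => [|y a] ab x2 x1 x0; first by rewrite x_nil mul0r.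
rewrite ser_sumE mulr_sumr big_seq_cond; apply: (big_ind K K0 KD) => j /andP[jr ji].
have [q2 q1] : (Om j b).2 = 0 /\ alt_from j (Om j b).1.
  by apply: IH => //; apply: leq_trans hn; rewrite -ab /= size_cat ltnS leq_addl.
rewrite uz_zero2 //; split => //=.
by apply: (alt_from_mul (j := j) _ _ _ _).1 => //; rewrite eq_sym.
Qed.

Lemma smap_Psi_Om i : i \in r -> smap Psi (Om i) = 0.
Proof. by move=> ir; apply/funext => s; have [q2 [q1 _]] := Om_alt s ir; apply: uz_ext. Qed.

(** [Phi] carries the recursion of the alternating products to its image, because it
    is multiplicative on them. *)
Lemma smap_Phi_Om i : i \in r ->
  smap Phi (Om i) = smap Phi (x i) * (1 + \sum_(j <- r | j != i) smap Phi (Om j)).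
Proof.
move=> ir; rewrite {1}Om_rec // -smap_sum // -(smap1 lPhi) -smapD //.
apply/funext => s; apply: smapM_eq => // a b ab.
have [x2 x1 x0] := x_in i a.
rewrite serDE mulrDr !(uz_mapD lPhi) mulrDr; congr (_ + _).
  by case: b ab => [|y b] ab; rewrite ?mulr1 ?mulr0 ?(uz_map1 lPhi) ?(uz_map0 lPhi) ?mulr1 ?mulr0.
rewrite ser_sumE !(big_morph _ (uz_mapD lPhi) (uz_map0 lPhi)) !mulr_sumr.
rewrite (big_morph _ (uz_mapD lPhi) (uz_map0 lPhi)).
rewrite big_seq_cond [RHS]big_seq_cond; apply: eq_bigr => j /andP[jr ji]; have [q2 q1] := Om_alt b jr.
rewrite uz_zero2 // [RHS]/GRing.mul /= /uz_mul /= x2 q2 !scale0r !addr0 mulr0.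
have ij : i != j by rewrite eq_sym.
by have [_ e] := alt_from_mul x1 x0 q1 ij; apply: uz_ext => //=; rewrite e.
Qed.

End Alternating.

End CumulantPair.
Arguments serI {R B}.

Section Cumulants.
Variables (R : realType) (B A : nuAlgType R) (iota : B -> A) (Phi Psi : A -> B).
Hypothesis lin_iota : linear iota.
Hypothesis iotaM : forall b c, iota (b ** c) = iota b ** iota c.
Hypothesis condPhi : conditional_expectation iota Phi.
Hypothesis condPsi : conditional_expectation iota Psi.

Notation SB := (mser B (uz B)).
Notation SA := (mser B (uz A)).
Notation cumulant_pair := (cumulant_pair iota Phi Psi).

Let lPhi : linear Phi. Proof. by case: condPhi. Qed.
Let lPsi : linear Psi. Proof. by case: condPsi. Qed.

(** * Additivity of the cumulants *)

Section Additivity.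
Variables (I : eqType) (D : I -> set A) (X : I -> A) (Rf Cf : I -> seq B -> B).
Hypothesis free : cfree D Phi Psi.
Hypothesis D0 : forall i, D i 0.
Hypothesis DD : forall i x y, D i x -> D i y -> D i (x + y).
Hypothesis DN : forall i x, D i x -> D i (- x).
Hypothesis DM : forall i x y, D i x -> D i y -> D i (x ** y).
Hypothesis DX : forall i, D i (X i).
Hypothesis Diota : forall i b, D i (iota b).
Hypothesis cpX : forall i, cumulant_pair (X i) (Rf i) (Cf i).

Let inD i (u : uz A) := u.2 = 0 /\ D i u.1.

Let inD0 i : inD i 0. Proof. by split => //; exact: D0. Qed.
Let inDD i u v : inD i u -> inD i v -> inD i (u + v).
Proof. by move=> [u2 u1] [v2 v1]; split; [rewrite /= u2 v2 addr0 | exact: DD]. Qed.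
Let inDM i u v : inD i u -> inD i v -> inD i (u * v).
Proof.
by move=> [u2 u1] [v2 v1]; rewrite uz_zero2 //; split => //; exact: DM.
Qed.

Lemma cumulant_arg_in i s : inD i (cumulant_arg iota (X i) (Rf i) s).
Proof.
rewrite /cumulant_arg serM; apply: splitsum_ind => [||a b _]; [exact: inD0 | exact: inDD |].
apply: inDM; last by split=> //; exact: Diota.
rewrite serDE serNE; apply: inDD.
  by case: a => [|x a] /=; [split => //; exact: DX | exact: inD0].
by split; [rewrite /= oppr0 | apply: DN; exact: Diota].
Qed.

(** W - 1 = y W lets membership in the subalgebra propagate to longer words, although
    the subalgebra need not contain a unit. *)
Lemma is_inv_in i W : is_inv (1 - cumulant_arg iota (X i) (Rf i)) W ->
  forall s, inD i ((W - 1 : SA) s).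
Proof.
move=> [yW _] s; set y := cumulant_arg _ _ _ in yW.
have E : W - 1 = y * (1 + (W - 1)).
  by rewrite [1 + _]addrC subrK -{1}yW mulrBl mul1r opprB addrC subrK.
have [n] := ubnP (size s); elim: n s => // n IH s /ltnSE hn.
rewrite E serM; apply: splitsum_ind => [||a b ab]; [exact: inD0 | exact: inDD |].
have ya : inD i (y a) by exact: cumulant_arg_in.
rewrite serDE mulrDr; apply: inDD.
  by case: b ab => [|z b] ab; rewrite ?mulr1 ?mulr0 //; exact: inD0.
case: a ab ya => [|z a] ab ya.
  by rewrite /y cumulant_arg_nil // mul0r; exact: inD0.
apply: inDM => //; apply: IH; apply: leq_trans hn.
by rewrite -ab /= size_cat ltnS leq_addl.
Qed.

Lemma cumulant_arg_sum (r : seq I) :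
  cumulant_arg iota (\sum_(i <- r) X i) (fun s => \sum_(i <- r) Rf i s) =
  \sum_(i <- r) cumulant_arg iota (X i) (Rf i).
Proof.
rewrite /cumulant_arg -mulr_suml; congr (_ * _); rewrite sumrB; congr (_ - _).
  apply/funext => s; rewrite ser_sumE; case: s => [|x s] /=; last by rewrite big1.
  by rewrite (big_morph _ (fun x y => esym (uz_inD x y)) (erefl (uz_in 0))).
rewrite -smap_sum //; congr (smap _ _); apply/funext => s; rewrite ser_sumE.
by rewrite /ser_in (big_morph _ (fun x y => esym (uz_inD x y)) (erefl (uz_in 0))).
Qed.

(** The inverse [Om] of 1 - (sum of the y_i) decomposes as 1 plus the sum of the
    [Omi i] = y_i Om, which collect the alternating products starting with x_i; they
    satisfy Om_i = x_i (Om - Om_i). *)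
Lemma cumulant_pair_sum (r : seq I) : uniq r ->
  cumulant_pair (\sum_(i <- r) X i) (fun s => \sum_(i <- r) Rf i s)
        (fun s => \sum_(i <- r) Cf i s).
Proof.
move=> ur.
pose y i := cumulant_arg iota (X i) (Rf i).
have [i|W hW] := @choice _ _ (fun i (W : SA) => [/\ is_inv (1 - y i) W,
    smap Psi W = 1 &
    smap Phi W * (1 - (ser_in (Cf i) - ser_in (Rf i)) * serI) = 1]).
  by have [W [h1 h2] h3] := cpX i; exists W.
pose x i := W i - 1.
pose Y : SA := \sum_(i <- r) y i.
have Y0 : Y [::] = 0.
  by rewrite /Y ser_sumE big1 // => i _; exact: cumulant_arg_nil.
have [Om hOm] := ser_inverse Y0; have [YO OY] := hOm.
pose Omi i := y i * Om.
have OmE : Om = 1 + \sum_(i <- r) Omi i.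
  by rewrite -mulr_suml -/Y -YO mulrBl mul1r subrK.
have WO i : W i * Omi i = x i * Om.
  have [[_ h] _ _] := hW i.
  by rewrite /Omi mulrA /x; congr (_ * _); rewrite -h mulrBr mulr1 opprB addrC subrK.
have Om_sub i : i \in r -> Om - Omi i = 1 + \sum_(j <- r | j != i) Omi j.
  by move=> ir; rewrite OmE (bigD1_seq i) //= [Omi i + _]addrC addrA addrK.
have Om_rec i : i \in r -> Omi i = x i * (1 + \sum_(j <- r | j != i) Omi j).
  move=> ir; rewrite -Om_sub // mulrBr -WO /x mulrBl mul1r opprB addrC subrK //.
have x_nil i : x i [::] = 0.
  have [[h _] _ _] := hW i.
  have : ((1 - y i) * W i) [::] = 1 by rewrite h.
  by rewrite serM_nil serDE serNE /y cumulant_arg_nil // subr0 mul1r => e; rewrite /x serDE serNE e subrr.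
have x_in i s : [/\ (x i s).2 = 0, D i (x i s).1 & Psi (x i s).1 = 0].
  have [h hp _] := hW i; have [x2 x1] := is_inv_in h s; split => //.
  have : smap Psi (x i) = 0 by rewrite /x smapD // smapN // hp smap1 // subrr.
  by move/(congr1 (fun u : SB => (u s).1)).
exists Om.
  split.
    rewrite cumulant_arg_sum; exact: hOm.
  rewrite OmE smapD // smap1 // smap_sum // big_seq big1 ?addr0 // => i ir.
  exact: (smap_Psi_Om condPhi condPsi free x_nil x_in Om_rec ir).
pose e i : SB := (ser_in (Cf i) - ser_in (Rf i)) * serI.
have e0 i : e i [::] = 0 by exact: mulI_nil.
have PhiOm i : i \in r -> smap Phi (Omi i) = e i * smap Phi Om.
  move=> ir; have [_ _ h] := hW i.
  have [F hF] := ser_inverse (e0 i).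
  have hl : (1 - e i) * smap Phi (W i) = 1.
    by rewrite -(ser_left_cancel hF.1 h) hF.1.
  have PO : smap Phi (Omi i) =
      smap Phi (x i) * (smap Phi Om - smap Phi (Omi i)).
    rewrite {1}(smap_Phi_Om condPhi condPsi free x_nil x_in Om_rec ir).
    congr (_ * _); rewrite -(smap1 lPhi) -smap_sum // -smapD // -Om_sub //.
    by rewrite smapD // smapN.
  (* Phi W_i = 1 + Phi x_i turns the recursion into Phi W_i * Phi Om_i = Phi x_i * Phi Om *)
  have PO' : smap Phi (W i) * smap Phi (Omi i) = smap Phi (x i) * smap Phi Om.
    move: PO; rewrite mulrBr => /eqP; rewrite eq_sym subr_eq => /eqP ->.
    rewrite -[W i](subrK 1) -/(x i) smapD // smap1 // mulrDl mul1r.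
    by rewrite addrC.
  rewrite -[LHS]mul1r -hl -mulrA PO' /x smapD // smapN // smap1 //.
  by rewrite mulrA mulrBr hl mulr1 opprB addrC subrK.
have E : (1 - \sum_(i <- r) e i) * smap Phi Om = 1.
  rewrite mulrBl mul1r {1}OmE smapD // smap1 // smap_sum // mulr_suml big_seq.
  by rewrite (eq_bigr _ PhiOm) -big_seq addrK.
have S0 : (\sum_(i <- r) e i : SB) [::] = 0.
  by rewrite ser_sumE big1 // => i _; exact: e0.
have [F hF] := ser_inverse S0.
rewrite (ser_left_cancel E hF.2).
have -> : (ser_in (fun s => \sum_(i <- r) Cf i s) -
           ser_in (fun s => \sum_(i <- r) Rf i s)) * serI =
          \sum_(i <- r) e i :> SB.
  rewrite -mulr_suml sumrB; congr ((_ - _) * _); apply/funext => s; rewrite ser_sumE;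
  by rewrite /ser_in (big_morph _ (fun x y => esym (uz_inD x y)) (erefl (uz_in 0))).
exact: hF.2.
Qed.

End Additivity.

(** * Uniqueness of the cumulants *)

Section Uniqueness.
Hypothesis faithful : forall x y : B, (forall b, x ** b = y ** b) -> x = y.

(** A series vanishing on shorter words meets only the constant term of its cofactor. *)
Lemma serM_low (V : nuAlgType R) (u d : mser B (uz V)) s :
  (forall t, (size t < size s)%N -> d t = 0) -> (u * d) s = u [::] * d s.
Proof.
case: s => [|x s] h; first exact: serM_nil.
rewrite serM splitsum_cons splitsum0 ?addr0 // => a b ab.
by rewrite h ?mulr0 // -ab /= size_cat ltnS leq_addl.
Qed.

Lemma serM_lowr (V : nuAlgType R) (u d : mser B (uz V)) s :
  (forall t, (size t < size s)%N -> d t = 0) -> (d * u) s = d s * u [::].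
Proof.
case/lastP: s => [|s x] h; first exact: serM_nil.
rewrite serM splitsum_rcons splitsum0 ?add0r // => a b ab.
by rewrite h ?mul0r // -ab size_rcons size_cat ltnS leq_addr.
Qed.

(** Right multiplication by I multiplies by an arbitrary last letter, and [B] has
    enough elements to cancel it. *)
Lemma serI_inj (u v : seq B -> B) : ser_in u * serI = ser_in v * serI -> u = v.
Proof.
move=> h; apply/funext => s; apply: faithful => b.
have := congr1 (fun w : SB => (w (rcons s b)).1) h.
have E w : ((ser_in w * serI : SB) (rcons s b)) = uz_in (w s ** b).
  rewrite serM splitsum_rcons /serI [ser_in idser [::]]/ser_in /= mulr0 addr0.
  case/lastP: s => [|s x]; first by rewrite splitsum_nil uz_inM.
  rewrite splitsum_rcons splitsum0 ?add0r ?uz_inM // => c d _.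
  by rewrite [ser_in idser _]/ser_in; case: d => [|? [|? ?]]; rewrite /= mulr0.
by rewrite !E.
Qed.

Lemma inv_nil (V : nuAlgType R) (u w : mser B (uz V)) :
  u [::] = 0 -> is_inv (1 - u) w -> w [::] = 1.
Proof.
move=> u0 [h _]; have := congr1 (fun w : mser B (uz V) => w [::]) h.
by rewrite serM_nil serDE serNE u0 subr0 mul1r.
Qed.

(** If [d] is the difference of the two series 1 - (X - r) I, then W d W' = W - W' is
    killed by [Psi]; its lowest term is that of [d], so [d] vanishes.  Then [c] is read
    off from the inverse of Phi W. *)
Lemma cumulant_pair_uniq X r c r' c' : cumulant_pair X r c -> cumulant_pair X r' c' -> r = r' /\ c = c'.
Proof.
move=> [W [hW pW] fW] [W' [hW' pW'] fW'].
have rr : r = r'.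
  pose d : SB := (ser_in r' - ser_in r) * serI.
  have dE : smap iota d = cumulant_arg iota X r - cumulant_arg iota X r'.
    rewrite /cumulant_arg -mulrBl opprB [X in _ = X * _]addrC addrA subrK /d smap_iotaM //.
    by rewrite smapD // smapN.
  have WdW : W * smap iota d * W' = W - W'.
    have -> : smap iota d = (1 - cumulant_arg iota X r') - (1 - cumulant_arg iota X r).
      by rewrite dE opprB [RHS]addrC addrA subrK addrC.
    by rewrite mulrBr mulrBl hW.2 -mulrA hW'.1 mulr1 mul1r.
  have d0 s : d s = 0.
    have [n] := ubnP (size s); elim: n s => // n IH s /ltnSE hn.
    have low t : (size t < size s)%N -> d t = 0.
      by move=> ts; apply: IH; exact: leq_trans ts hn.
    have lowi t : (size t < size s)%N -> smap iota d t = 0.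
      by move=> ts; rewrite /smap low // uz_map0.
    have lowi' t : (size t < size s)%N -> (smap iota d * W') t = 0.
      move=> ts; rewrite serM splitsum0 // => a b ab.
      by rewrite lowi ?mul0r //; apply: leq_ltn_trans ts; rewrite -ab size_cat leq_addr.
    have := congr1 (fun u : SA => uz_map Psi (u s)) WdW.
    rewrite -mulrA serM_low // serM_lowr //.
    rewrite (inv_nil (cumulant_arg_nil lin_iota X r) hW) (inv_nil (cumulant_arg_nil lin_iota X r') hW').
    rewrite mul1r mulr1 serDE serNE (uz_mapD lPsi).
    have -> : uz_map Psi (- W' s) = - uz_map Psi (W' s).
      exact: (congr1 (fun u : SB => u s) (smapN lPsi W')).
    rewrite -[uz_map Psi (W s)]/(smap Psi W s) -[uz_map Psi (W' s)]/(smap Psi W' s).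
    rewrite pW pW' subrr.
    by have /(congr1 (fun u : SB => u s)) := smap_cond condPsi d; rewrite /smap => ->.
  apply: serI_inj; apply/esym/eqP; rewrite -subr_eq0 -mulrBl -/d.
  by apply/eqP/funext.
split=> //; rewrite -{}rr in hW' fW'.
have WW : W = W' by exact: (ser_left_cancel hW.1 hW'.2).
rewrite -WW in fW'.
have [F hF] := ser_inverse (mulI_nil (ser_in c - ser_in r : SB)).
have FW := ser_left_cancel hF.1 fW.
have E : (1 - (ser_in c - ser_in r) * serI) = (1 - (ser_in c' - ser_in r) * serI) :> SB.
  by apply: esym; apply: (ser_left_cancel fW'); rewrite -FW; exact: hF.1.
apply: serI_inj; move: E => /addrI /oppr_inj; rewrite !mulrBl.
by move/addIr.
Qed.

End Uniqueness.

(** * Scaling of the cumulants *)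

Section Dilation.
Variable lam : R[i].

Definition dil (V : lmodType R[i]) (u : seq B -> V) : seq B -> V :=
  fun s => lam ^+ size s *: u s.

Lemma dilM (V : nuAlgType R) (u v : mser B (uz V)) :
  (dil (u * v : mser B (uz V)) : mser B (uz V)) = (dil u : mser B (uz V)) * dil v.
Proof.
apply/funext => s; rewrite /dil !serM.
rewrite (splitsum_raddf _ _ (scaler0 _ (lam ^+ size s)) (scalerDr (lam ^+ size s))).
apply: eq_splitsum => a b ab.
by rewrite uz_scalel uz_scaler scalerA -exprD -size_cat ab.
Qed.

Lemma dil1 (V : nuAlgType R) : (dil (1 : mser B (uz V)) : mser B (uz V)) = 1.
Proof. by apply/funext => -[|x s]; rewrite /dil /= ?scale1r // scaler0. Qed.

Lemma dilD (V : nuAlgType R) (u v : mser B (uz V)) :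
  (dil (u + v : mser B (uz V)) : mser B (uz V)) = (dil u : mser B (uz V)) + dil v.
Proof. by apply/funext => s; rewrite /dil !serDE scalerDr. Qed.

Lemma dilN (V : nuAlgType R) (u : mser B (uz V)) :
  (dil (- u : mser B (uz V)) : mser B (uz V)) = - (dil u : mser B (uz V)).
Proof. by apply/funext => s; rewrite /dil !serNE scalerN. Qed.

Lemma smap_dil (V W : nuAlgType R) (f : V -> W) (u : mser B (uz V)) : linear f ->
  smap f (dil u) = dil (smap f u).
Proof.
by move=> lf; apply/funext => s; rewrite /smap /dil; apply: uz_ext => //=; exact: (linZ lf).
Qed.

Definition dil_cum (r : seq B -> B) : seq B -> B := fun s => lam *: dil r s.

Lemma dil_argI (V : nuAlgType R) (u : mser B (uz V)) (f : B -> V) : linear f ->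
  dil (u * smap f serI : mser B (uz V)) =
  ((fun s => lam *: dil u s) : mser B (uz V)) * smap f serI.
Proof.
move=> lf; rewrite dilM; apply/funext => s; rewrite !serM; apply: eq_splitsum => a b _.
rewrite [RHS]uz_scalel -[RHS]uz_scaler; congr (_ * _).
rewrite /dil /smap /serI /ser_in; case: b => [|y [|z b]] //=.
all: by apply: uz_ext => /=; rewrite ?(lin0 lf) ?scaler0 ?expr1.
Qed.

(** Dilation is a ring morphism and multiplies I by the dilation factor, which is why
    the component of degree n of a cumulant is scaled by the power n + 1. *)
Lemma cumulant_pair_dil X r c : cumulant_pair X r c -> cumulant_pair (lam *: X) (dil_cum r) (dil_cum c).
Proof.
move=> [W [hW pW] fW].
have sE (V : nuAlgType R) (u : seq B -> B) (f : B -> V) : linear f ->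
    (fun s => lam *: dil (smap f (ser_in u)) s : uz V) = smap f (ser_in (dil_cum u)).
  move=> lf; apply/funext => s; rewrite /dil /smap /dil_cum /dil; apply: uz_ext => /=.
    by rewrite !(linZ lf).
  by rewrite !scaler0.
have argE : cumulant_arg iota (lam *: X) (dil_cum r) = dil (cumulant_arg iota X r).
  rewrite /cumulant_arg dil_argI //; congr (_ * _).
  rewrite -sE //; apply/funext => s; rewrite serDE serNE /dil serDE serNE.
  rewrite scalerBr; rewrite scalerBr; congr (_ - _).
  case: s => [|x s]; last by rewrite !scaler0.
  by apply: uz_ext; rewrite /= expr0 ?scale1r ?scaler0.
exists (dil W).
  rewrite argE -(dil1 A) -dilN -dilD; split.
    by split; rewrite -dilM ?hW.1 ?hW.2 dil1.
  by rewrite smap_dil // pW dil1.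
rewrite smap_dil //.
have -> : (ser_in (dil_cum c) - ser_in (dil_cum r)) * serI =
   dil ((ser_in c - ser_in r) * serI : SB) :> SB.
  have lid : linear (@id B) by [].
  have idE (u : SB) : smap id u = u by apply/funext => s; apply: uz_ext.
  rewrite -{2}(idE serI) dil_argI // idE; congr (_ * _).
  apply/funext => s; rewrite !serDE !serNE /dil serDE serNE !scalerBr.
  by congr (_ - _); apply: uz_ext => //=; rewrite !scaler0.
by rewrite -{1}(dil1 B) -dilN -dilD -dilM fW dil1.
Qed.

End Dilation.
End Cumulants.

(** * Composition as a ring morphism *)

Section CompSeries.
Variables (R : realType) (B V : nuAlgType R) (h : seq B -> B).

Lemma scomp_mul (u v : mser B (uz V)) :
  scomp h (u * v : mser B (uz V)) = (scomp h u : mser B (uz V)) * scomp h v.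
Proof.
apply/funext => s; rewrite serM -[LHS]/(scomp h (splitsum (fun a b => u a * v b)) s).
rewrite scomp_splitsum; apply: eq_splitsum => a b _.
have lr (y : uz V) : linear (fun x : uz V => x * y).
  by move=> k x z; rewrite mulrDl uz_scalel.
have ll (y : uz V) : linear (fun x : uz V => y * x).
  by move=> k x z; rewrite mulrDr uz_scaler.
rewrite -(scomp_linear h u a (lr (scomp h v b))).
apply: eq_scomp => t; exact: (scomp_linear h v b (ll (u t))).
Qed.

Lemma scomp_ser1 : scomp h (1 : mser B (uz V)) = 1 :> mser B (uz V).
Proof.
apply/funext => -[|x s] //; rewrite scomp_cons splitsum0 // => a b _; exact: scomp0.
Qed.

Lemma scomp_serD (u v : mser B (uz V)) :
  scomp h (u + v : mser B (uz V)) = (scomp h u : mser B (uz V)) + scomp h v.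
Proof. by apply/funext => s; exact: scompD. Qed.

Lemma scomp_serN (u : mser B (uz V)) :
  scomp h (- u : mser B (uz V)) = - (scomp h u : mser B (uz V)).
Proof.
apply/eqP; rewrite -addr_eq0 -scomp_serD addNr.
by apply/eqP/funext => s; exact: scomp0.
Qed.

Lemma scomp_ser_in (u : seq B -> V) : scomp h (ser_in u) = ser_in (scomp h u).
Proof. by apply/funext => s; exact: (scomp_linear h u s (@uz_in_lin R V)). Qed.

Lemma scomp_ser_cst (X : V) : scomp h (ser_cst X) = ser_cst X.
Proof.
apply/funext => -[|x s] //; rewrite scomp_cons splitsum0 // => a b _; exact: scomp0.
Qed.

End CompSeries.

Lemma scomp_smap (R : realType) (B V W : nuAlgType R) h (f : V -> W)
    (u : mser B (uz V)) : linear f -> scomp h (smap f u) = smap f (scomp h u).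
Proof. by move=> lf; apply/funext => s; exact: (scomp_linear h u s (uz_map_lin lf)). Qed.

Lemma scomp_serI (R : realType) (B : nuAlgType R) (h : seq B -> B) :
  h [::] = 0 -> scomp h serI = ser_in h.
Proof. by move=> h0; rewrite /serI scomp_ser_in scomp_id_l. Qed.

(** * The recursion between moments and cumulants *)

Section Recurrence.
Variables (R : realType) (B : nuAlgType R).
Notation SB := (mser B (uz B)).

Lemma mulI_cons (V : nuAlgType R) (f : B -> V) (u : mser B (uz V)) b s : linear f ->
  (smap f serI * u) (b :: s) = uz_in (f b) * u s.
Proof.
move=> lf; rewrite serM splitsum_cons.
have -> : smap f serI [::] = 0 by apply: uz_ext => //=; exact: lin0.
rewrite mul0r add0r; case: s => [|c s]; first by rewrite splitsum_nil.
rewrite splitsum_cons splitsum0 ?addr0 // => d e _.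
suff -> : smap f serI [:: b, c & d] = 0 by rewrite mul0r.
by apply: uz_ext => //=; exact: lin0.
Qed.

Lemma mulI_rcons (V : nuAlgType R) (f : B -> V) (u : mser B (uz V)) s b : linear f ->
  (u * smap f serI) (rcons s b) = u s * uz_in (f b).
Proof.
move=> lf; rewrite serM splitsum_rcons.
have -> : smap f serI [::] = 0 by apply: uz_ext => //=; exact: lin0.
rewrite mulr0 addr0; case/lastP: s => [|s c]; first by rewrite splitsum_nil.
rewrite splitsum_rcons splitsum0 ?add0r // => d e _.
suff -> : smap f serI (rcons (rcons e c) b) = 0 by rewrite mulr0.
by apply: uz_ext => //=; case: e => [|? [|? ?]]; rewrite /= (lin0 lf).
Qed.

Lemma smap_id (u : SB) : smap id u = u.
Proof. by apply/funext => s; apply: uz_ext. Qed.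

Lemma serI_nil (u : SB) : (serI * u : SB) [::] = 0.
Proof. by rewrite serM_nil [serI [::]](_ : _ = 0) ?mul0r. Qed.

Lemma serI_cons (u : SB) b s : (serI * u : SB) (b :: s) = uz_in b * u s.
Proof. by rewrite -{1}(smap_id serI) mulI_cons. Qed.

Lemma serI_rcons (u : SB) s b : (u * serI : SB) (rcons s b) = u s * uz_in b.
Proof. by rewrite -{1}(smap_id serI) mulI_rcons. Qed.

(** The series I + I gamma I, evaluated in closed form so that it takes values in [B]
    whether or not [B] has a unit; see [ser_in_gsub]. *)
Definition gsub (gamma : seq B -> B) (s : seq B) : B :=
  if s is b :: t then
    if t is c :: t' then b ** gamma (belast c t') ** last c t' else b
  else 0.

Lemma ser_in_gsub (gamma : seq B -> B) :
  ser_in (gsub gamma) = serI + serI * ser_in gamma * serI :> SB.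
Proof.
apply/funext => -[|b s].
  by rewrite serDE serM_nil serM_nil /serI /ser_in /= !mulr0 addr0.
rewrite serDE; case/lastP: s => [|s c].
  by rewrite -[ [:: b]]/(rcons [::] b) serI_rcons serM_nil /serI /ser_in /= !mul0r addr0.
rewrite -rcons_cons serI_rcons serI_cons !uz_inM /serI /ser_in uz_inD; congr uz_in.
by case: s => [|d s]; rewrite /= add0r // belast_rcons last_rcons.
Qed.

Lemma mlin_ser_in (V : nuAlgType R) (u : seq B -> V) : multilinear u -> multilinear (ser_in u).
Proof. by move=> mu s t a x y; rewrite /ser_in mu uz_in_lin. Qed.

Lemma mlin_fst (V : nuAlgType R) (u : mser B (uz V)) : multilinear u ->
  multilinear (fun s => (u s).1).
Proof. by move=> mu s t a x y; rewrite mu. Qed.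

Lemma mlin_serI : multilinear (serI : SB).
Proof.
apply: mlin_ser_in => -[|a [|b s]] [|c t] z x y //=; by rewrite scaler0 addr0.
Qed.

Lemma mlin_gsub gamma : multilinear gamma -> multilinear (gsub gamma).
Proof.
move=> mg; have : multilinear (ser_in (gsub gamma) : SB).
  rewrite ser_in_gsub; apply: mlin_serD; first exact: mlin_serI.
  apply: mlin_serM; last exact: mlin_serI.
  by apply: mlin_serM; [exact: mlin_serI | exact: mlin_ser_in].
exact: mlin_fst.
Qed.

(** The recursion that defines the cR-transform c of (beta, gamma); for beta = gamma it
    characterizes the R-transform of gamma. *)
Definition cumulant_rec (beta gamma c : seq B -> B) : Prop :=
  ser_in beta = ser_in (scomp (gsub gamma) c) * (1 + serI * ser_in beta) :> SB.

Section Solve.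
Variables beta gamma : seq B -> B.
Hypotheses (mb : multilinear beta) (mg : multilinear gamma).

Lemma gsub_inverse : exists h, [/\ multilinear h, h [::] = 0,
   scomp h (gsub gamma) = idser & scomp (gsub gamma) h = idser].
Proof. by apply: scomp_inverse => //; exact: mlin_gsub. Qed.

Lemma Ibeta_nil : (- (serI * ser_in beta) : SB) [::] = 0.
Proof. by rewrite serNE serM_nil /serI /ser_in /= mul0r oppr0. Qed.

Lemma ser_inM2 (u : seq B -> B) (v : SB) s : ((ser_in u * v : SB) s).2 = 0.
Proof.
rewrite serM; apply: (splitsum_ind (K := fun x : uz B => x.2 = 0)) => //.
  by move=> x y /= -> ->; rewrite addr0.
by move=> a b _; rewrite uzM2 mul0r.
Qed.

(** Divide by 1 + I beta, then compose with the inverse of I + I gamma I. *)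
Lemma rec_exists : exists2 c, multilinear c & cumulant_rec beta gamma c.
Proof.
have [V hV] := ser_inverse Ibeta_nil; rewrite opprK in hV.
have [h [mh h0 hg gh]] := gsub_inverse.
pose K : SB := ser_in beta * V; pose k s := (K s).1.
have mV : multilinear V.
  apply: (is_inv_mlin Ibeta_nil); last by rewrite opprK.
  by apply: mlin_serN; apply: mlin_serM; [exact: mlin_serI | exact: mlin_ser_in].
have mk : multilinear k.
  by apply: mlin_fst; apply: mlin_serM => //; exact: mlin_ser_in.
have kK : ser_in k = K.
  by apply/funext => s; rewrite /ser_in /k -uz_inE // ser_inM2.
exists (scomp h k); first exact: mlin_comp.
by rewrite /cumulant_rec scompA // gh scomp_id_r // kK /K -mulrA hV.2 mulr1.
Qed.

Lemma ser_in_inj (u v : seq B -> B) : ser_in u = ser_in v :> SB -> u = v.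
Proof.
by move=> h; apply/funext => s; have := congr1 (fun w : SB => (w s).1) h.
Qed.

End Solve.

Lemma rec_nil beta gamma c : cumulant_rec beta gamma c -> c [::] = beta [::].
Proof.
move/(congr1 (fun w : SB => (w [::]).1)).
by rewrite serM_nil serDE serI_nil addr0 ser1_nil mulr1.
Qed.

Lemma rec_one beta gamma c b : cumulant_rec beta gamma c -> c [::] = 0 -> c [:: b] = beta [:: b].
Proof.
move=> h c0; have := congr1 (fun w : SB => (w [:: b]).1) h.
rewrite serM splitsum_cons splitsum_nil [ser_in (scomp _ _) [::]](_ : _ = 0).
  by rewrite mul0r add0r serDE serI_nil addr0 ser1_nil mulr1.
by rewrite /ser_in /= c0.
Qed.

End Recurrence.

Section RecToCumulant.
Variables (R : realType) (B : cstarAlgType R) (A : nuAlgType R) (iota : B -> A) (Phi Psi : A -> B).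
Hypothesis lin_iota : linear iota.
Hypothesis iotaM : forall b c, iota (b ** c) = iota b ** iota c.
Hypothesis condPhi : conditional_expectation iota Phi.
Hypothesis condPsi : conditional_expectation iota Psi.
Variable X : A.

Notation SB := (mser B (uz B)).
Notation SA := (mser B (uz A)).

Lemma moment_word_cons b s :
  moment_word iota X (b :: s) = X ** iota b ** moment_word iota X s.
Proof.
have G z y : foldl (fun y b => y ** iota b ** X) (z ** y) s =
    z ** foldl (fun y b => y ** iota b ** X) y s.
  by elim: s y => [|c s IH] y //=; rewrite -IH !mulgA.
exact: G.
Qed.

Lemma mlin_moment : multilinear (moment_word iota X).
Proof.
move=> s t a x y; elim: s => [|b s IH] /=.
  by rewrite !moment_word_cons lin_iota nu_mulDr nu_mulDl nu_scaler nu_scalel.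
by rewrite !moment_word_cons IH nu_mulDr nu_scaler.
Qed.

Definition mom (E : A -> B) (s : seq B) : B := E (moment_word iota X s).

Lemma mlin_mom (E : A -> B) : linear E -> multilinear (mom E).
Proof. by move=> lE s t a x y; rewrite /mom mlin_moment lE. Qed.

Let IA : SA := smap iota serI.
Let Q : SA := 1 + ser_in (moment_word iota X) * IA.

Lemma cst_mul (u : SA) : ser_cst X * u = (fun s => uz_in X * u s) :> SA.
Proof.
apply/funext => -[|b s]; first by rewrite serM_nil.
by rewrite serM splitsum_cons splitsum0 ?addr0 // => c d _; rewrite mul0r.
Qed.

(** The moments of X are the coefficients of the resolvent (1 - X I)^-1. *)
Lemma resolvent : (1 - ser_cst X * IA) * Q = 1.
Proof.
have E : ser_in (moment_word iota X) =
    ser_cst X + ser_cst X * IA * ser_in (moment_word iota X) :> SA.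
  apply/funext => -[|b s]; rewrite serDE -mulrA cst_mul.
    rewrite serM_nil [IA [::]](_ : _ = 0) ?mul0r ?mulr0 ?addr0 //.
    by apply: uz_ext => //=; exact: lin0.
  rewrite /IA mulI_cons // /ser_in moment_word_cons !uz_inM /= add0r.
  by rewrite mulgA.
rewrite /Q mulrDr mulr1 mulrA mulrBl mul1r {1}E addrK.
by rewrite subrK.
Qed.

(** Compose with the inverse h of I + I gamma I.  With G = gamma o h one has
    1 - (X - r) I = (1 - X h) (1 + G h), so its inverse is (1 + G h)^-1 times the
    composed resolvent, on which [Psi] and [Phi] are known. *)
Lemma rec_cumulant_pair r c : multilinear r -> multilinear c ->
  cumulant_rec (mom Psi) (mom Psi) r -> cumulant_rec (mom Phi) (mom Psi) c ->
  cumulant_pair iota Phi Psi X r c.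
Proof.
have lPhi : linear Phi by case: condPhi.
have lPsi : linear Psi by case: condPsi.
move=> mr mc hr hc.
have mg := mlin_mom lPsi.
have [h [mh h0 hg gh]] := gsub_inverse mg.
pose H : SB := ser_in h; pose G : SB := ser_in (scomp h (mom Psi)).
pose E : SB := ser_in (scomp h (mom Phi)).
have HG : H + H * G * H = serI.
  have : scomp h (ser_in (gsub (mom Psi))) = serI :> SB by rewrite scomp_ser_in hg.
  by rewrite ser_in_gsub scomp_serD !scomp_mul !scomp_ser_in scomp_id_l.
have rec_h b u : multilinear u -> cumulant_rec b (mom Psi) u ->
    ser_in (scomp h b) = ser_in u * (1 + H * ser_in (scomp h b)) :> SB.
  move=> mu /(congr1 (scomp h : SB -> SB)).
  rewrite scomp_mul scomp_serD scomp_ser1 scomp_mul scomp_serI // !scomp_ser_in.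
  by rewrite scompA // hg scomp_id_r.
have rI : ser_in r * serI = G * H :> SB.
  rewrite -HG {2}/G (rec_h _ _ mr hr) -/G -/H.
  by rewrite mulrDr mulrDr mulr1 mulrDl !mulrA.
have cI : ser_in c * serI = ser_in c * H * (1 + G * H) :> SB.
  by rewrite -HG mulrDr mulrDr mulr1 !mulrA.
pose Qh : SA := scomp h Q.
have Qh1 : (1 - ser_cst X * smap iota H) * Qh = 1.
  have := congr1 (scomp h : SA -> SA) resolvent.
  rewrite scomp_mul scomp_serD scomp_serN scomp_ser1 scomp_mul scomp_ser_cst.
  by rewrite scomp_smap // scomp_serI.
have [F hF] : exists F, is_inv (1 - ser_cst X * smap iota H) F.
  apply: ser_inverse; rewrite serM_nil [smap iota H [::]](_ : _ = 0) ?mulr0 //.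
  by apply: uz_ext; rewrite //= h0 (lin0 lin_iota).
have QhF : Qh = F := ser_left_cancel Qh1 hF.2.
have smapQ (L : A -> B) : conditional_expectation iota L ->
    smap L Qh = 1 + ser_in (scomp h (mom L)) * H.
  move=> cL; have lL : linear L by case: cL.
  rewrite /Qh -scomp_smap // /Q smapD // smap1 // (smap_condr cL).
  rewrite scomp_serD scomp_ser1 scomp_mul scomp_serI //; congr (1 + _ * _).
  by rewrite -scomp_ser_in; congr (scomp h _).
have GH0 : (- (G * H) : SB) [::] = 0.
  by rewrite serNE serM_nil [H [::]](_ : _ = 0) ?mulr0 ?oppr0 // /H /ser_in h0.
have [V hV] := ser_inverse GH0; rewrite opprK in hV.
pose W := smap iota V * Qh.
have TE : 1 - cumulant_arg iota X r = (1 - ser_cst X * smap iota H) * smap iota (1 + G * H).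
  rewrite /cumulant_arg mulrBl -(smap_iotaM lin_iota iotaM) rI.
  have -> : smap iota serI = smap iota H * smap iota (1 + G * H).
    by rewrite -smap_iotaM // mulrDr mulr1 mulrA HG.
  by rewrite mulrBl mul1r mulrA opprB addrA smapD // smap1.
have iVl : smap iota V * smap iota (1 + G * H) = 1 :> SA.
  by rewrite -smap_iotaM // hV.2 smap1.
have iVr : smap iota (1 + G * H) * smap iota V = 1 :> SA.
  by rewrite -smap_iotaM // hV.1 smap1.
exists W.
  split.
    split; rewrite TE /W.
      by rewrite mulrA -[_ * smap iota V]mulrA iVr mulr1.
    by rewrite mulrA -[_ * Qh * _]mulrA QhF hF.2 mulr1.
  by rewrite /W smap_condl // smapQ // hV.2.
rewrite /W smap_condl // smapQ // mulrBl rI cI.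
have -> : 1 - (ser_in c * H * (1 + G * H) - G * H) = (1 - ser_in c * H) * (1 + G * H) :> SB.
  by rewrite mulrBl mul1r opprB addrA.
have EH : (1 - ser_in c * H) * (1 + ser_in (scomp h (mom Phi)) * H) = 1 :> SB.
  rewrite -/E mulrBl mul1r mulrDr mulr1.
  rewrite {1}(rec_h _ _ mc hc : E = _) mulrDr mulr1 mulrDl -/E !mulrA.
  by rewrite addrK.
have cH0 : (ser_in c * H : SB) [::] = 0.
  by rewrite serM_nil [H [::]](_ : _ = 0) ?mulr0 // /H /ser_in h0.
have [F' hF'] := ser_inverse cH0.
rewrite (ser_left_cancel EH hF'.2) mulrA -[V * F' * _]mulrA hF'.2 mulr1.
exact: hV.2.
Qed.

End RecToCumulant.

(** * Compositions of integers *)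

Section Compositions.
Local Open Scope nat_scope.

(** The compositions of k + n with first part at least k, built by letting the first
    part grow; this parallels [scomp_head]. *)
Fixpoint cpos (k n : nat) : seq (seq nat) :=
  if n is n'.+1 then cpos k.+1 n' ++ [seq k :: q | q <- cpos 1 n'] else [:: [:: k]].

Definition comps (n : nat) : seq (seq nat) := if n is n'.+1 then cpos 1 n' else [:: [::]].

Lemma mem_cpos k n q : (q \in cpos k n) =
  if q is p :: r then [&& k <= p, all (fun j => 0 < j) r & p + sumn r == k + n] else false.
Proof.
elim: n k q => [|n IH] k q /=.
  rewrite inE; case: q => [|p r] //=; apply/eqP/and3P => [[-> ->] /=|[kp ar /eqP e]].
    by rewrite !addn0.
  case: r ar e => [|a r] /=; first by rewrite !addn0 => _ ->.
  by move=> /andP[a0 _]; lia.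
rewrite mem_cat IH; case: q => [|p r].
  by apply/negbTE/mapP => -[].
have -> : (p :: r \in [seq k :: q | q <- cpos 1 n]) = (p == k) && (r \in cpos 1 n).
  apply/mapP/andP => [[q qc [-> ->]]|[/eqP -> rc]]; last by exists r.
  by rewrite eqxx.
rewrite IH; case: r => [|a r] /=.
  by apply/idP/idP; lia.
by case: (all _ r); rewrite ?andbF //=; lia.
Qed.

Lemma mem_comps n q : (q \in comps n) = all (fun j => 0 < j) q && (sumn q == n).
Proof.
case: n => [|n] /=; last first.
  rewrite mem_cpos; case: q => [|p r] //=; by rewrite andbA add1n.
by rewrite inE; case: q => [|[|p] r] //=; rewrite ?andbF //.
Qed.

Lemma uniq_cpos k n : uniq (cpos k n).
Proof.
elim: n k => [|n IH] k //=; rewrite cat_uniq IH map_inj_uniq ?IH //=; last by move=> ? ? [].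
rewrite andbT; apply/hasPn => q /mapP[r _ ->]; rewrite /= mem_cpos.
by apply/negP => /and3P[]; lia.
Qed.

Lemma uniq_comps n : uniq (comps n).
Proof. by case: n => [|n] //; exact: uniq_cpos. Qed.

End Compositions.

(** The sum over block lengths that defines composition in [ser_comp]. *)
Lemma scomp_comps (R : realType) (B V : lmodType R[i]) (h : seq B -> B) (u : seq B -> V) s :
  scomp h u s = \sum_(q <- comps (size s)) u [seq h t | t <- reshape q s].
Proof.
have H c s' (u' : seq B -> V) : scomp_head h u' (fun t => h (c ++ t)) s' =
    \sum_(q <- cpos (size c) (size s')) u' [seq h t | t <- reshape q (c ++ s')].
  elim: s' c u' => [|x s' IH] c u' /=.
    by rewrite big_seq1 /= cats0 take_size.
  rewrite big_cat big_map /=; congr (_ + _).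
    have -> : (fun t => h (c ++ x :: t)) = (fun t => h (rcons c x ++ t)).
      by apply/funext => t; rewrite cat_rcons.
    by rewrite IH size_rcons cat_rcons.
  rewrite (IH [:: x] (fun t => u' (h (c ++ [::]) :: t))).
  by apply: eq_bigr => q _; rewrite cats0 /= take_size_cat // drop_size_cat.
case: s => [|x s] /=; first by rewrite big_seq1.
exact: (H [:: x]).
Qed.

Lemma big_tuple_seq (V : nmodType) k m (P : pred (seq nat)) (F : seq nat -> V) L :
  uniq L -> (forall q, all (fun j => j < m)%N q -> (q \in L) = P q) ->
  (forall q, q \in L -> all (fun j => j < m)%N q) ->
  \sum_(p : k.-tuple 'I_m | P (map val p)) F (map val p) =
  \sum_(q <- L | size q == k) F q.
Proof.
move=> uL LP Lm.
rewrite -big_filter -(big_map (fun p : k.-tuple 'I_m => map val p) xpredT F) -[RHS]big_filter.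
apply: perm_big; apply: uniq_perm.
- rewrite map_inj_uniq ?filter_uniq ?index_enum_uniq // => p p' e.
  by apply/val_inj; apply: (inj_map val_inj).
- exact: filter_uniq.
move=> q; rewrite mem_filter; apply/mapP/andP => [[p]|[/eqP sq qL]].
  rewrite mem_filter => /andP[Pp _] ->; rewrite size_map size_tuple eqxx; split => //.
  by rewrite LP //; apply/allP => _ /mapP[j _ ->]; exact: ltn_ord.
have am := Lm q qL.
have sz : size (pmap (insub : nat -> option 'I_m) q) == k.
  rewrite size_pmap -sq -all_count; apply/allP => j /(allP am) jm /=.
  by case: insubP => //; rewrite jm.
have E : map val (pmap (insub : nat -> option 'I_m) q) = q.
  elim: q {sq qL sz} am => [|j q IH] //= /andP[jm am].
  by rewrite insubT /= IH.
exists (Tuple sz); last by rewrite E.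
by rewrite mem_filter mem_index_enum andbT E -LP.
Qed.

Lemma sum_delta (V : nmodType) (r : seq nat) (j : nat) (x : V) :
  uniq r -> j \in r -> \sum_(k <- r | j == k) x = x.
Proof.
move=> ur jr; rewrite -big_filter (_ : [seq k <- r | j == k] = [:: j]) ?big_seq1 //.
by rewrite -(filter_pred1_uniq ur jr); apply: eq_filter => k; rewrite /= eq_sym.
Qed.

Lemma sum_delta_succ (V : nmodType) n (l : nat) (x : V) :
  (0 < l < n.+2)%N -> \sum_(k < n.+1 | l == k.+1) x = x.
Proof.
move=> hl; rewrite -(big_mkord (fun k => l == k.+1) (fun=> x)).
rewrite (eq_bigl (fun k => l.-1 == k)); last by move=> k; apply/eqP/eqP; lia.
by apply: sum_delta; rewrite ?iota_uniq // mem_index_iota; lia.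
Qed.

(** * Index sums over tuples as sums over splittings *)

Section IndexSums.
Variables (R : realType) (B : cstarAlgType R).
Notation SB := (mser B (uz B)).
Implicit Types beta gamma c : seq B -> B.

Lemma ser_compE (alpha beta : mfseries B) s :
  ser_comp alpha beta s = scomp (fun t => (beta t).1) (alpha : seq B -> uz B) s.
Proof.
case: s => [|x s] //; set n := size (x :: s).
rewrite scomp_comps -/n -[LHS]/(\sum_(1 <= k < n.+1)
    \sum_(p : k.-tuple 'I_n.+1 |
            all (fun j => (0 < j)%N) (map val p) && (sumn (map val p) == n))
      alpha [seq (beta t).1 | t <- reshape (map val p) (x :: s)]).
pose F q : uz B := alpha [seq (beta t).1 | t <- reshape q (x :: s)].
have sum_mem q j : j \in q -> (j <= sumn q)%N.
  by elim: q => [|y q IH] //=; rewrite inE => /orP[/eqP -> |/IH]; lia.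
transitivity (\sum_(1 <= k < n.+1) \sum_(q <- comps n | size q == k) F q).
  apply: eq_bigr => k _.
  apply: (@big_tuple_seq (uz B) k n.+1 (fun q => all (fun j => (0 < j)%N) q && (sumn q == n)) F).
  - exact: uniq_comps.
  - by move=> q _; rewrite mem_comps.
  - move=> q; rewrite mem_comps => /andP[_ /eqP sq]; apply/allP => j /sum_mem.
    by rewrite sq ltnS.
rewrite (exchange_big_dep xpredT) // [RHS]big_seq [LHS]big_seq; apply: eq_bigr => q.
rewrite mem_comps => /andP[qpos /eqP sq].
have szq : (0 < size q <= n)%N.
  rewrite -sq; apply/andP; split; first by case: q sq {qpos}.
  by elim: q qpos {sq} => [|y q IH] //= /andP[y0 /IH h]; rewrite -add1n leq_add.
by apply: sum_delta; rewrite ?iota_uniq // mem_index_iota ltnS.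
Qed.

Section TildeOne.
Implicit Types u v : unitization B.

Lemma tilde1_tilde : in_tilde (tilde1 B).
Proof. by move=> h; rewrite /tilde1; case: asboolP. Qed.

Lemma tilde1l u : in_tilde u -> (tilde1 B : uz B) * u = u.
Proof.
rewrite /tilde1; case: asboolP => [he hu|he _]; last exact: mul1r.
rewrite (uz_inE (hu he)) uz_inM; congr uz_in.
by case: he => e he; have [] := xgetPex (0 : B) (ex_intro _ e he) u.1.
Qed.

Lemma tilde1r u : in_tilde u -> (u : uz B) * tilde1 B = u.
Proof.
rewrite /tilde1; case: asboolP => [he hu|he _]; last exact: mulr1.
rewrite (uz_inE (hu he)) uz_inM; congr uz_in.
by case: he => e he; have [] := xgetPex (0 : B) (ex_intro _ e he) u.1.
Qed.

End TildeOne.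

Lemma gsub_long gamma (t : seq B) : (1 < size t)%N ->
  gsub gamma t = nth 0 t 0 ** gamma (take (size t - 2) (behead t)) ** nth 0 t (size t).-1.
Proof.
case: t => [|b [|c t]] //= _; rewrite subn2 /= (last_nth 0); congr (_ ** gamma _ ** _).
elim: t c => [|d t IH] c //=; by rewrite IH.
Qed.

(** The partial sums of a composition are the positions i(1) < i(2) < ..., and the
    arguments c_j of the recurrence are the values of I + I gamma I on its blocks. *)
Lemma cR_args gamma (s : seq B) q j : (0 < j)%N -> all (fun p => (0 < p)%N) q ->
  (j.-1 + sumn q <= size s)%N ->
  pairmap (cR_arg (ser_in gamma : mfseries B) s) j (scanl addn j q) =
  [seq gsub gamma t | t <- reshape q (drop j.-1 s)].
Proof.
elim: q j => [|p q IH] j //= j0 /andP[p0 qpos] hs.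
rewrite IH //; [|by rewrite addn_gt0 j0 | by apply: leq_trans hs; lia].
rewrite drop_drop (_ : (p + j.-1)%N = (j + p).-1); last by lia.
congr (_ :: _); rewrite /cR_arg.
have st : size (take p (drop j.-1 s)) = p by rewrite size_takel // size_drop; lia.
case: ifP => [/eqP e|/eqP e].
  have p1 : p = 1%N by lia.
  rewrite p1 (drop_nth 0) /= ?take0 //; lia.
have p2 : (1 < p)%N by lia.
rewrite gsub_long st // (_ : (j + p - j - 2)%N = (p - 2)%N); last by lia.
rewrite -[LHS]/((uz_in (barg s j) * uz_in (gamma (take (p - 2) (drop j s)))
                 * uz_in (barg s (j + p).-1)).1) !uz_inM /=.
rewrite /barg !nth_take ?nth_drop ?addn0; [|lia|lia].
rewrite (_ : (j + p).-1.-1 = (j.-1 + p.-1)%N); last by lia.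
congr (_ ** gamma _ ** _).
rewrite -drop1 (_ : take p (drop j.-1 s) = take (p.-1 + 1) (drop j.-1 s)) -?take_drop; last by congr take; lia.
rewrite drop_drop (_ : (1 + j.-1)%N = j) ?take_takel //; lia.
Qed.

(** The position i(k) cuts the word in two: a composed part, and a remainder starting
    with the letter at i(k). *)
Lemma cR_recurrenceE beta gamma (rho : mfseries B) s :
  \sum_(k < (size s).+1)
      \sum_(i : k.-tuple 'I_(size s).+2 | path ltn 1%N (map val i))
        umul (rho (pairmap (cR_arg (ser_in gamma : mfseries B) s) 1%N (map val i)))
             (cR_rest (ser_in beta : mfseries B) s (last 1%N (map val i))) =
  splitsum (fun a b => (scomp (gsub gamma) (rho : seq B -> uz B) a : uz B) *
     (if b is c :: b' then uz_in c * ser_in beta b' else tilde1 B)) s.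
Proof.
set n := size s.
pose F i : uz B := umul (rho (pairmap (cR_arg (ser_in gamma : mfseries B) s) 1%N i))
             (cR_rest (ser_in beta : mfseries B) s (last 1%N i)).
pose L m := [seq scanl addn 1%N q | q <- comps m].
have scanK q j : pairmap (fun x y => y - x)%N j (scanl addn j q) = q.
  by apply: scanlK => x y; rewrite addnC addnK.
have last_scan q j : last j (scanl addn j q) = (j + sumn q)%N.
  by elim: q j => [|p q IH] j /=; rewrite ?addn0 // IH addnA.
have uL m : uniq (L m).
  by rewrite map_inj_uniq ?uniq_comps // => q q' /(congr1 (pairmap (fun x y => y - x)%N 1%N)); rewrite !scanK.
have pos_diff i j : path ltn j i -> all (fun d => 0 < d)%N (pairmap (fun x y => y - x)%N j i).
  by elim: i j => [|p i IH] j //= /andP[jp pi]; rewrite subn_gt0 jp IH.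
have memL m i : (m <= n)%N -> (i \in L m) = path ltn 1%N i && (last 1%N i == m.+1).
  move=> mn; apply/mapP/andP => [[q]|[pi /eqP li]].
    rewrite mem_comps => /andP[qp /eqP sq] ->; rewrite last_scan sq; split => //.
    elim: q qp 1%N {sq} => [|p q IH] //= /andP[p0 qp] j.
    by rewrite IH // andbT -[X in (X < _)%N]addn0 ltn_add2l.
  exists (pairmap (fun x y => y - x)%N 1%N i); last first.
    by elim: i 1%N pi {li} => [|p i IH] j //= /andP[jp pi]; rewrite (subnKC (ltnW jp)) -IH.
  rewrite mem_comps; apply/andP; split.
    exact: pos_diff.
  suff : (1 + sumn (pairmap (fun x y => y - x) 1 i) == last 1 i)%N by rewrite li.
  elim: i 1%N pi {li} => [|p i IH] j /=; first by rewrite addn0.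
  by move=> /andP[jp pi]; rewrite addnA (subnKC (ltnW jp)) IH.
have last_path i j : path ltn j i -> (j <= last j i)%N.
  elim: i j => [|p i IH] j //= /andP[jp /IH]; apply: leq_trans; exact: ltnW.
have size_path i j : path ltn j i -> (j + size i <= last j i)%N.
  elim: i j => [|p i IH] j /=; first by rewrite addn0.
  by move=> /andP[jp /IH]; apply: leq_trans; rewrite addnS -addSn leq_add2r.
have path_le i j x : path ltn j i -> x \in i -> (x <= last j i)%N.
  elim: i j => [|p i IH] j //= /andP[jp pi]; rewrite inE => /orP[/eqP ->|/IH]; last exact.
  exact: last_path.
transitivity (\sum_(k < n.+1) \sum_(m < n.+1) \sum_(q <- L m | size q == k) F q).
  apply: eq_bigr => k _.
  transitivity (\sum_(m < n.+1) \sum_(i : k.-tuple 'I_n.+2 |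
      path ltn 1%N (map val i) && (last 1%N (map val i) == m.+1)) F (map val i)).
    rewrite (exchange_big_dep (fun i : k.-tuple 'I_n.+2 => path ltn 1%N (map val i))) /=; last first.
      by move=> m i _ /andP[].
    apply: eq_bigr => i pi; rewrite pi /=.
    have l1 := last_path _ _ pi.
    have l2 : (last 1%N (map val i) < n.+2)%N.
      have : all (fun x => x < n.+2)%N (map val i).
        by apply/allP => _ /mapP[x _ ->]; exact: ltn_ord.
      by case/lastP: (map val i) => // r x; rewrite last_rcons all_rcons => /andP[].
    by apply/esym; apply: sum_delta_succ; rewrite l1.
  apply: eq_bigr => m _.
  have mn : (m <= n)%N by rewrite -ltnS ltn_ord.
  apply: (@big_tuple_seq (uz B) k n.+2 (fun i => path ltn 1%N i && (last 1%N i == m.+1)) F (L m)) => //.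
    by move=> q _; exact: memL.
  move=> q; rewrite memL // => /andP[pq /eqP lq]; apply/allP => x /(path_le _ _ _ pq).
  by rewrite lq => /leq_ltn_trans; apply; rewrite !ltnS.
rewrite exchange_big; apply: eq_bigr => m _ /=.
have mn : (m <= n)%N by rewrite -ltnS.
rewrite -(big_mkord xpredT (fun k => \sum_(q <- L m | size q == k) F q)).
rewrite (exchange_big_dep xpredT) //.
transitivity (\sum_(q <- L m) F q).
  rewrite [LHS]big_seq [RHS]big_seq; apply: eq_bigr => q.
  rewrite memL // => /andP[pq /eqP lq]; apply: sum_delta; rewrite ?iota_uniq // mem_index_iota ltnS /=.
  by have := size_path _ _ pq; rewrite lq add1n ltnS => /leq_trans; apply.
rewrite big_map scomp_comps size_takel // mulr_suml [LHS]big_seq [RHS]big_seq.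
apply: eq_bigr => q; rewrite mem_comps => /andP[qp /eqP sq].
rewrite -[LHS]/((rho (pairmap (cR_arg (ser_in gamma : mfseries B) s) 1%N (scanl addn 1%N q)) : uz B) *
  cR_rest (ser_in beta : mfseries B) s (last 1%N (scanl addn 1%N q))).
rewrite cR_args //=; last by rewrite add0n sq.
rewrite drop0 last_scan sq /cR_rest add1n.
have <- : reshape q s = reshape q (take m s).
  rewrite -{1}(cat_take_drop m s).
  have : (sumn q <= size (take m s))%N by rewrite size_takel // sq.
  elim: q {qp sq} (take m s) => [|p q IH] //= r hr.
  have pr : (p <= size r)%N by apply: leq_trans hr; rewrite leq_addr.
  rewrite take_cat drop_cat; case: ltngtP pr => // [pr _|pr _].
    by rewrite IH // size_drop leq_subRL // ltnW.
  rewrite pr subnn take0 cats0 drop0 take_size drop_size; congr (_ :: _).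
  by apply: (IH [::]); move: hr; rewrite pr -{2}[size r]addn0 leq_add2l.
case: ltnP => [ms|ms].
  by rewrite (drop_nth 0 ms) /barg.
by rewrite drop_oversize.
Qed.

End IndexSums.

(** * The R- and cR-transforms solve the moment recursion *)

Section TransformsSolve.
Variables (R : realType) (B : cstarAlgType R).
Notation SB := (mser B (uz B)).
Implicit Types beta gamma c : seq B -> B.

Lemma Mul_ser_in c : multilinear c -> Mul (ser_in c : mfseries B).
Proof. by move=> mc; split => //; exact: mlin_ser_in. Qed.

Lemma Mul_ser_inE (rho : mfseries B) : Mul rho -> (rho [::]).2 = 0 ->
  exists2 c, multilinear c & rho = ser_in c.
Proof.
move=> [_ r2 mr] r0; exists (fun s => (rho s).1); first exact: (@mlin_fst R B B).
by apply/funext => s; apply: (uz_inE (u := rho s : uz B)); case: s => // x s; exact: r2.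
Qed.

Lemma cR_rec beta gamma c :
  cR_recurrence (ser_in beta : mfseries B) (ser_in gamma) (ser_in c) <->
  cumulant_rec beta gamma c.
Proof.
have E s : splitsum (fun a b => (scomp (gsub gamma) (ser_in c) a : uz B) *
     (if b is d :: b' then uz_in d * ser_in beta b' else tilde1 B)) s =
     (ser_in (scomp (gsub gamma) c) * (1 + serI * ser_in beta) : SB) s.
  rewrite serM; apply: eq_splitsum => a b _; rewrite scomp_ser_in.
  case: b => [|d b]; last by rewrite serDE serI_cons ser1_cons add0r.
  by rewrite serDE serI_nil addr0 mulr1 tilde1r // => _.
split=> [h|h s]; last by rewrite cR_recurrenceE E -h.
by apply/funext => s; rewrite -E -cR_recurrenceE; exact: h.
Qed.

(** The recurrence at the empty word forces the constant term into [B], also when the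
    unitization is larger; everything then happens over [B]. *)
Lemma cR_ofE beta gamma : multilinear beta -> multilinear gamma ->
  exists c, [/\ multilinear c, cumulant_rec beta gamma c &
     cR_of (ser_in beta : mfseries B) (ser_in gamma) = ser_in c].
Proof.
move=> mb mg; have [c mc hc] := rec_exists mb mg.
have [Mr hr] : [set rho | Mul rho /\ cR_recurrence (ser_in beta : mfseries B) (ser_in gamma) rho]
    (cR_of (ser_in beta : mfseries B) (ser_in gamma)).
  by apply: xgetPex; exists (ser_in c); split; [exact: Mul_ser_in | apply/cR_rec].
have r0 : (cR_of (ser_in beta : mfseries B) (ser_in gamma) [::]).2 = 0.
  have := hr [::]; rewrite cR_recurrenceE splitsum_nil.
  case: Mr => [t0 _ _] /=; rewrite tilde1r //.
  by move/(congr1 snd).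
have [c' mc' e] := Mul_ser_inE Mr r0.
by exists c'; split => //; apply/cR_rec; rewrite -e.
Qed.

Lemma ser_one_l (u : SB) : in_tilde (u [::]) -> (forall s, s != [::] -> (u s).2 = 0) ->
  (@ser_one R B : SB) * u = u.
Proof.
move=> h0 hs; apply/funext => -[|x s]; first by rewrite serM_nil /ser_one tilde1l.
rewrite serM splitsum_cons splitsum0 ?addr0 ?tilde1l // => [|a b _]; last by rewrite mul0r.
by rewrite /in_tilde hs.
Qed.

Lemma ser_one_r (u : SB) : in_tilde (u [::]) -> (forall s, s != [::] -> (u s).2 = 0) ->
  u * (@ser_one R B : SB) = u.
Proof.
move=> h0 hs; apply/funext; case/lastP => [|s x]; first by rewrite serM_nil /ser_one tilde1r.
rewrite serM splitsum_rcons splitsum0 ?add0r ?tilde1r // => [|a b _].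
  by rewrite /in_tilde hs // -size_eq0 size_rcons.
by case: b => [|? ?]; rewrite mulr0.
Qed.

Lemma ser_idE : @ser_id R B = serI.
Proof. by apply/funext => -[|x [|y s]]. Qed.

(** With K = (1 + gamma I)^-1 gamma one has K (1 + I gamma) = gamma, because
    gamma (1 + I gamma) = (1 + gamma I) gamma; so K o (I + I gamma I)^<-1> solves the
    recursion with beta = gamma. *)
Lemma R_ofE gamma : multilinear gamma ->
  exists c, [/\ multilinear c, cumulant_rec gamma gamma c &
     R_of (ser_in gamma : mfseries B) = ser_in c].
Proof.
move=> mg; set al : SB := ser_in gamma.
have a_I0 : (- (al * serI) : SB) [::] = 0 by rewrite serNE mulI_nil oppr0.
have [W hW] := ser_inverse a_I0; rewrite opprK in hW.
have mal : multilinear al by exact: mlin_ser_in.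
have mW : multilinear W.
  apply: (is_inv_mlin a_I0); last by rewrite opprK.
  by apply: mlin_serN; apply: mlin_serM => //; exact: mlin_serI.
pose o : SB := @ser_one R B.
have al2 (u : SB) s : ((al * u) s).2 = 0 by exact: ser_inM2.
(* The unit of the series over B~ is [o], which differs from 1 if [B] is unital; W - 1
   has coefficients in [B], where the two units act in the same way. *)
have [J [MJ oJ JE]] : exists J : SB, [/\ Mul (J : mfseries B), (o + al * serI) * J = o &
    ser_inv (ser_add (@ser_one R B) (ser_mul al serI)) = J].
  have WE : W - 1 = - (al * serI * W).
    by rewrite -[X in W - X]hW.1 mulrDl mul1r opprD addrA subrr add0r.
  have W2 s : ((W - 1) s).2 = 0 by rewrite WE serNE -mulrA /= al2 oppr0.
  have [w wE] : exists w : SB, w = W - 1 by exists (W - 1).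
  rewrite -wE in WE W2.
  pose J0 : SB := o + w.
  have h0 (u : SB) : (forall s, (u s).2 = 0) -> o * u = u.
    by move=> h; apply: ser_one_l => // _; exact: h.
  have h1 (u : SB) : (forall s, (u s).2 = 0) -> u * o = u.
    by move=> h; apply: ser_one_r => // _; exact: h.
  have oo : o * o = o by apply: ser_one_l => //; [exact: tilde1_tilde | case].
  have J1 : (o + al * serI) * J0 = o.
    rewrite /J0 mulrDl !mulrDr oo (h0 _ W2) (h1 _ (al2 _)) -/al.
    rewrite -addrA [X in o + X](_ : _ = 0) ?addr0 //.
    have : (1 + al * serI) * (1 + w) = 1 by rewrite wE [1 + (_ - _)]addrC subrK hW.1.
    rewrite mulrDl mul1r mulrDr mulr1 -addrA => /eqP.
    by rewrite -[X in _ == X]addr0 (inj_eq (addrI _)) => /eqP.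
  have J2 : J0 * (o + al * serI) = o.
    rewrite /J0 mulrDl !mulrDr oo (h1 _ W2) (h0 _ (al2 _)) -/al.
    rewrite -addrA [X in o + X](_ : _ = 0) ?addr0 //.
    have : (1 + w) * (1 + al * serI) = 1 by rewrite wE [1 + (_ - _)]addrC subrK hW.2.
    rewrite mulrDl mul1r mulrDr mulr1 -addrA => /eqP.
    by rewrite -[X in _ == X]addr0 (inj_eq (addrI _)) => /eqP.
  have MJ0 : Mul (J0 : mfseries B).
    split.
    - rewrite /J0 serDE [w [::]](_ : _ = 0) ?addr0; first exact: tilde1_tilde.
      by rewrite WE serNE -mulrA serM_nil serI_nil mulr0 oppr0.
    - by case=> // x s _; rewrite /J0 serDE /= W2 addr0.
    - apply: (@mlin_serD R B B); last by rewrite wE; apply: mlin_serD => //; apply: mlin_serN; exact: mlin_ser1.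
      by move=> [|z s] t a x y; rewrite /o /ser_one /= scaler0 addr0.
  have [MJ oJ _] : [set J | [/\ Mul J,
      ser_mul (ser_add (@ser_one R B) (ser_mul al (serI))) J = @ser_one R B &
      ser_mul J (ser_add (@ser_one R B) (ser_mul al (serI))) = @ser_one R B]]
      (ser_inv (ser_add (@ser_one R B) (ser_mul al (serI)))).
    by apply: xgetPex; exists J0; split; [exact: MJ0 | exact: J1 | exact: J2].
  by exists (ser_inv (ser_add (@ser_one R B) (ser_mul al (serI)))).
have gE : ser_add (serI) (ser_mul (serI) (ser_mul al (serI))) =
    ser_in (gsub gamma) by rewrite ser_in_gsub -mulrA.
have [h [mh h0 hg gh hE]] : exists h, [/\ multilinear h, h [::] = 0,
    scomp h (gsub gamma) = idser, scomp (gsub gamma) h = idser &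
    ser_cinv (ser_in (gsub gamma) : mfseries B) = ser_in h].
  have compE (u v : seq B -> B) :
      ser_comp (ser_in u : mfseries B) (ser_in v) = ser_in (scomp v u).
    by apply/funext => s; rewrite ser_compE -scomp_ser_in.
  have [Mh hh0 H1 H2] : [set b | [/\ Mul b, b [::] = 0,
     ser_comp (ser_in (gsub gamma) : mfseries B) b = serI &
     ser_comp b (ser_in (gsub gamma) : mfseries B) = serI]]
     (ser_cinv (ser_in (gsub gamma) : mfseries B)).
    rewrite /ser_cinv ser_idE; apply: xgetPex; have [h [mh h0 hg gh]] := gsub_inverse mg.
    exists (ser_in h); split; first exact: Mul_ser_in.
    - by rewrite /ser_in h0.
    - by rewrite compE hg.
    - by rewrite compE gh.
  have [|h mh hE] := Mul_ser_inE Mh; first by rewrite hh0.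
  exists h; rewrite hE !compE in H1 H2; rewrite hE in hh0; split => //.
  - by case: hh0.
  - exact: ser_in_inj H1.
  - exact: ser_in_inj H2.
pose K : SB := J * al.
have K2 s : (K s).2 = 0.
  rewrite /K serM; apply: (splitsum_ind (K := fun x : uz B => x.2 = 0)) => //.
    by move=> x y /= -> ->; rewrite addr0.
  by move=> a b _; rewrite uzM2 mulr0.
have oK : o * K = K.
  by rewrite /K mulrA; congr (_ * _); case: MJ => t0 J2 _; exact: ser_one_l.
have KE : (1 + al * serI) * K = al.
  have : (o + al * serI) * K = al.
    by rewrite /K mulrA oJ; apply: ser_one_l.
  by rewrite !mulrDl oK mul1r.
have K3 : K * (1 + serI * al) = al.
  have e : (1 + al * serI) * (K * (1 + serI * al)) = (1 + al * serI) * al.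
    by rewrite mulrA KE mulrDr mulr1 mulrDl mul1r mulrA.
  by have := congr1 (fun x => W * x) e; rewrite !mulrA hW.2 !mul1r.
pose k s := (K s).1.
have kK : ser_in k = K by apply/funext => s; rewrite /ser_in /k -uz_inE.
have mk : multilinear k.
  by apply: mlin_fst; apply: mlin_serM => //; case: MJ.
exists (scomp h k); split; first exact: mlin_comp.
  by rewrite /cumulant_rec scompA // gh scomp_id_r // kK K3.
rewrite /R_of ser_idE gE hE JE; apply/funext => s; rewrite ser_compE.
by rewrite -[X in scomp _ X s]/K -kK scomp_ser_in.
Qed.

End TransformsSolve.

(** * Expansions in powers of the inverse square root of N *)

Section Expansion.
Variable R : realType.

Definition lam (N : nat) : R[i] := ((Num.sqrt (N%:R : R))^-1)%:C.

Lemma lam_sq N : (0 < N)%N -> N%:R * lam N ^+ 2 = 1.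
Proof.
move=> N0; rewrite /lam -rmorphXn /= exprVn sqr_sqrtr ?ler0n //.
rewrite -[N%:R](rmorph_nat (real_complex R)) -rmorphM /= mulfV //.
by rewrite pnatr_eq0 -lt0n.
Qed.

(** [u N] is, for positive [N], a polynomial in [lam N] with fixed coefficients and
    constant term [l], in Horner form.  Unlike convergence, this passes through
    arbitrary linear maps. *)
Inductive expansion (V : lmodType R[i]) (u : nat -> V) (l : V) : Prop :=
| Exp0 : (forall N, (0 < N)%N -> u N = l) -> expansion u l
| ExpS v l' : expansion v l' -> (forall N, (0 < N)%N -> u N = l + lam N *: v N) ->
    expansion u l.

Section Theory.
Variable V : lmodType R[i].
Implicit Types (u v : nat -> V) (l k : V).

Lemma exp_cst l : expansion (fun=> l) l. Proof. exact: Exp0. Qed.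

Lemma exp_ext u v l : (forall N, (0 < N)%N -> u N = v N) -> expansion u l -> expansion v l.
Proof.
move=> e [h|w k hw h]; first by apply: Exp0 => N N0; rewrite -e // h.
by apply: ExpS hw _ => N N0; rewrite -e // h.
Qed.

Lemma exp_add u v l k : expansion u l -> expansion v k ->
  expansion (fun N => u N + v N) (l + k).
Proof.
move=> hu; elim: hu v k => [{}u {}l h|{}u {}l u' l' hu' IH h] v k.
  case=> [e|v' k' hv' e]; first by apply: Exp0 => N N0; rewrite h // e.
  by apply: ExpS hv' _ => N N0; rewrite h // e // addrA.
case=> [e|v' k' hv' e].
  by apply: ExpS hu' _ => N N0; rewrite h // e // addrAC.
apply: ExpS (IH _ _ hv') _ => N N0; rewrite h // e // scalerDr addrACA //.
Qed.

Lemma exp_lam u l : expansion u l -> expansion (fun N => lam N *: u N) 0.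
Proof. by move=> h; apply: ExpS h _ => N _; rewrite add0r. Qed.

Lemma exp_lamX u l j : expansion u l ->
  expansion (fun N => lam N ^+ j *: u N) (if j is 0%N then l else 0).
Proof.
move=> h; elim: j => [|j IH].
  by apply: exp_ext h => N _; rewrite expr0 scale1r.
by apply: exp_ext (exp_lam IH) => N _; rewrite scalerA exprS.
Qed.

End Theory.

Lemma exp_sum (V : lmodType R[i]) (I : Type) (r : seq I) (P : pred I)
    (F : nat -> I -> V) (L : I -> V) :
  (forall i, P i -> expansion (F^~ i) (L i)) ->
  expansion (fun N => \sum_(i <- r | P i) F N i) (\sum_(i <- r | P i) L i).
Proof.
move=> h; elim: r => [|i r IH].
  by apply: exp_ext (exp_cst _) => N _; rewrite !big_nil.
rewrite big_cons; case: ifPn => Pi.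
  by apply: exp_ext (exp_add (h i Pi) IH) => N _; rewrite big_cons Pi.
by apply: exp_ext IH => N _; rewrite big_cons (negbTE Pi).
Qed.

Lemma exp_splitsum (V : lmodType R[i]) T (F : nat -> seq T -> seq T -> V) L s :
  (forall a b, a ++ b = s -> expansion (fun N => F N a b) (L a b)) ->
  expansion (fun N => splitsum (F N) s) (splitsum L s).
Proof. by move=> h; apply: exp_sum => k _; apply: h; exact: cat_take_drop. Qed.

(** Linearity moves [F N] past the powers of [lam N] in the expansion of its argument. *)
Lemma exp_family (V W : lmodType R[i]) (F : nat -> V -> W) (G : V -> W) y l :
  (forall N, linear (F N)) -> (forall c, expansion (F^~ c) (G c)) ->
  expansion y l -> expansion (fun N => F N (y N)) (G l).
Proof.
move=> lF hF hy; elim: hy => [{}y {}l h|{}y {}l v l' _ IH h].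
  by apply: exp_ext (hF l) => N N0; rewrite h.
rewrite -[G l]addr0; apply: exp_ext (exp_add (hF l) (exp_lam IH)) => N N0.
by rewrite h // addrC -lF [RHS]/= addrC.
Qed.

Lemma exp_linear (V W : lmodType R[i]) (f : V -> W) u l :
  linear f -> expansion u l -> expansion (fun N => f (u N)) (f l).
Proof.
by move=> lf; apply: (@exp_family V W (fun=> f) f) => // c; exact: exp_cst.
Qed.

Lemma exp_mul (B : nuAlgType R) (u v : nat -> B) l k :
  expansion u l -> expansion v k -> expansion (fun N => u N ** v N) (l ** k).
Proof.
move=> hu hv; apply: (@exp_family B B (fun N y => u N ** y) (fun y => l ** y)) => //.
  by move=> N a x y; rewrite nu_mulDr nu_scaler.
move=> c; apply: (@exp_linear B B (fun x => x ** c)) => // a x y.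
by rewrite nu_mulDl nu_scalel.
Qed.

Lemma lam_small (e : R[i]) : 0 < e -> \forall N \near \oo, `|lam N| < e.
Proof.
move=> e0.
have re0 : 0 < complex.Re e by move: e0; rewrite ltcE /= => /andP[].
have -> : e = (complex.Re e)%:C.
  by move: e0; rewrite ltcE /= => /andP[/eqP]; case: (e) => a b /= -> _.
near=> N.
have N0 : (0 < N)%N by near: N; exact: nbhs_infty_gt.
rewrite /lam normc_def /= expr0n /= addr0 sqrtr_sqr ltcR.
rewrite ger0_norm ?invr_ge0 ?sqrtr_ge0 // invf_plt ?posrE ?sqrtr_gt0 ?ltr0n //.
rewrite -[(complex.Re e)^-1]ger0_norm ?invr_ge0 ?ltW // -sqrtr_sqr ltr_sqrt ?ltr0n //.
near: N; exact: nbhs_infty_gtr.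
Unshelve. all: by end_near. Qed.

Lemma exp_cvg (V : normedModType R[i]) (u : nat -> V) l :
  expansion u l -> u N @[N --> \oo] --> l.
Proof.
elim=> [{}u {}l h|{}u {}l v l' _ IH h].
  apply: cvg_near_cst; near=> N; apply: h; near: N; exact: nbhs_infty_gt.
apply/cvgrPdist_lt => e e0.
have c0 : 0 < `|l'| + 1 by rewrite ltr_wpDl.
have e1 : 0 < e / (`|l'| + 1) by rewrite divr_gt0.
near=> N.
rewrite h; last by near: N; exact: nbhs_infty_gt.
rewrite opprD addNKr normrN normrZ.
have hv : `|v N| <= `|l'| + 1.
  rewrite -[v N](subrK l') addrC (le_trans (ler_normD _ _)) // lerD2l ltW //.
  by rewrite distrC; near: N; move/cvgrPdist_lt: IH; apply.
apply: (@le_lt_trans _ _ (`|lam N| * (`|l'| + 1))); first by rewrite ler_wpM2l.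
rewrite -ltr_pdivlMr //; near: N; exact: lam_small.
Unshelve. all: by end_near. Qed.

End Expansion.

(** * The moment recursion and its limit *)

Section MomentRecursion.
Variables (R : realType) (B : nuAlgType R).
Notation SB := (mser B (uz B)).

(** The product x (1 + I v)(s), which is x itself on the empty word; the factor 1 need
    not be in [B]. *)
Definition tailmul (x : B) (v : seq B -> B) (s : seq B) : B :=
  if s is b :: t then x ** b ** v t else x.

(** The moment recursion inside [B], with no unitization. *)
Lemma rec_tail beta gamma c s : cumulant_rec beta gamma c ->
  beta s = splitsum (fun a b => tailmul (scomp (gsub gamma) c a) beta b) s.
Proof.
move=> h; apply: (@uz_in_inj R B).
rewrite -[LHS]/(ser_in beta s) h.
rewrite serM (splitsum_raddf (f := uz_in) _ _ erefl (fun x y => esym (uz_inD x y))).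
apply: eq_splitsum => a [|b t] _; first by rewrite serDE serI_nil addr0 mulr1.
by rewrite serDE ser1_cons add0r serI_cons mulrA !uz_inM.
Qed.

(** The recursion of the limit moments: only pairs survive as the block containing the
    first letter. *)
Definition pair_step (m : B -> B) (v w : seq B -> B) (s : seq B) : B :=
  splitsum (fun a b => if a is [::] then 0 else tailmul (m (gsub v a)) w b) s.

Lemma gsub_congr (v v' : seq B -> B) n :
  (forall t, (size t < n)%N -> v t = v' t) ->
  forall a, (size a <= n.+1)%N -> gsub v a = gsub v' a.
Proof.
by move=> vv [|b [|c t]] //= ht; rewrite vv // size_belast.
Qed.

Lemma pair_step_congr m v v' w w' n :
  (forall t, (size t < n)%N -> v t = v' t) ->
  (forall t, (size t < n)%N -> w t = w' t) ->
  forall s, (size s <= n)%N -> pair_step m v w s = pair_step m v' w' s.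
Proof.
move=> vv ww s sn; apply: eq_splitsum => -[|x a] b ab //.
have ha : (size (x :: a) <= n)%N.
  by apply: leq_trans sn; rewrite -ab size_cat leq_addr.
rewrite (gsub_congr vv) ?(leq_trans ha) //.
case: b ab => [|y b] ab //=; rewrite ww //.
by apply: leq_trans sn; rewrite -ab size_cat /= addSn ltnS addnS leqW // leq_addl.
Qed.

(** The moments of the limit law for [Psi], as a function of m = M_1 alone. *)
Definition gauss_mom (m : B -> B) : seq B -> B := fixser (fun v => pair_step m v v).

(** The moments of the limit law for [Phi]; the blocks nested inside a pair are
    computed with the moments for [Psi]. *)
Definition cgauss_mom (m m' : B -> B) : seq B -> B :=
  fixser (fun w => pair_step m' (gauss_mom m) w).

Lemma gauss_momE m : pair_step m (gauss_mom m) (gauss_mom m) = gauss_mom m.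
Proof.
by apply: (fixserE (F := fun v => pair_step m v v)) => u v n uv; exact: pair_step_congr.
Qed.

Lemma cgauss_momE m m' : pair_step m' (gauss_mom m) (cgauss_mom m m') = cgauss_mom m m'.
Proof.
by apply: (fixserE (F := pair_step m' (gauss_mom m))) => u v n uv; exact: pair_step_congr.
Qed.

Lemma mlin_pair_step m v w : linear m -> multilinear v -> multilinear w ->
  multilinear (pair_step m v w).
Proof.
move=> lm mv mw; have mg := mlin_gsub mv.
have tl (b : seq B) : linear (fun x => tailmul x w b).
  by case: b => [|y b] k x z //=; rewrite !nu_mulDl !nu_scalel.
apply: mlin_splitsum => [b|a] s t k x y /=.
  have E z : (if s ++ z :: t is [::] then 0 else tailmul (m (gsub v (s ++ z :: t))) w b)
      = tailmul (m (gsub v (s ++ z :: t))) w b by case: s.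
  by rewrite !E mg lm tl.
case: a => [|c a]; first by rewrite scaler0 addr0.
case: s => [|d s] /=; last by rewrite mw nu_mulDr nu_scaler.
by rewrite nu_mulDr nu_scaler nu_mulDl nu_scalel.
Qed.

Lemma mlin_gauss_mom m : linear m -> multilinear (gauss_mom m).
Proof. by move=> lm; apply: fixser_mlin => u mu; exact: mlin_pair_step. Qed.

Lemma mlin_cgauss_mom m m' : linear m -> linear m' -> multilinear (cgauss_mom m m').
Proof.
move=> lm lm'; apply: fixser_mlin => u mu; apply: mlin_pair_step => //.
exact: mlin_gauss_mom.
Qed.

Section Limit.
Notation lam := (@lam R).

(** Each block of the composition contributes one factor [lam N], so only the empty
    composition has a constant term. *)
Lemma exp_scomp (V : lmodType R[i]) (f : nat -> seq B -> B) (g : seq B -> B)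
    (u : seq B -> V) b : multilinear u ->
  (forall t, (size t <= size b)%N -> expansion (f^~ t) (g t)) ->
  expansion (fun N => scomp (f N) (fun t => lam N ^+ size t *: u t) b)
            (if b is [::] then u [::] else 0).
Proof.
have [n] := ubnP (size b); elim: n u b => // n IH u [|x b] /= /ltnSE hn mu hf.
  by apply: exp_ext (exp_cst _) => N _ /=; rewrite expr0 scale1r.
rewrite -[0 in X in expansion _ X](splitsum0 (F := fun _ _ : seq B => 0 : V) (s := b)) //.
apply: (exp_ext (u := fun N => splitsum (fun a c => lam N *: scomp (f N)
    (fun t => lam N ^+ size t *: u (f N (x :: a) :: t)) c) b)) => [N _|].
  rewrite -[RHS]/(scomp (f N) _ (x :: b)) scomp_cons; apply: eq_splitsum => a c _.
  rewrite -(scomp_linear (f N) _ c (f := fun z => lam N *: z)); last first.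
    by move=> k y z; rewrite scalerDr !scalerA mulrC.
  by apply: eq_scomp => t /=; rewrite scalerA -exprS.
apply: exp_splitsum => a c ac;
apply: (exp_lam (l := if c is [::] then u [:: g (x :: a)] else 0)).
pose G z : V := if c is [::] then u [:: z] else 0.
apply: (@exp_family R B V (fun N z => scomp (f N)
    (fun t => lam N ^+ size t *: u (z :: t)) c) G (fun N => f N (x :: a))).
- move=> N k y z; rewrite -scomp_lin; apply: eq_scomp => t.
  by have /= -> := mu [::] t k y z; rewrite scalerDr !scalerA mulrC.
- move=> z; rewrite /G.
  have hc : (size c < n)%N by apply: leq_trans hn; rewrite -ac size_cat ltnS leq_addl.
  have := IH (fun t => u (z :: t)) c hc (mlin_cons z mu); apply => t tc.
  by apply: hf; rewrite (leq_trans tc) // -ac size_cat leqW // leq_addl.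
- by apply: hf; rewrite /= ltnS -ac size_cat leq_addr.
Qed.

Variables (r : seq B -> B) (rN : nat -> seq B -> B).
Hypothesis mr : multilinear r.
Hypothesis r0 : r [::] = 0.
Hypothesis rNE : forall N s, (0 < N)%N -> rN N s = lam N ^+ (size s).-1 *: r s.

(** A single block carries no factor [lam N]; every further block carries one. *)
Lemma exp_scomp_cum (f : nat -> seq B -> B) (g : seq B -> B) x s :
  (forall t, (size t <= size (x :: s))%N -> expansion (f^~ t) (g t)) ->
  expansion (fun N => scomp (f N) (rN N) (x :: s)) (r [:: g (x :: s)]).
Proof.
move=> hf.
have -> : r [:: g (x :: s)] =
    splitsum (fun a c => if c is [::] then r [:: g (x :: a)] else 0) s.
  case/lastP: s {hf} => [|s y]; first by rewrite splitsum_nil.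
  by rewrite splitsum_rcons splitsum0 ?add0r // => a [|? ?].
apply: (exp_ext (u := fun N => splitsum (fun a c => scomp (f N)
    (fun t => lam N ^+ size t *: r (f N (x :: a) :: t)) c) s)) => [N N0|].
  rewrite scomp_cons; apply: eq_splitsum => a c _; apply: eq_scomp => t.
  by rewrite rNE.
apply: exp_splitsum => a c ac.
pose G z : B := if c is [::] then r [:: z] else 0.
apply: (@exp_family R B B (fun N z => scomp (f N)
    (fun t => lam N ^+ size t *: r (z :: t)) c) G (fun N => f N (x :: a))).
- move=> N k y z; rewrite -scomp_lin; apply: eq_scomp => t.
  by have /= -> := mr [::] t k y z; rewrite scalerDr !scalerA mulrC.
- move=> z; apply: (exp_scomp (u := fun t => r (z :: t))); first exact: mlin_cons.
  by move=> t tc; apply: hf; rewrite (leq_trans tc) //= -ac size_cat leqW // leq_addl.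
- by apply: hf; rewrite /= ltnS -ac size_cat leq_addr.
Qed.

Lemma exp_gsub (f : nat -> seq B -> B) (g : seq B -> B) n :
  (forall t, (size t < n)%N -> expansion (f^~ t) (g t)) ->
  forall a, (size a <= n.+1)%N -> expansion (fun N => gsub (f N) a) (gsub g a).
Proof.
move=> h [|b [|c a]] /= ha; try exact: exp_cst.
apply: exp_mul; last exact: exp_cst.
by apply: exp_mul; [exact: exp_cst | apply: h; rewrite size_belast].
Qed.

Variables (be ga : nat -> seq B -> B) (v w : seq B -> B).
Hypothesis rec : forall N, (0 < N)%N -> cumulant_rec (be N) (ga N) (rN N).

(** Constant terms of the moment recursion: the part of the cumulants in degree one
    is the only one that is not multiplied by a power of [lam N]. *)
Lemma exp_pair_step n :
  (forall t, (size t < n)%N -> expansion (ga^~ t) (v t)) ->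
  (forall t, (size t < n)%N -> expansion (be^~ t) (w t)) ->
  forall s, (size s <= n)%N ->
    expansion (be^~ s) (pair_step (fun x => r [:: x]) v w s).
Proof.
move=> hv hw s sn.
apply: (exp_ext (u := fun N => splitsum (fun a b =>
    tailmul (scomp (gsub (ga N)) (rN N) a) (be N) b) s)) => [N N0|].
  by rewrite -(rec_tail s (rec N0)).
apply: exp_splitsum => -[|x a] b ab.
  apply: (exp_ext _ (exp_cst _)) => N N0.
  rewrite /= rNE // r0 scaler0; case: b {ab} => [|y b] //=.
  by rewrite !nu_mul0.
have ha : (size (x :: a) <= n)%N.
  by apply: leq_trans sn; rewrite -ab size_cat leq_addr.
have h1 : expansion (fun N => scomp (gsub (ga N)) (rN N) (x :: a)) (r [:: gsub v (x :: a)]).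
  apply: exp_scomp_cum => t ta; apply: exp_gsub hv _ _.
  by rewrite (leq_trans ta) // (leq_trans ha).
case: b ab => [|y b] ab //=.
apply: exp_mul; first by apply: exp_mul => //; exact: exp_cst.
apply: hw; apply: leq_trans sn.
by rewrite -ab size_cat /= addSn ltnS addnS leqW // leq_addl.
Qed.

End Limit.
End MomentRecursion.

(** * Non-crossing pairings as involutions *)

Section NcInvolution.
Local Open Scope nat_scope.

(** A non-crossing perfect matching of the interval from [lo] to [hi] (excluded). *)
Definition ncseg (p : nat -> nat) (lo hi : nat) : Prop :=
  (forall i, lo <= i < hi -> [/\ lo <= p i < hi, p (p i) = i & p i <> i]) /\
  (forall i j, lo <= i < hi -> lo <= j < hi -> i < j -> j < p i -> p i < p j -> False).

Lemma ncseg_first p lo hi : ncseg p lo hi -> lo < hi -> lo < p lo < hi.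
Proof. by move=> [h _] lh; have [|h1 h2 h3] := h lo; lia. Qed.

(** A point strictly between [lo] and its partner cannot be paired outside, since that
    pair would cross the first one. *)
Lemma ncseg_inner p lo hi : ncseg p lo hi -> lo < hi -> ncseg p lo.+1 (p lo).
Proof.
move=> H lh; have k := ncseg_first H lh; case: H => h hx.
have hlo : lo <= lo < hi by lia.
have [_ plo _] := h lo hlo.
split=> [i hi1|i j hi1 hj1]; last by apply: hx; lia.
have hi2 : lo <= i < hi by lia.
have [p1 p2 p3] := h i hi2; split => //.
have e1 : p i <> lo by move=> e; move: p2; rewrite e; lia.
have e2 : p i <> p lo by move=> e; move: p2; rewrite e plo; lia.
case: (ltnP (p lo) (p i)) => c; last by lia.
by exfalso; apply: (hx lo i hlo hi2) => //; lia.
Qed.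

Lemma ncseg_outer p lo hi : ncseg p lo hi -> lo < hi -> ncseg p (p lo).+1 hi.
Proof.
move=> H lh; have k := ncseg_first H lh; have I := ncseg_inner H lh.
case: H => h hx; case: I => I _.
have hlo : lo <= lo < hi by lia.
have [_ plo _] := h lo hlo.
split=> [i hi1|i j hi1 hj1]; last by apply: hx; lia.
have hi2 : lo <= i < hi by lia.
have [p1 p2 p3] := h i hi2; split => //.
have e1 : p i <> lo by move=> e; move: p2; rewrite e; lia.
have e2 : p i <> p lo by move=> e; move: p2; rewrite e plo; lia.
case: (ltnP (p lo) (p i)) => c; first by lia.
have c' : lo < p i < p lo by lia.
by have [] := I (p i) c'; rewrite p2; lia.
Qed.

Lemma ncseg_congr p q lo hi : (forall i, lo <= i < hi -> p i = q i) ->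
  ncseg p lo hi -> ncseg q lo hi.
Proof.
move=> pq [h hx]; split=> [i hi1|i j hi1 hj1].
  have [h1 h2 h3] := h i hi1; rewrite -pq // -pq //.
by rewrite -!pq //; exact: hx.
Qed.

End NcInvolution.

Section Involutions.
Variable m : nat.
Local Open Scope nat_scope.
Implicit Types f g : {ffun 'I_m -> 'I_m}.

Definition fnat f (i : nat) : nat := if insub i is Some o then val (f o) else i.

Lemma fnatE f (i : 'I_m) : fnat f i = f i.
Proof. by rewrite /fnat valK. Qed.

(** Being the identity off the interval makes the pairing of the interval determine
    the function. *)
Definition nc_inv (lo hi : nat) f : bool :=
  `[< ncseg (fnat f) lo hi /\ forall i : 'I_m, ~~ (lo <= i < hi) -> f i = i >].

Lemma nc_inv_out f lo hi : nc_inv lo hi f -> forall i : 'I_m, ~~ (lo <= i < hi) -> f i = i.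
Proof. by move/asboolP => []. Qed.

Lemma nc_inv_nil lo f : nc_inv lo lo f = (f == [ffun i => i]).
Proof.
apply/asboolP/eqP => [[_ h]|->].
  by apply/ffunP => i; rewrite ffunE h //; apply/negP; lia.
split=> [|i _]; last by rewrite ffunE.
by split=> [i|i j]; lia.
Qed.

Definition restr (a b : nat) f : {ffun 'I_m -> 'I_m} :=
  [ffun i : 'I_m => if a <= i < b then f i else i].

Definition nc_glue (l k : 'I_m) f1 f2 : {ffun 'I_m -> 'I_m} :=
  [ffun i : 'I_m => if i == l then k else if i == k then l else
                    if l < i < k then f1 i else f2 i].

Lemma fnat_restr a b f i : a <= i < b -> fnat (restr a b f) i = fnat f i.
Proof.
by move=> hi1; rewrite /fnat; case: insubP => //= o _ oi; rewrite ffunE oi hi1.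
Qed.

Lemma nc_inv_restr a b f : ncseg (fnat f) a b -> nc_inv a b (restr a b f).
Proof.
move=> h; apply/asboolP; split; first by apply: ncseg_congr h => i hi1; rewrite fnat_restr.
by move=> i /negbTE hi1; rewrite ffunE hi1.
Qed.

Section Glue.
Variables (l k : 'I_m) (hi : nat).
Hypotheses (lk : l < k) (kh : k < hi) (hm : hi <= m).

Lemma fnat_glue f1 f2 i : i < m -> fnat (nc_glue l k f1 f2) i =
  if i == l then val k else if i == k then val l else
  if l < i < k then fnat f1 i else fnat f2 i.
Proof.
move=> im; have [x <-] : exists x : 'I_m, val x = i by exists (Ordinal im).
rewrite !fnatE ffunE -!val_eqE /=.
by do 3 case: ifP => //.
Qed.

Lemma nc_inv_glue f1 f2 : nc_inv l.+1 k f1 -> nc_inv k.+1 hi f2 -> nc_inv l hi (nc_glue l k f1 f2).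
Proof.
move=> /asboolP[[h1 x1] o1] /asboolP[[h2 x2] o2]; apply/asboolP.
pose p1 := fnat f1; pose p2 := fnat f2; pose p := fnat (nc_glue l k f1 f2).
have pE i : i < m -> p i = if i == l then val k else if i == k then val l else
  if l < i < k then p1 i else p2 i by exact: fnat_glue.
have pl : p l = k by rewrite pE ?ltn_ord // eqxx.
have pk : p k = l by rewrite pE ?ltn_ord // (gtn_eqF lk) eqxx.
have p_in i : l < i < k -> p i = p1 i.
  by move=> h; rewrite pE; [do 2 (case: eqP => [?|_]; first by lia); rewrite h | lia].
have p_out i : k < i < hi -> p i = p2 i.
  by move=> h; rewrite pE; [do 2 (case: eqP => [?|_]; first by lia); case: ifP => //; lia | lia].
have cases i : l <= i < hi -> [\/ i = l, i = k, l < i < k | k < i < hi].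
  move=> h; case: (ltngtP i k) => c; last by constructor 2.
    by case: (ltngtP i l) => c'; [lia | constructor 3; lia | constructor 1].
  by constructor 4; lia.
split; last first.
  move=> i hi1; rewrite ffunE -!val_eqE /=.
  do 2 (case: eqP => [?|_]; first by lia).
  by case: ifP => [|_]; [lia | apply: o2; lia].
split=> [i /cases[->|->|h|h]|i j].
- by rewrite -/p pl pk; split; lia.
- by rewrite -/p pk pl; split; lia.
- have [a b c] := h1 i h; rewrite -/p p_in // p_in //; split => //; rewrite /p1; lia.
- have [a b c] := h2 i h; rewrite -/p p_out // p_out //; split => //; rewrite /p2; lia.
rewrite -/p => /cases[->|->|h|h] /cases[->|->|h'|h']; rewrite ?pl ?pk; try lia.
- by have [a b c] := h1 j h'; rewrite (p_in j) //; rewrite /p1; lia.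
- have [a b c] := h1 i h; rewrite (p_in i) // (p_in j) // => ? ? ?.
  by apply: (x1 i j) => //.
- have [a b c] := h1 i h; rewrite (p_in i) // /p1; lia.
- have [a b c] := h2 i h; rewrite (p_out i) // (p_out j) // => ? ? ?.
  by apply: (x2 i j) => //.
Qed.

Lemma glueK f1 f2 : nc_inv l.+1 k f1 -> nc_inv k.+1 hi f2 ->
  (restr l.+1 k (nc_glue l k f1 f2) = f1) /\ (restr k.+1 hi (nc_glue l k f1 f2) = f2).
Proof.
move=> n1 n2; split; apply/ffunP => i; rewrite ffunE; case: ifPn => hi1.
- rewrite ffunE -!val_eqE /=; do 2 (case: eqP => [?|_]; first by lia).
  by rewrite hi1.
- by rewrite (nc_inv_out n1).
- rewrite ffunE -!val_eqE /=; do 2 (case: eqP => [?|_]; first by lia).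
  by case: ifP => //; lia.
- by rewrite (nc_inv_out n2).
Qed.

Lemma restrK f : nc_inv l hi f -> f l = k ->
  nc_glue l k (restr l.+1 k f) (restr k.+1 hi f) = f.
Proof.
move=> /asboolP[[h _] o] fl; apply/ffunP => i; rewrite ffunE.
have fk : f k = l.
  have [|_ e _] := h l; first by lia.
  by apply/val_inj; move: e; rewrite fnatE fl fnatE.
case: eqP => [->|/eqP il]; first by rewrite fl.
case: eqP => [->|/eqP ik]; first by rewrite fk.
move: il ik; rewrite -!val_eqE /= => il ik.
case: ifP => hik; first by rewrite ffunE hik.
rewrite ffunE; case: ifPn => // hik'; rewrite o //; apply/negP; lia.
Qed.

End Glue.

(** By [ncseg_inner] and [ncseg_outer] the partner [k] of the first point separates the
    points between the two from those after [k]. *)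
Lemma sum_nc_inv_split (V : nmodType) (l : 'I_m) hi (F : {ffun 'I_m -> 'I_m} -> V) :
  l < hi -> hi <= m ->
  (\sum_(f | nc_inv l hi f) F f = \sum_(k : 'I_m | (l < k < hi)%N)
     \sum_(f1 | nc_inv l.+1 k f1) \sum_(f2 | nc_inv k.+1 hi f2) F (nc_glue l k f1 f2))%R.
Proof.
move=> lh hm.
rewrite (partition_big (fun f : {ffun 'I_m -> 'I_m} => f l) (fun k : 'I_m => l < k < hi)) /=.
  apply: eq_bigr => k /andP[lk kh].
  rewrite pair_big_dep /=.
  rewrite (reindex_onto (fun p : {ffun 'I_m -> 'I_m} * {ffun 'I_m -> 'I_m} => nc_glue l k p.1 p.2)
    (fun f => (restr l.+1 k f, restr k.+1 hi f))) /=; last first.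
    by move=> f /andP[nf /eqP fl]; exact: restrK.
  apply: eq_bigl => -[f1 f2] /=; apply/idP/idP => [/andP[/andP[n /eqP gl] /eqP[e1 e2]]|/andP[n1 n2]].
    have H : ncseg (fnat (nc_glue l k f1 f2)) l hi by move/asboolP: n => [].
    have gk : fnat (nc_glue l k f1 f2) l = k by rewrite fnatE gl.
    have I := ncseg_inner H lh; have O := ncseg_outer H lh; rewrite gk in I O.
    by rewrite -[X in nc_inv _ _ X && _]e1 -[X in _ && nc_inv _ _ X]e2 !nc_inv_restr.
  have [e1 e2] := glueK lk kh hm n1 n2.
  by rewrite nc_inv_glue //= e1 e2 eqxx andbT ffunE eqxx.
move=> f /asboolP[h _]; have := ncseg_first h lh; by rewrite fnatE.
Qed.

End Involutions.

(** * Involutions and set partitions into pairs *)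

Section PairingBijection.
Variable m : nat.
Local Open Scope set_scope.
Local Open Scope nat_scope.
Implicit Types (f : {ffun 'I_m -> 'I_m}) (P : {set {set 'I_m}}).

Definition partner_fun P : {ffun 'I_m -> 'I_m} :=
  [ffun i : 'I_m => odflt i [pick j | (val j != val i) &&
        [exists U in P, (j \in U) && [exists l in U, val l == val i]]]].

Definition orbits f : {set {set 'I_m}} := [set [set i; f i] | i : 'I_m].

Lemma partnerE P (i : 'I_m) : partner P i = partner_fun P i.
Proof. by rewrite /partner ffunE; case: pickP. Qed.

Lemma fnat_partner P i : i < m -> fnat (partner_fun P) i = partner P i.
Proof.
move=> im; have [x <-] : exists x : 'I_m, val x = i by exists (Ordinal im).
by rewrite fnatE partnerE.
Qed.

Section OrbitsOf.
Variable f : {ffun 'I_m -> 'I_m}.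
Hypothesis nf : nc_inv 0 m f.

Lemma nc_invK i : f (f i) = i.
Proof.
have [[h _] _] := asboolP _ nf; have [|_ e _] := h i; first exact: ltn_ord.
by apply: val_inj; move: e; rewrite !fnatE.
Qed.

Lemma nc_inv_neq i : f i != i.
Proof.
have [[h _] _] := asboolP _ nf; have [|_ _ e] := h i; first exact: ltn_ord.
by apply/eqP => e'; apply: e; rewrite fnatE e'.
Qed.

Lemma nc_inv_cross (i j : 'I_m) : i < j -> j < f i -> f i < f j -> False.
Proof.
have [[_ h] _] := asboolP _ nf; have := h i j (ltn_ord i) (ltn_ord j).
by rewrite !fnatE.
Qed.

Lemma mem_orbit U i j : U \in orbits f -> i \in U -> (j \in U) = (j == i) || (j == f i).
Proof.
case/imsetP => l _ ->; rewrite !inE => /orP[] /eqP ->; first by [].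
by rewrite nc_invK orbC.
Qed.

Lemma orbit_mem i : [set i; f i] \in orbits f.
Proof. exact: (imset_f (fun i => [set i; f i])). Qed.

Lemma orbit_eq U i : U \in orbits f -> i \in U -> U = [set i; f i].
Proof. by move=> Uf iU; apply/setP => j; rewrite (mem_orbit _ Uf iU) !inE. Qed.

Lemma partner_orbits : partner_fun (orbits f) = f.
Proof.
apply/ffunP => i; rewrite ffunE; case: pickP => [j /andP[ji /existsP[U]]|] /=.
  case/and3P => Uf jU /existsP[l /andP[lU /eqP /val_inj li]]; move: lU; rewrite li => iU.
  move: jU; rewrite (mem_orbit _ Uf iU) => /orP[/eqP e|/eqP //].
  by rewrite e eqxx in ji.
move=> /(_ (f i)) /negbT /negP[]; rewrite val_eqE nc_inv_neq /=.
apply/existsP; exists [set i; f i]; rewrite orbit_mem //= !inE eqxx orbT /=.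
by apply/existsP; exists i; rewrite !inE !eqxx.
Qed.

(** Two blocks cross exactly when the involution has a crossing. *)
Lemma orbits_NC2 : orbits f \in NC2 m.
Proof.
rewrite inE; apply/and3P; split.
- apply/and3P; split.
  + apply/eqP/setP => i; rewrite inE; apply/bigcupP; exists [set i; f i]; first exact: orbit_mem.
    by rewrite !inE eqxx.
  + apply/finset.trivIsetP => U W Uf Wf; apply: contraR => /pred0Pn[i /andP[iU iW]].
    by rewrite (orbit_eq Uf iU) (orbit_eq Wf iW).
  + by apply/negP => /imsetP[i _] /setP /(_ i); rewrite !inE eqxx.
- apply/forall_inP => U Uf; apply/forall_inP => W Wf; apply/implyP => UW.
  apply/negP => /exists_inP[i iU /exists_inP[j jW /exists_inP[k kU /exists_inP[l lW]]]].
  case/andP => /andP[ij jk] kl.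
  have ki : k = f i.
    by move: kU; rewrite (mem_orbit _ Uf iU) => /orP[/eqP e|/eqP //]; rewrite e in jk; lia.
  have lj : l = f j.
    by move: lW; rewrite (mem_orbit _ Wf jW) => /orP[/eqP e|/eqP //]; rewrite e in kl; lia.
  by rewrite ki lj in jk kl; exact: nc_inv_cross ij jk kl.
- apply/forall_inP => U /imsetP[i _ ->].
  by rewrite cards2 [i == _]eq_sym nc_inv_neq.
Qed.

End OrbitsOf.

Section PairingOf.
Variable P : {set {set 'I_m}}.
Hypothesis hP : P \in NC2 m.

Let NC2_and : [&& finset.partition P [set: 'I_m], noncrossing P &
  [forall U in P, #|U| == 2]].
Proof. by move: hP; rewrite inE. Qed.

Lemma NC2_block i : exists2 U, U \in P & i \in U.
Proof.
have /and3P[/and3P[/eqP cP _ _] _ _] := NC2_and.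
by have := finset.in_setT i; rewrite -cP => /bigcupP[U UP iU]; exists U.
Qed.

Lemma NC2_eq U W i : U \in P -> W \in P -> i \in U -> i \in W -> U = W.
Proof.
have /and3P[/and3P[_ tP _] _ _] := NC2_and.
move=> UP WP iU iW; apply/eqP; apply: contraT => UW.
have /pred0P/(_ i) := finset.trivIsetP tP U W UP WP UW.
by rewrite /= iU iW.
Qed.

(** The blocks are pairwise disjoint of size two, so the block of [i] consists of [i] and
    its partner. *)
Lemma NC2_pair i : partner_fun P i != i /\ [set i; partner_fun P i] \in P.
Proof.
have /and3P[_ _ /forall_inP cP] := NC2_and.
have [U UP iU] := NC2_block i.
have /cards2P[a [b [ab UE]]] := cP U UP.
rewrite ffunE; case: pickP => [j /andP[ji /existsP[W]]|] /=.
  case/and3P => WP jW /existsP[l /andP[lW /eqP /val_inj li]]; rewrite li in lW.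
  have WU := NC2_eq WP UP lW iU; rewrite WU in jW; rewrite -val_eqE; split=> //.
  rewrite (_ : [set i; j] = U) //; apply/eqP; rewrite eqEcard cards2 -val_eqE eq_sym ji.
  rewrite (eqP (cP U UP)) leqnn andbT; apply/fintype.subsetP => x; rewrite !inE.
  by case/orP => /eqP ->.
move=> h; exfalso.
have [c ci cU] : exists2 c, c != i & c \in U.
  move: iU; rewrite UE !inE => /orP[/eqP ->|/eqP ->].
    by exists b; [rewrite eq_sym | rewrite !inE eqxx orbT].
  by exists a; rewrite // !inE eqxx.
have := h c; rewrite val_eqE ci /= => /negbT /negP[].
apply/existsP; exists U; rewrite UP cU /=.
by apply/existsP; exists i; rewrite iU eqxx.
Qed.

Lemma partner_inv i : partner_fun P (partner_fun P i) = i.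
Proof.
set j := partner_fun P i; have [ji jP] := NC2_pair i; have [lj lP] := NC2_pair j.
have e := NC2_eq jP lP (i := j); rewrite !inE eqxx orbT /= in e.
have := e isT isT => /setP /(_ (partner_fun P j)); rewrite !inE eqxx orbT.
by rewrite -/j (negbTE lj) orbF => /eqP.
Qed.

Lemma nc_inv_partner : nc_inv 0 m (partner_fun P).
Proof.
have /and3P[_ /forall_inP nP _] := NC2_and.
apply/asboolP; split; last by move=> i; rewrite ltn_ord.
split=> [i /= im|i j /= im jm].
  have [x <-] : exists x : 'I_m, val x = i by exists (Ordinal im).
  rewrite fnatE fnatE partner_inv ltn_ord; split => // e.
  by have [/eqP h _] := NC2_pair x; apply: h; apply: val_inj.
have [x <-] : exists x : 'I_m, val x = i by exists (Ordinal im).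
have [y <-] : exists y : 'I_m, val y = j by exists (Ordinal jm).
rewrite !fnatE => xy yx xy'.
have [_ Ux] := NC2_pair x; have [_ Uy] := NC2_pair y.
have := nP _ Ux => /forall_inP /(_ _ Uy) /implyP H.
have /H /negP[] : [set x; partner_fun P x] != [set y; partner_fun P y].
  apply/eqP => /setP /(_ y); rewrite !inE eqxx /= => /orP[/eqP e|/eqP e].
    by rewrite e ltnn in xy.
  by rewrite -e ltnn in yx.
apply/exists_inP; exists x; first by rewrite !inE eqxx.
apply/exists_inP; exists y; first by rewrite !inE eqxx.
apply/exists_inP; exists (partner_fun P x); first by rewrite !inE eqxx orbT.
apply/exists_inP; exists (partner_fun P y); first by rewrite !inE eqxx orbT.
by rewrite xy yx xy'.
Qed.

Lemma orbits_partner : orbits (partner_fun P) = P.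
Proof.
have /and3P[/and3P[_ _ n0] _ _] := NC2_and.
apply/setP => U; apply/imsetP/idP => [[i _ ->]|UP]; first by have [] := NC2_pair i.
have [i iU] : exists i, i \in U.
  by apply/set0Pn; apply: contraNneq n0 => <-.
exists i => //; have [_ iP] := NC2_pair i.
by apply: (NC2_eq (i := i)) => //; rewrite !inE eqxx.
Qed.

End PairingOf.

Lemma sum_NC2 (V : nmodType) (F : {ffun 'I_m -> 'I_m} -> V) :
  (\sum_(P in NC2 m) F (partner_fun P) = \sum_(f | nc_inv 0 m f) F f)%R.
Proof.
rewrite [RHS](reindex_onto partner_fun orbits); last by move=> f; exact: partner_orbits.
apply: eq_bigl => P; apply/idP/andP => [hP|[nf /eqP <-]]; last exact: orbits_NC2.
by rewrite nc_inv_partner // orbits_partner.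
Qed.

End PairingBijection.

(** * Sums of nested moments over non-crossing pairings *)

Lemma sum_shift (V : nmodType) m lo hi (G : nat -> V) : (lo < hi)%N -> (hi <= m)%N ->
  \sum_(k < m | (lo < k < hi)%N) G k =
  \sum_(j < hi - lo) (if j == 0%N :> nat then 0 else G (j + lo)%N).
Proof.
move=> lh hm.
rewrite -(big_mkord (fun k => lo < k < hi)%N G).
rewrite -(big_mkord xpredT (fun j => if j == 0%N then 0 else G (j + lo)%N)).
rewrite (eq_bigr (fun j => if (j + lo == lo)%N then 0 else G (j + lo)%N)); last first.
  by move=> j _; rewrite (_ : (j + lo == lo)%N = (j == 0)%N) //; lia.
rewrite -(big_addn 0 hi lo xpredT (fun k => if k == lo then 0 else G k)) add0n.
transitivity (\sum_(lo <= k < hi | k != lo) G k); last first.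
  by rewrite big_mkcond; apply: eq_bigr => k _; case: eqP.
rewrite (@big_nat_widen _ _ _ lo hi m) // (@big_nat_widenl _ _ _ lo 0 m) //.
by apply: eq_bigl => k; lia.
Qed.

Section PairingSums.
Variables (R : realType) (B : cstarAlgType R).
Implicit Types (s : seq B) (p q : nat -> nat).

(** [Vval] and [Wval] below are [V_seg] and [W_seg] with an arbitrary partner function
    and with arbitrary maps [mv], [mw] in place of b |-> Psi (X b X) and
    b |-> Phi (X b X). *)
Definition seg_coef (V : nat -> nat -> B) s (lo k : nat) : B :=
  if k == lo.+1 then s`_lo else s`_lo ** V lo.+1 k ** s`_k.-1.

Section Values.
Variables (mv : B -> B) (s : seq B) (p : nat -> nat).

Fixpoint Vval (d lo hi : nat) : B :=
  if d is d'.+1 then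
    let e := mv (seg_coef (Vval d') s lo (p lo)) in
    if (p lo).+1 == hi then e else e ** s`_(p lo) ** Vval d' (p lo).+1 hi
  else 0.

Variable mw : B -> B.

Fixpoint Wval (d lo hi : nat) : B :=
  if d is d'.+1 then
    let e := mw (seg_coef (Vval d') s lo (p lo)) in
    if (p lo).+1 == hi then e else e ** s`_(p lo) ** Wval d' (p lo).+1 hi
  else 0.

End Values.

Lemma Wval_same mv s p d lo hi : Wval mv s p mv d lo hi = Vval mv s p d lo hi.
Proof. by elim: d lo hi => //= d IH lo hi; rewrite IH. Qed.

(** The recursion starting at [lo] stays inside the interval, because [p] pairs it with
    itself at every stage. *)
Lemma Vval_congr mv s p q d lo hi : (lo < hi)%N -> ncseg p lo hi ->
  (forall i, (lo <= i < hi)%N -> p i = q i) ->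
  Vval mv s p d lo hi = Vval mv s q d lo hi.
Proof.
elim: d lo hi => //= d IH lo hi lh H pq.
have k := ncseg_first H lh; rewrite -pq; last by lia.
have -> : seg_coef (Vval mv s p d) s lo (p lo) = seg_coef (Vval mv s q d) s lo (p lo).
  rewrite /seg_coef; case: eqP => // e; rewrite IH //; first by lia.
    exact: ncseg_inner H lh.
  by move=> i hi1; apply: pq; lia.
case: eqP => // e; rewrite IH //; first by lia.
  exact: ncseg_outer H lh.
by move=> i hi1; apply: pq; lia.
Qed.

Lemma Wval_congr mv mw s p q d lo hi : (lo < hi)%N -> ncseg p lo hi ->
  (forall i, (lo <= i < hi)%N -> p i = q i) ->
  Wval mv s p mw d lo hi = Wval mv s q mw d lo hi.
Proof.
elim: d lo hi => //= d IH lo hi lh H pq.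
have k := ncseg_first H lh; rewrite -pq; last by lia.
have -> : seg_coef (Vval mv s p d) s lo (p lo) = seg_coef (Vval mv s q d) s lo (p lo).
  rewrite /seg_coef; case: eqP => // e; rewrite (@Vval_congr _ _ p q) //; first by lia.
    exact: ncseg_inner H lh.
  by move=> i hi1; apply: pq; lia.
case: eqP => // e; rewrite IH //; first by lia.
  exact: ncseg_outer H lh.
by move=> i hi1; apply: pq; lia.
Qed.

Definition seg s (lo hi : nat) : seq B := take (hi - lo.+1) (drop lo s).

Section Sum.
Variables (mv mw : B -> B) (v w : seq B -> B) (s : seq B).
Hypothesis lmw : linear mw.
Notation m := (size s).+1.
Local Notation Vf f := (Vval mv s (fnat f)).
Local Notation Wf f := (Wval mv s (fnat f) mw).

Lemma size_seg lo hi : (lo < hi <= m)%N -> size (seg s lo hi) = (hi - lo.+1)%N.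
Proof. by move=> h; rewrite /seg size_takel // size_drop; lia. Qed.

Lemma drop_seg lo k hi : (lo < k < hi)%N -> (hi <= m)%N ->
  drop (k - lo) (seg s lo hi) = if k.+1 == hi then [::] else s`_k :: seg s k.+1 hi.
Proof.
move=> h hm; rewrite /seg.
have -> : (hi - lo.+1)%N = (hi - k.+1 + (k - lo))%N by lia.
rewrite -take_drop drop_drop subnK; last by lia.
case: eqP => [<-|e]; first by rewrite subnn take0.
have -> : (hi - k.+1)%N = (hi - k.+2).+1 by lia.
have ks : (k < size s)%N by lia.
by rewrite (drop_nth 0 ks).
Qed.

Lemma take_seg lo k hi : (lo < k < hi)%N -> (hi <= m)%N ->
  gsub v (take (k - lo) (seg s lo hi)) =
  if k == lo.+1 then s`_lo else s`_lo ** v (seg s lo.+1 k) ** s`_k.-1.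
Proof.
move=> h hm; rewrite /seg take_takel; last by lia.
case: eqP => [->|e].
  by rewrite subSnn (drop_nth 0) /= ?take0 //; lia.
have sz : size (take (k - lo) (drop lo s)) = (k - lo)%N.
  by rewrite size_takel // size_drop; lia.
rewrite gsub_long sz; last by lia.
rewrite !nth_take ?nth_drop ?addn0; [|lia|lia].
rewrite (_ : (lo + (k - lo).-1)%N = k.-1); last by lia.
congr (_ ** v _ ** _).
rewrite -drop1 (_ : take (k - lo) _ = take (k - lo.+1 + 1) (drop lo s)) -?take_drop;
  last by congr take; lia.
by rewrite drop_drop add1n take_takel; [congr take; lia | lia].
Qed.

Lemma sum_nc_inv_nil (V : nmodType) lo (F : {ffun 'I_m -> 'I_m} -> V) x :
  (forall f, F f = x) -> \sum_(f | nc_inv lo lo f) F f = x.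
Proof.
by move=> h; rewrite (big_pred1 [ffun i => i]) // => f; rewrite nc_inv_nil.
Qed.

(** Splitting the pairings of the interval at the partner [k] of [lo] separates the
    sum into the inner pairings, over which [mw] is pulled out by linearity, and the
    outer ones; the cuts of the word give the same terms. *)
Lemma sum_seg_step d lo hi : (lo < hi <= m)%N ->
  (forall a b, (a < b <= m)%N -> (b - a <= d)%N ->
     \sum_(f : {ffun 'I_m -> 'I_m} | nc_inv a b f) Vf f d a b = v (seg s a b)) ->
  (forall a b, (a < b <= m)%N -> (b - a <= d)%N ->
     \sum_(f : {ffun 'I_m -> 'I_m} | nc_inv a b f) Wf f d a b = w (seg s a b)) ->
  (hi - lo <= d.+1)%N ->
  \sum_(f : {ffun 'I_m -> 'I_m} | nc_inv lo hi f) Wf f d.+1 lo hi =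
  pair_step mw v w (seg s lo hi).
Proof.
move=> lhm hV hW hd; have [lh hm] := andP lhm.
have lm : (lo < m)%N by exact: leq_trans lh hm.
pose l := Ordinal lm.
rewrite (sum_nc_inv_split (l := l) _ lh hm).
pose S := seg s lo hi.
pose G k := tailmul (mw (gsub v (take (k - lo) S))) w (drop (k - lo) S).
transitivity (\sum_(k < m | (lo < k < hi)%N) G k); last first.
  rewrite sum_shift // /pair_step /splitsum -/S size_seg //.
  rewrite (_ : (hi - lo.+1).+1 = (hi - lo)%N); last by lia.
  apply: eq_bigr => j _; case: eqP => [->|j0]; first by rewrite take0.
  rewrite /G addnK.
  have jm := ltn_ord j.
  have sE : size (take j S) = j by rewrite size_takel // size_seg // -ltnS -subSn // subSS.
  by case: (take j S) sE => [/= e|//]; case: j0; rewrite -e.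
apply: eq_bigr => k lkh'; have lkh : (lo < k < hi)%N := lkh'; have /andP[lk kh] := lkh.
rewrite /G drop_seg // take_seg //.
pose e (f1 : {ffun 'I_m -> 'I_m}) := mw (seg_coef (Vf f1 d) s lo k).
pose tl x (f2 : {ffun 'I_m -> 'I_m}) :=
  if k.+1 == hi then x else x ** s`_k ** Wf f2 d k.+1 hi.
have tlE x : \sum_(f2 | nc_inv k.+1 hi f2) tl x f2 =
    tailmul x w (if k.+1 == hi then [::] else s`_k :: seg s k.+1 hi).
  rewrite /tl; case: eqP => [<-|ne] /=; first exact: sum_nc_inv_nil.
  rewrite -(hW k.+1 hi); [|by lia|by lia].
  rewrite (big_morph (fun y => x ** s`_k ** y) (nu_mulDr _) (nu_mulr0 _)) //.
have eE : \sum_(f1 | nc_inv lo.+1 k f1) e f1 =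
    mw (if k == lo.+1 :> nat then s`_lo else s`_lo ** v (seg s lo.+1 k) ** s`_k.-1).
  rewrite /e /seg_coef; case: eqP => [->|ne]; first exact: sum_nc_inv_nil.
  rewrite -(hV lo.+1 k); [|by lia|by lia].
  by rewrite (big_morph (fun y => mw (s`_lo ** y ** s`_k.-1)) (id1 := 0) (op1 := +%R)) //;
    [move=> x y; rewrite nu_mulDr nu_mulDl (linD lmw) | rewrite nu_mulr0 nu_mul0 (lin0 lmw)].
transitivity (\sum_(f1 | nc_inv lo.+1 k f1) \sum_(f2 | nc_inv k.+1 hi f2) tl (e f1) f2).
  apply: eq_bigr => f1 n1; apply: eq_bigr => f2 n2.
  have n := nc_inv_glue (l := l) lk kh hm n1 n2.
  have gl : fnat (nc_glue l k f1 f2) lo = k.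
    by rewrite -[lo]/(val l) fnatE ffunE eqxx.
  have H1 : ncseg (fnat f1) lo.+1 k by move/asboolP: n1 => [].
  have H2 : ncseg (fnat f2) k.+1 hi by move/asboolP: n2 => [].
  rewrite /= gl /tl /e.
  have -> : seg_coef (Vf (nc_glue l k f1 f2) d) s lo k = seg_coef (Vf f1 d) s lo k.
    rewrite /seg_coef; case: eqP => // ne; congr (_ ** _ ** _).
    apply/esym; apply: Vval_congr => //; first by lia.
    move=> i hi1; rewrite fnat_glue; last by lia.
    have -> : (i == l) = false by apply/eqP => /= ?; lia.
    have -> : (i == k) = false by apply/eqP => ?; lia.
    by rewrite /= hi1.
  case: eqP => // ne; congr (_ ** _).
  apply/esym; apply: Wval_congr => //; first by lia.
  move=> i hi1; rewrite fnat_glue; last by lia.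
  have -> : (i == l) = false by apply/eqP => /= ?; lia.
  have -> : (i == k) = false by apply/eqP => ?; lia.
  by case: ifP => //=; lia.
under eq_bigr do rewrite tlE.
rewrite -eE; case: (k.+1 == hi) => //=.
rewrite (big_morph (fun x => x ** s`_k ** w (seg s k.+1 hi)) (id1 := 0) (op1 := +%R)) //.
  by move=> x y; rewrite !nu_mulDl.
by rewrite !nu_mul0.
Qed.

End Sum.

Lemma sum_V mv v s d lo hi : linear mv -> pair_step mv v v = v ->
  (lo < hi <= (size s).+1)%N -> (hi - lo <= d)%N ->
  \sum_(f : {ffun 'I_(size s).+1 -> 'I_(size s).+1} | nc_inv lo hi f)
     Vval mv s (fnat f) d lo hi = v (seg s lo hi).
Proof.
move=> lmv vE; elim: d lo hi => [|d IH] lo hi lh hd; first by lia.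
rewrite -[in RHS]vE -(sum_seg_step lmv lh IH) //; last first.
  by move=> a b ab hd'; rewrite -IH //; apply: eq_bigr => f _; rewrite Wval_same.
by apply: eq_bigr => f _; rewrite Wval_same.
Qed.

Lemma sum_W mv mw v w s d lo hi : linear mv -> linear mw ->
  pair_step mv v v = v -> pair_step mw v w = w ->
  (lo < hi <= (size s).+1)%N -> (hi - lo <= d)%N ->
  \sum_(f : {ffun 'I_(size s).+1 -> 'I_(size s).+1} | nc_inv lo hi f)
     Wval mv s (fnat f) mw d lo hi = w (seg s lo hi).
Proof.
move=> lmv lmw vE wE; elim: d lo hi => [|d IH] lo hi lh hd; first by lia.
rewrite -[in RHS]wE -(sum_seg_step lmw lh _ IH) //.
by move=> a b ab hd'; exact: sum_V.
Qed.

Variables (A : nuAlgType R) (iota : B -> A) (Phi Psi : A -> B) (X : A).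
Hypotheses (li : linear iota) (lPhi : linear Phi) (lPsi : linear Psi).

Definition second (E : A -> B) (b : B) : B := E (X ** iota b ** X).

Lemma lin_second E : linear E -> linear (second E).
Proof.
by move=> lE a x y; rewrite /second li nu_mulDr nu_scaler nu_mulDl nu_scalel lE.
Qed.

Lemma seg_argE E (V V' : nat -> nat -> B) s lo k : (forall a b, V a b = V' a b) ->
  E (seg_arg iota X s V lo k) = second E (seg_coef V' s lo k).
Proof. by move=> h; rewrite /seg_arg /seg_coef /second; case: eqP; rewrite ?h. Qed.

Lemma V_segE m (P : {set {set 'I_m}}) s d lo hi :
  V_seg iota Psi X P s d lo hi = Vval (second Psi) s (partner P) d lo hi.
Proof. by elim: d lo hi => //= d IH lo hi; rewrite (seg_argE _ _ _ _ IH) IH. Qed.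

Lemma W_segE m (P : {set {set 'I_m}}) s d lo hi :
  W_seg iota Phi Psi X P s d lo hi =
  Wval (second Psi) s (partner P) (second Phi) d lo hi.
Proof.
elim: d lo hi => //= d IH lo hi; rewrite IH.
by rewrite (seg_argE _ _ _ _ (@V_segE m P s d)).
Qed.

Lemma sum_V_pairing s :
  \sum_(P in NC2 (size s).+1) V_pairing iota Psi X P s = gauss_mom (second Psi) s.
Proof.
set m := (size s).+1.
have segE : seg s 0 m = s by rewrite /seg drop0 subn1 take_size.
rewrite -[in RHS]segE -(sum_V (d := m) (lin_second lPsi) (gauss_momE _)) ?subn0 ?leqnn //.
rewrite -(sum_NC2 (fun f => Vval (second Psi) s (fnat f) m 0 m)).
apply: eq_bigr => P hP; rewrite /V_pairing V_segE; apply/esym/Vval_congr => //.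
  by have /asboolP[] := nc_inv_partner hP.
by move=> i im; exact: fnat_partner.
Qed.

Lemma sum_W_pairing s :
  \sum_(P in NC2 (size s).+1) W_pairing iota Phi Psi X P s =
  cgauss_mom (second Psi) (second Phi) s.
Proof.
set m := (size s).+1.
have segE : seg s 0 m = s by rewrite /seg drop0 subn1 take_size.
rewrite -[in RHS]segE -(sum_W (d := m) (lin_second lPsi) (lin_second lPhi)
  (gauss_momE _) (cgauss_momE _ _)) ?subn0 ?leqnn //.
rewrite -(sum_NC2 (fun f => Wval (second Psi) s (fnat f) (second Phi) m 0 m)).
apply: eq_bigr => P hP; rewrite /W_pairing W_segE; apply/esym/Wval_congr => //.
  by have /asboolP[] := nc_inv_partner hP.
by move=> i im; exact: fnat_partner.
Qed.

End PairingSums.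

(** * Cancellation in a C*-algebra *)

Section CstarFaithful.
Variables (R : realType) (B : cstarAlgType R).

Lemma star0 : star (0 : B) = 0.
Proof. by have := starZ 0 (0 : B); rewrite scale0r conjc0 scale0r. Qed.

(** With z = x - y, the assumption at b = z* gives z z* = 0, hence z = 0 by the
    C*-identity.  This replaces evaluation at a unit. *)
Lemma cstar_cancel (x y : B) : (forall b, x ** b = y ** b) -> x = y.
Proof.
move=> h; apply/eqP; rewrite -subr_eq0 -(starK (x - y)).
have z0 : star (star (x - y)) ** star (x - y) = 0.
  by rewrite starK nu_mulDl h -nu_mulDl addrN nu_mul0.
have : `|star (x - y)| ^+ 2 = 0 by rewrite -cstar_norm z0 normr0.
by move/eqP; rewrite expf_eq0 /= normr_eq0 => /eqP ->; rewrite star0.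
Qed.

End CstarFaithful.

(** * Generated star-subalgebras *)

Section StarGenerated.
Variables (R : realType) (B A : starAlgType R) (iota : B -> A) (X : A).
Notation S := (star_generated iota X).

Lemma star_generated_sub : star_subalgebra S.
Proof.
split=> [M [[M0 _ _ _] _]|a x y Sx Sy M HM|x y Sx Sy M HM|x Sx M HM] //.
- by have [_ h _ _] := HM.1; apply: h; [exact: Sx | exact: Sy].
- by have [_ _ h _] := HM.1; apply: h; [exact: Sx | exact: Sy].
- by have [_ _ _ h] := HM.1; apply: h; exact: Sx.
Qed.

Lemma star_generated_iota b : S (iota b).
Proof. by move=> M [_ h]; apply: h; left; exists b. Qed.

Lemma star_generated_elt : S X.
Proof. by move=> M [_ h]; apply: h; right. Qed.

End StarGenerated.

(** * Functionals on noncommutative polynomials *)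

Section NcFunctional.
Variables (R : realType) (B : nuAlgType R).

(** On a monomial b_0 xi b_1 ... xi b_k the outer coefficients factor out, which is the
    shape of [gsub v]: it sends it to b_0 v(b_1, ..., b_(k-1)) b_k, and b_0 to itself. *)
Definition nc_fun (v : seq B -> B) : ncpoly B -> B := nc_eval (gsub v).

Lemma gsub_mull (v : seq B -> B) b s : s != [::] -> gsub v (word_mul [:: b] s) = b ** gsub v s.
Proof. by case: s => [|c [|d s]] //= _; rewrite !mulgA. Qed.

Lemma gsub_mulr (v : seq B -> B) b x s : gsub v (word_mul (x :: s) [:: b]) = gsub v (x :: s) ** b.
Proof.
case: s => [|c s] //.
have -> : word_mul [:: x, c & s] [:: b] = x :: rcons (belast c s) (last c s ** b).
  congr (x :: _); elim: s c => [|d s IH] c //.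
  by rewrite /= -IH.
by case: s => [|d s] /=; rewrite ?belast_rcons ?last_rcons !mulgA.
Qed.

Lemma nc_fun_cond v : multilinear v -> conditional_expectation (@nc_const R B) (nc_fun v).
Proof.
move=> mv; have mg := mlin_gsub mv; split.
- by move=> a f g; rewrite /nc_fun nc_evalD // nc_evalZ.
- move=> b f; rewrite /nc_fun nc_evalM // [LHS]nc_evalE; last first.
    by apply: nc_eval_mlin => t; exact: word_mul_mlin_l.
  rewrite /nc_sum big_seq1 /= /nc_eval /nc_sum.
  rewrite [RHS](big_morph (fun x => b ** x) (nu_mulDr b) (nu_mulr0 b)).
  by apply: eq_bigr => w _; rewrite -gsub_mull.
- move=> f b; rewrite /nc_fun nc_evalM // /nc_eval /nc_sum.
  rewrite [RHS](big_morph (fun x => x ** b) (fun x y => nu_mulDl x y b) (nu_mul0 b)).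
  apply: eq_bigr => w _; rewrite -gsub_mulr.
  rewrite -[LHS]/(nc_eval (fun t => gsub v (word_mul (w.1 :: w.2) t)) (ncpoly_of [:: (b, [::])])).
  by rewrite (nc_evalE _ (word_mul_mlin_r mg _ _)) /nc_sum big_seq1.
- by move=> b; rewrite /nc_fun /nc_const /nc_mono nc_evalE // /nc_sum big_seq1.
Qed.

Lemma nc_fun_mono v b b' s : multilinear v ->
  nc_fun v (nc_mono b (rcons s b')) = b ** v s ** b'.
Proof.
move=> mv; rewrite /nc_fun /nc_mono nc_evalE; last exact: mlin_gsub.
rewrite /nc_sum big_seq1 /=; case: s => [|c s] //=.
by rewrite belast_rcons last_rcons.
Qed.

End NcFunctional.

Section Evaluation.
Variables (R : realType) (B : cstarAlgType R) (A : nuAlgType R) (iota : B -> A) (X : A).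

Lemma mono_atE b s c : mono_at iota X (b :: rcons s c) =
  iota b ** moment_word iota X s ** iota c.
Proof.
elim/last_ind: s c => [|s d IH] c //.
rewrite /mono_at -cats1 foldl_cat -/(mono_at iota X (b :: rcons s d)) IH /=.
by rewrite /moment_word -cats1 foldl_cat /= !mulgA.
Qed.

Lemma cond_nc_at (E : A -> B) f : linear iota -> conditional_expectation iota E ->
  E (nc_at iota X f) = nc_fun (mom iota X E) f.
Proof.
move=> li [lE El Er Ei]; rewrite /nc_at /nc_fun /nc_eval /nc_sum.
rewrite (big_morph E (linD lE) (lin0 lE)); apply: eq_bigr => -[b s] _.
case/lastP: s => [|s c]; first exact: Ei.
rewrite [LHS](congr1 E (mono_atE b s c)) Er El /mom /=.
by case: s => [|d s] //=; rewrite belast_rcons last_rcons.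
Qed.

End Evaluation.

(** * The central limit theorem *)

Section NormalizedSum.
Variables (R : realType) (B : cstarAlgType R) (A : starAlgType R).
Variables (iota : B -> A) (Phi Psi : A -> B) (X : nat -> A).
Hypothesis emb : star_embedding iota.
Hypothesis condPhi : conditional_expectation iota Phi.
Hypothesis condPsi : conditional_expectation iota Psi.
Hypothesis free : cfree (fun n => star_generated iota (X n)) Phi Psi.
Variables ga be : seq B -> B.
Hypothesis gaE : forall n, mom iota (X n) Psi = ga.
Hypothesis beE : forall n, mom iota (X n) Phi = be.

Notation lam := (@lam R).

(** Adding N identically distributed variables and scaling by 1 / sqrt N multiplies the
    component of degree n of the cumulants by N * N^(-(n+1)/2). *)
Lemma cumulants_sum (N : nat) r c : multilinear r -> multilinear c ->
  cumulant_rec ga ga r -> cumulant_rec be ga c ->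
  let S := normalized_sum X N in
  let rN s := (lam N ^+ (size s).+1 * N%:R) *: r s in
  let cN s := (lam N ^+ (size s).+1 * N%:R) *: c s in
  [/\ cumulant_rec (mom iota S Psi) (mom iota S Psi) rN,
      cumulant_rec (mom iota S Phi) (mom iota S Psi) cN,
      R_transform iota Psi S = ser_in rN &
      cR_transform iota Phi Psi S = ser_in cN].
Proof.
move=> mr mc hr hc S rN cN.
have [li _ iM _] := emb.
have [lPhi _ _ _] := condPhi; have [lPsi _ _ _] := condPsi.
have cpX n : cumulant_pair iota Phi Psi (X n) r c.
  by apply: rec_cumulant_pair => //; rewrite ?gaE ?beE.
have sg n := star_generated_sub iota (X n).
have cpS : cumulant_pair iota Phi Psi S rN cN.
  have D1 n x y : star_generated iota (X n) x -> star_generated iota (X n) y ->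
      star_generated iota (X n) (x + y).
    by have [_ h _ _] := sg n => hx hy; rewrite -[x]scale1r; exact: h.
  have D2 n x : star_generated iota (X n) x -> star_generated iota (X n) (- x).
    by have [h0 h _ _] := sg n => hx; rewrite -scaleN1r -[_ *: _]addr0; exact: h.
  have D3 n x y : star_generated iota (X n) x -> star_generated iota (X n) y ->
      star_generated iota (X n) (x ** y).
    by have [_ _ h _] := sg n; exact: h.
  have D0 n : star_generated iota (X n) 0 by have [] := sg n.
  have cs := cumulant_pair_sum li condPhi condPsi free D0 D1 D2 D3
    (fun n => @star_generated_elt R B A iota (X n))
    (fun n b => @star_generated_iota R B A iota (X n) b) cpX (iota_uniq 0 N).
  have := cumulant_pair_dil li condPhi condPsi (lam N) cs.
  have -> : lam N *: \sum_(i <- seq.iota 0 N) X i = S.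
    by rewrite /S /normalized_sum -(big_mkord xpredT X) /index_iota subn0.
  have cE (u : seq B -> B) : dil_cum (lam N) (fun s => \sum_(i <- seq.iota 0 N) u s) =
      (fun s => (lam N ^+ (size s).+1 * N%:R) *: u s).
    apply/funext => s; rewrite /dil_cum /dil big_const_seq count_predT size_iota.
    by rewrite iter_addr_0 -scaler_nat !scalerA -exprS.
  by rewrite !cE.
have [rS [mrS hrS RS]] := R_ofE (mlin_mom li S lPsi).
have [cS [mcS hcS CS]] := cR_ofE (mlin_mom li S lPhi) (mlin_mom li S lPsi).
have := rec_cumulant_pair li iM condPhi condPsi mrS mcS hrS hcS.
move=> /(cumulant_pair_uniq li iM condPsi (@cstar_cancel R B) cpS) [er ec].
by rewrite -er in hrS RS; rewrite -ec in hcS CS.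
Qed.
End NormalizedSum.

Section CentralLimit.
Variables (R : realType) (B : cstarAlgType R) (A : starAlgType R).
Variables (iota : B -> A) (Phi Psi : A -> B) (X : nat -> A).
Hypothesis emb : star_embedding iota.
Hypothesis condPhi : conditional_expectation iota Phi.
Hypothesis condPsi : conditional_expectation iota Psi.
Hypothesis free : cfree (fun n => star_generated iota (X n)) Phi Psi.
Hypothesis idPhi : forall n, mom iota (X n) Phi = mom iota (X 0%N) Phi.
Hypothesis idPsi : forall n, mom iota (X n) Psi = mom iota (X 0%N) Psi.
Hypothesis centered : forall n, Psi (X n) = 0 /\ Phi (X n) = 0.

Notation S N := (normalized_sum X N).
Notation mPsi := (second iota (X 0%N) Psi).
Notation mPhi := (second iota (X 0%N) Phi).

Let li : linear iota. Proof. by case: emb. Qed.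
Let lPhi : linear Phi. Proof. by case: condPhi. Qed.
Let lPsi : linear Psi. Proof. by case: condPsi. Qed.

Lemma scaled_cumulant (u : seq B -> B) N s : (0 < N)%N -> u [::] = 0 ->
  (@lam R N ^+ (size s).+1 * N%:R) *: u s = @lam R N ^+ (size s).-1 *: u s.
Proof.
case: s => [|x s] N0 u0; first by rewrite u0 !scaler0.
by congr (_ *: _); rewrite /= -addn2 exprD -mulrA [_ ^+ 2 * _]mulrC lam_sq // mulr1.
Qed.

Lemma exp_cumulant (u : seq B -> B) s : u [::] = 0 ->
  expansion (fun N => (@lam R N ^+ (size s).+1 * N%:R) *: u s)
            (if s is [:: b] then u s else 0).
Proof.
move=> u0; apply: (exp_ext (u := fun N => @lam R N ^+ (size s).-1 *: u s)).
  by move=> N N0; rewrite scaled_cumulant.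
have := exp_lamX (size s).-1 (exp_cst (u s)).
by case: s => [|b [|c s]] //=; rewrite u0.
Qed.

Theorem central_limit :
  [/\ forall s, exists2 u, forall N, cR_transform iota Phi Psi (S N) s = uz_in (u N) &
        expansion u (if s is [:: b] then mPhi b else 0),
      forall s, exists2 u, forall N, R_transform iota Psi (S N) s = uz_in (u N) &
        expansion u (if s is [:: b] then mPsi b else 0),
      forall s, expansion (fun N => mom iota (S N) Psi s) (gauss_mom mPsi s) &
      forall s, expansion (fun N => mom iota (S N) Phi s) (cgauss_mom mPsi mPhi s)].
Proof.
have [r mr hr] := rec_exists (mlin_mom li (X 0%N) lPsi) (mlin_mom li (X 0%N) lPsi).
have [c mc hc] := rec_exists (mlin_mom li (X 0%N) lPhi) (mlin_mom li (X 0%N) lPsi).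
have sum N := cumulants_sum emb condPhi condPsi free idPsi idPhi N mr mc hr hc.
have r0 : r [::] = 0 by rewrite (rec_nil hr); case: (centered 0).
have c0 : c [::] = 0 by rewrite (rec_nil hc); case: (centered 0).
have r1 : (fun b => r [:: b]) = mPsi.
  by apply/funext => b; rewrite (rec_one b hr r0).
have c1 : (fun b => c [:: b]) = mPhi.
  by apply/funext => b; rewrite (rec_one b hc c0).
have hPsi s : expansion (fun N => mom iota (S N) Psi s) (gauss_mom mPsi s).
  have [n] := ubnP (size s); elim: n s => // n IH s /ltnSE sn.
  rewrite -[gauss_mom mPsi in X in expansion _ X]gauss_momE -{1}r1.
  apply: (exp_pair_step mr r0 _ _ IH IH) sn.
  - by move=> N t N0; exact: scaled_cumulant.
  - by move=> N N0; have [h _ _ _] := sum N; exact: h.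
have hPhi s : expansion (fun N => mom iota (S N) Phi s) (cgauss_mom mPsi mPhi s).
  have [n] := ubnP (size s); elim: n s => // n IH s /ltnSE sn.
  rewrite -[cgauss_mom mPsi mPhi in X in expansion _ X]cgauss_momE -{1}c1.
  apply: (exp_pair_step mc c0 _ _ (fun t _ => hPsi t) IH) sn.
  - by move=> N t N0; exact: scaled_cumulant.
  - by move=> N N0; have [_ h _ _] := sum N; exact: h.
split => // s.
- exists (fun N => (@lam R N ^+ (size s).+1 * N%:R) *: c s).
    by move=> N; have [_ _ _ ->] := sum N.
  have := exp_cumulant s c0; case: s => [|b [|d s]] //.
  by rewrite (congr1 (fun f => f b) c1).
- exists (fun N => (@lam R N ^+ (size s).+1 * N%:R) *: r s).
    by move=> N; have [_ _ -> _] := sum N.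
  have := exp_cumulant s r0; case: s => [|b [|d s]] //.
  by rewrite (congr1 (fun f => f b) r1).
Qed.

End CentralLimit.

Lemma cvg_uB (R : realType) (B : cstarAlgType R) (u : nat -> B) (v : nat -> unitization B) l :
  (forall N, v N = uz_in (u N)) -> expansion u l -> v N @[N --> \oo] --> uB l.
Proof.
move=> e h; rewrite (funext e : v = fun N => uz_in (u N)).
apply: (@cvg_pair _ _ _ _ (nbhs l) (nbhs (0 : R[i]^o)) _ _ _ u (fun=> (0 : R[i]^o))).
  exact: exp_cvg.
exact: cvg_cst.
Qed.

(* The sequence X_1, X_2, ... is X 0, X 1, ... *)
Theorem theorem4p1 (R : realType) (B : cstarAlgType R) :
  exists (nu : (B -> B) -> ncpoly B -> B)
         (mu : (B -> B) -> (B -> B) -> ncpoly B -> B),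
  forall (A : starAlgType R) (iota : B -> A) (Phi Psi : A -> B)
         (X : nat -> A) (fM M : mfseries B),
    star_embedding iota ->
    conditional_expectation iota Phi ->
    conditional_expectation iota Psi ->
    cfree (fun n => star_generated iota (X n)) Phi Psi ->
    (forall n, moment_series iota Phi (X n) = fM) ->
    (forall n, moment_series iota Psi (X n) = M) ->
    (forall n, Psi (X n) = 0 /\ Phi (X n) = 0) ->
    [/\ forall s : seq B,
          cR_transform iota Phi Psi (normalized_sum X N) s @[N --> \oo]
            --> ser_linear (ser1 fM) s,
        forall s : seq B,
          R_transform iota Psi (normalized_sum X N) s @[N --> \oo]
            --> ser_linear (ser1 M) s
      & [/\ conditional_expectation (@nc_const R B) (nu (ser1 M)),
            conditional_expectation (@nc_const R B) (mu (ser1 M) (ser1 fM)),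
            forall f : ncpoly B,
              Psi (nc_at iota (normalized_sum X N) f) @[N --> \oo]
                --> nu (ser1 M) f /\
              Phi (nc_at iota (normalized_sum X N) f) @[N --> \oo]
                --> mu (ser1 M) (ser1 fM) f,
            (* the values at xi b_1 xi ... b_n xi with outer coefficients b, b';
               take b = b' = 1 when B is unital *)
            forall (b b' : B) (s : seq B),
              nu (ser1 M) (nc_mono b (rcons s b')) =
                b ** (\sum_(P in NC2 (size s).+1)
                        V_pairing iota Psi (X 0%N) P s) ** b' /\
              mu (ser1 M) (ser1 fM) (nc_mono b (rcons s b')) =
                b ** (\sum_(P in NC2 (size s).+1)
                        W_pairing iota Phi Psi (X 0%N) P s) ** b'
            (* the limits of the moments at xi b_1 xi ... b_n xi itself, which
               is not in B<xi> when B has no unit *)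
          & forall s : seq B,
              Psi (moment_word iota (normalized_sum X N) s) @[N --> \oo]
                --> \sum_(P in NC2 (size s).+1)
                      V_pairing iota Psi (X 0%N) P s /\
              Phi (moment_word iota (normalized_sum X N) s) @[N --> \oo]
                --> \sum_(P in NC2 (size s).+1)
                      W_pairing iota Phi Psi (X 0%N) P s]].
Proof.
exists (fun m => nc_fun (gauss_mom m)), (fun m m' => nc_fun (cgauss_mom m m')).
move=> A iota Phi Psi X fM M emb cPhi cPsi free hfM hM hc.
have [li _ _ _] := emb.
have [lPhi _ _ _] := cPhi; have [lPsi _ _ _] := cPsi.
have idPhi n : mom iota (X n) Phi = mom iota (X 0%N) Phi.
  by apply: ser_in_inj; rewrite -[LHS]/(moment_series iota Phi (X n)) hfM -(hfM 0%N).
have idPsi n : mom iota (X n) Psi = mom iota (X 0%N) Psi.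
  by apply: ser_in_inj; rewrite -[LHS]/(moment_series iota Psi (X n)) hM -(hM 0%N).
have [cRlim Rlim limPsi limPhi] := central_limit emb cPhi cPsi free idPhi idPsi hc.
have -> : ser1 fM = second iota (X 0%N) Phi by rewrite -(hfM 0%N).
have -> : ser1 M = second iota (X 0%N) Psi by rewrite -(hM 0%N).
have mV := mlin_gauss_mom (lin_second (X 0%N) li lPsi).
have mW := mlin_cgauss_mom (lin_second (X 0%N) li lPsi) (lin_second (X 0%N) li lPhi).
have exp_nc (E : A -> B) (v : seq B -> B) (f : ncpoly B) :
    conditional_expectation iota E ->
    (forall s, expansion (fun N => mom iota (normalized_sum X N) E s) (v s)) ->
    expansion (fun N => E (nc_at iota (normalized_sum X N) f)) (nc_fun v f).
  move=> cE h.
  apply: (exp_ext (u := fun N => nc_fun (mom iota (normalized_sum X N) E) f)).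
    by move=> N _; rewrite cond_nc_at.
  apply: exp_sum => w _; apply: (exp_gsub (n := size w.2)) => // t _; exact: h.
split.
- move=> s; have [u uE eu] := cRlim s.
  have -> : ser_linear (second iota (X 0%N) Phi) s =
     uB (if s is [:: b] then second iota (X 0%N) Phi b else 0) by case: s {u uE eu} => [|b [|]].
  exact: cvg_uB uE eu.
- move=> s; have [u uE eu] := Rlim s.
  have -> : ser_linear (second iota (X 0%N) Psi) s =
     uB (if s is [:: b] then second iota (X 0%N) Psi b else 0) by case: s {u uE eu} => [|b [|]].
  exact: cvg_uB uE eu.
- split.
  + exact: nc_fun_cond.
  + exact: nc_fun_cond.
  + by move=> f; split; apply: exp_cvg; apply: exp_nc.
  + by move=> b b' s; rewrite !nc_fun_mono // sum_V_pairing // sum_W_pairing.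
  + move=> s; rewrite sum_V_pairing // sum_W_pairing //.
    by split; apply: exp_cvg; [exact: limPsi | exact: limPhi].
Qed.
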